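(* Let $\alpha\in\mathbb{R}$, let $B:L^2(\mathbb{R})\to F^2$ be the Bargmann transform and let $\mathcal{F}_\alpha$ be the $\alpha$-angle fractional Fourier transform on $L^2(\mathbb{R})$. Then the operator $T=B\mathcal{F}_\alpha B^{-1}:F^2\to F^2$ is given by $$Tf(z)=f(e^{-i\alpha}z),\qquad z\in\mathbb{C},$$ for all $f\in F^2$.
   Context: The Fock space $F^2$ is the Hilbert space of all entire functions $f$ on $\mathbb{C}$ with $\|f\|^2=\int_{\mathbb{C}}|f(z)|^2\,d\lambda(z)<\infty$, where $d\lambda(z)=\frac1\pi e^{-|z|^2}\,dA(z)$ and $dA$ is area (Lebesgue) measure; its inner product is that of $L^2(\mathbb{C},d\lambda)$. $L^2(\mathbb{R})=L^2(\mathbb{R},dx)$ consists of complex-valued functions. The Bargmann transform $B:L^2(\mathbb{R})\to F^2$ is $$Bf(z)=c\int_{\mathbb{R}} f(x)e^{2xz-x^2-(z^2/2)}\,dx,\qquad c=(2/\pi)^{1/4};$$ it is a well-known fact that $B$ is a unitary operator from $L^2(\mathbb{R})$ onto $F^2$. For $\alpha\in\mathbb{R}$ with $\sin\alpha\ne0$, the $\alpha$-angle fractional Fourier transform is $$\mathcal{F}_\alpha(f)(x)=\frac{\sqrt{1-i\cot\alpha}}{\sqrt{\pi}}\,e^{ix^2\cot\alpha}\int_{\mathbb{R}} e^{-2i\left(xt\csc\alpha-\frac{\cot\alpha}{2}t^2\right)}f(t)\,dt,$$ where the square root is chosen with $\arg\sqrt{1-i\cot\alpha}\in(-\pi/2,\pi/2]$.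 The integral formula is used for $f\in L^1(\mathbb{R})\cap L^2(\mathbb{R})$, and $\mathcal{F}_\alpha$ on $L^2(\mathbb{R})$ is its extension by continuity. For $\alpha=0$ set $\mathcal{F}_\alpha(f)(x)=f(x)$, for $\alpha=\pm\pi$ set $\mathcal{F}_\alpha(f)(x)=f(-x)$, and for other integer multiples of $\pi$ extend $2\pi$-periodically in $\alpha$. *)

(* Defs.v *)
From mathcomp Require Export all_boot all_order all_algebra.
From mathcomp Require Export all_classical all_reals all_analysis.
From mathcomp.real_closed Require Export complex.

Set Implicit Arguments.
Unset Strict Implicit.
Unset Printing Implicit Defensive.
Import Order.TTheory GRing.Theory Num.Theory.
Import numFieldNormedType.Exports.
Import Normc.

Local Open Scope classical_set_scope.
Local Open Scope complex_scope.
Local Open Scope ring_scope.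

(* Complex numbers are [R[i]], with [R] the real numbers. The symbol ['i] has
   two meanings here; ['i%C] is the imaginary unit [0 +i* 1] of [R[i]]. *)

Section FockFrft.
Context {R : realType}.
Local Notation C := R[i].
Local Notation mu := (@lebesgue_measure R).

Definition cexp (z : C) : C :=
  (expR (complex.Re z))%:C * (cos (complex.Im z) +i* sin (complex.Im z)).

(* Lebesgue integral over the real line of an integrable complex function. *)
Definition cintegral (u : R -> C) : C :=
  (\int[mu]_(x in setT) complex.Re (u x)) +i*
  (\int[mu]_(x in setT) complex.Im (u x)).

Definition cmeasurable (u : R -> C) : Prop :=
  measurable_fun setT (fun x => complex.Re (u x)) /\
  measurable_fun setT (fun x => complex.Im (u x)).

Definition norm1 (u : R -> C) : \bar R :=
  Lnorm mu 1%:E (fun x => (normc (u x))%:E).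

Definition norm2 (u : R -> C) : \bar R :=
  Lnorm mu 2%:E (fun x => (normc (u x))%:E).

(* Elements of L^1 and L^2 are represented by functions, not by classes of
   functions modulo equality almost everywhere. *)
Definition inL1 (u : R -> C) : Prop := cmeasurable u /\ (norm1 u < +oo)%E.

Definition inL2 (u : R -> C) : Prop := cmeasurable u /\ (norm2 u < +oo)%E.

(* The derivative is along the scalar field [C] itself, hence this is complex
   differentiability at every point. *)
Definition entire (f : C -> C) : Prop :=
  forall z : C, derivable (f : C^o -> C^o) z 1.

Definition fock_normsq (f : C -> C) : \bar R :=
  (\int[mu \x mu]_(p in setT)
    (normc (f (p.1 +i* p.2)) ^+ 2 *
     (pi^-1 * expR (- normc (p.1 +i* p.2) ^+ 2)))%:E)%E.

Definition fock (f : C -> C) : Prop := entire f /\ (fock_normsq f < +oo)%E.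

Definition bargmann (h : R -> C) (z : C) : C :=
  ((2 / pi) `^ (4^-1))%:C *
  cintegral (fun x => h x * cexp (2 * x%:C * z - x%:C ^+ 2 - z ^+ 2 / 2)).

(* The transform is injective on L^2 up to equality almost everywhere, and it
   does not see the choice of the representative. *)
Definition bargmann_inv (f : C -> C) : R -> C :=
  xget (fun=> 0) [set h : R -> C | inL2 h /\ bargmann h = f].

Definition cot (a : R) : R := cos a / sin a.
Definition csc (a : R) : R := (sin a)^-1.

(* [sqrtc] is the square root with argument in ]-pi/2, pi/2]. *)
Definition frft_integral (a : R) (u : R -> C) (x : R) : C :=
  sqrtc (1 - 'i%C * (cot a)%:C) / (Num.sqrt pi)%:C *
  cexp ('i%C * (x ^+ 2 * cot a)%:C) *
  cintegral (fun t =>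
    cexp (- 2 * 'i%C * (x * t * csc a - cot a / 2 * t ^+ 2)%:C) * u t).

(* [g] is the limit in L^2 of [A u] as [u] in L^1 \cap L^2 tends to [h] in
   L^2. *)
Definition extends_to (A : (R -> C) -> R -> C) (h g : R -> C) : Prop :=
  inL2 g /\
  forall e : R, 0 < e -> exists2 d : R, 0 < d &
    forall u : R -> C, inL1 u -> inL2 u ->
      (norm2 (fun x => u x - h x)%R < d%:E)%E ->
      (norm2 (fun x => A u x - g x)%R < e%:E)%E.

(* When [sin a = 0], [a] is a multiple of pi, an even one iff [cos a = 1]. *)
Definition frft (a : R) (h : R -> C) : R -> C :=
  if sin a == 0 then
    if cos a == 1 then h else fun x => h (- x)
  else xget (fun=> 0) [set g : R -> C | extends_to (frft_integral a) h g].

End FockFrft.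

(* Main.v *)
(* Write w = e^{-i alpha}. Interchanging the two integrals and evaluating the
   inner complex Gaussian integral with parameter a = 1 - i cot alpha, where
   1/a = i w sin alpha, gives B(F_alpha u)(z) = (B u)(w z) for integrable u.

   The passage to L^2 goes through Taylor coefficients. The normalized Hermite
   functions psi_n are orthonormal and B psi_n = z^n / sqrt(n!). Hence (Bessel)
   the coefficients b_n of B h satisfy sum n! |b_n|^2 <= |h|^2, and conversely
   (Riesz-Fischer) every power series with sum n! |b_n|^2 finite is B h for some
   h in L^2 with |h|^2 at most twice that sum. Both conditions are invariant
   under b_n |-> b_n w^n, so for every k in L^2 there is q in L^2 with
   B q = (B k)(w .) and |q|^2 <= 2 |k|^2. Elements of the Fock space satisfy the
   coefficient condition, by averaging |f|^2 over rotations by roots of unity;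
   in particular B is onto.

   Let B g = (B h)(w .). For u in L^1 and L^2 close to h, choose q for
   k = u - h. Then F_alpha u - g and q have the same transform, so they agree
   almost everywhere because B is injective, and F_alpha u is close to g. *)
Require Import Defs.
From mathcomp Require Import measurable_realfun ring lra.
Set Implicit Arguments.
Unset Strict Implicit.
Unset Printing Implicit Defensive.
Import Order.TTheory GRing.Theory Num.Theory.
Import numFieldNormedType.Exports.
Import Normc.
Local Open Scope classical_set_scope.
Local Open Scope complex_scope.
Local Open Scope ring_scope.

(** The pointwise expansion of B h rests on the kernels of B: for fixed z the Hermite coefficients
    of the kernel have squares summing to exp(|z|^2), exactly its squared norm, so its Hermite
    expansion converges in L^2 and can be paired with h. The factor 2 in the norm bounds comes from
    |u + v|^2 <= 2 |u|^2 + 2 |v|^2; it is harmless because only continuity is at stake.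

    The values of [bargmann_inv] and [frft] are picked by choice, so functions on the line are
    compared through their transforms. For integrable u the function F_alpha u is not known
    beforehand to lie in L^2; this is why injectivity of B is proved on the larger class of
    functions whose Bargmann integrals converge absolutely.

    [entire] only means complex differentiable everywhere, so power series have to come from Goursat
    and Cauchy. Circles are parametrized by exp(s + i t), which turns them into vertical segments
    and annuli into rectangles. Integrals over the plane are handled by shears and by integration by
    parts in one coordinate. *)

Section ComplexBasics.
Context {R : realType}.
Local Notation C := R[i].
Local Notation Re := (@complex.Re R).
Local Notation Im := (@complex.Im R).
Implicit Types (z w : C) (a b : R).

Lemma complexP z w : Re z = Re w -> Im z = Im w -> z = w.
Proof. by case: z => a b; case: w => c d /= -> ->. Qed.

Lemma ReD z w : Re (z + w) = Re z + Re w. Proof. by case: z; case: w. Qed.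
Lemma ImD z w : Im (z + w) = Im z + Im w. Proof. by case: z; case: w. Qed.
Lemma ReN z : Re (- z) = - Re z. Proof. by case: z. Qed.
Lemma ImN z : Im (- z) = - Im z. Proof. by case: z. Qed.
Lemma ReM z w : Re (z * w) = Re z * Re w - Im z * Im w.
Proof. by case: z; case: w. Qed.
Lemma ImM z w : Im (z * w) = Re z * Im w + Im z * Re w.
Proof. by case: z; case: w. Qed.

Lemma ReMn z n : Re (z *+ n) = Re z *+ n.
Proof. by elim: n => // n IH; rewrite !mulrSr ReD IH. Qed.
Lemma ImMn z n : Im (z *+ n) = Im z *+ n.
Proof. by elim: n => // n IH; rewrite !mulrSr ImD IH. Qed.

Lemma Re_nat n : Re n%:R = n%:R. Proof. exact: ReMn. Qed.
Lemma Im_nat n : Im n%:R = 0. Proof. by rewrite ImMn mul0rn. Qed.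

Definition ReImE := (ReD, ImD, ReN, ImN, ReM, ImM, Re_nat, Im_nat).

Lemma normc_sqr z : normc z ^+ 2 = Re z ^+ 2 + Im z ^+ 2.
Proof. by case: z => a b /=; rewrite sqr_sqrtr// addr_ge0// sqr_ge0. Qed.

Lemma normc_ge0 z : 0 <= normc z.
Proof. by case: z => a b; rewrite sqrtr_ge0. Qed.

Lemma normr_Re_le z : `|Re z| <= normc z.
Proof.
rewrite -[leRHS]ger0_norm ?normc_ge0// -ler_sqr ?nnegrE// !real_normK ?num_real//.
by rewrite normc_sqr lerDl sqr_ge0.
Qed.

Lemma normr_Im_le z : `|Im z| <= normc z.
Proof.
rewrite -[leRHS]ger0_norm ?normc_ge0// -ler_sqr ?nnegrE// !real_normK ?num_real//.
by rewrite normc_sqr lerDr sqr_ge0.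
Qed.

Lemma normc_real a : normc a%:C = `|a|.
Proof. by rewrite /= expr0n addr0 sqrtr_sqr. Qed.

Lemma normc_i : normc ('i%C : C) = 1.
Proof. by rewrite /= expr0n expr1n add0r sqrtr1. Qed.

Lemma normc_le_ReIm z : normc z <= `|Re z| + `|Im z|.
Proof.
rewrite -ler_sqr ?nnegrE ?normc_ge0 ?addr_ge0// normc_sqr sqrrD !real_normK ?num_real//.
by rewrite addrAC lerDl mulrn_wge0// mulr_ge0.
Qed.

Lemma normcX z n : normc (z ^+ n) = normc z ^+ n.
Proof. by elim: n => [|n IH]; rewrite ?expr0 ?normc1// !exprS normcM IH. Qed.

Lemma normc_sum (I : Type) (r : seq I) (P : pred I) (F : I -> C) :
  normc (\sum_(i <- r | P i) F i) <= \sum_(i <- r | P i) normc (F i).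
Proof.
elim/big_rec2 : _ => [|i y1 y2 _ h]; first by rewrite normc0.
by rewrite (le_trans (le_normcD _ _))// lerD2l.
Qed.

Lemma normc_eq0 z : (normc z == 0) = (z == 0).
Proof. by apply/eqP/eqP => [/eq0_normc//|->]; rewrite normc0. Qed.

Lemma normc_gt0 z : (0 < normc z) = (z != 0).
Proof. by rewrite lt_neqAle normc_ge0 andbT eq_sym normc_eq0. Qed.

Lemma le_normcB z w : normc (z - w) <= normc z + normc w.
Proof. by rewrite -(normcN w) le_normcD. Qed.

Lemma normcC z w : normc (z - w) = normc (w - z).
Proof. by rewrite -normcN opprB. Qed.

Lemma lerB_normc z w : normc z - normc w <= normc (z - w).
Proof. by rewrite lerBlDr -{1}(subrK w z) le_normcD. Qed.

Lemma cexpD z w : cexp (z + w) = cexp z * cexp w.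
Proof.
case: z => a b; case: w => c d; rewrite /cexp/= expRD cosD sinD.
by apply: complexP; rewrite !ReImE/=; ring.
Qed.

Lemma cexp0 : cexp (0 : C) = 1.
Proof. by rewrite /cexp/= expR0 cos0 sin0 mul1r. Qed.

Lemma normc_cexp z : normc (cexp z) = expR (Re z).
Proof.
rewrite normcM normc_real ger0_norm ?expR_ge0//=.
by rewrite cos2Dsin2 sqrtr1 mulr1.
Qed.

Lemma cexp_real a : cexp a%:C = (expR a)%:C.
Proof. by rewrite /cexp/= cos0 sin0 mulr1. Qed.

Lemma cexp_neq0 z : cexp z != 0.
Proof. by rewrite -normc_gt0 normc_cexp expR_gt0. Qed.

Lemma cexpX z n : cexp z ^+ n = cexp (n%:R * z).
Proof.
elim: n => [|n IH]; first by rewrite mul0r cexp0 expr0.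
by rewrite exprS IH -cexpD; congr cexp; ring.
Qed.

Lemma Re_cexp z : Re (cexp z) = expR (Re z) * cos (Im z).
Proof. by rewrite /cexp ReM/= mul0r subr0. Qed.
Lemma Im_cexp z : Im (cexp z) = expR (Re z) * sin (Im z).
Proof. by rewrite /cexp ImM/= mul0r addr0. Qed.

End ComplexBasics.

(** * Integration of complex functions *)

Section ComplexMeasurable.
Context d (T : measurableType d) {R : realType}.
Local Notation C := R[i].
Local Notation Re := (@complex.Re R).
Local Notation Im := (@complex.Im R).
Implicit Types (u v : T -> C).

(** The condition [cmeasurable] over an arbitrary measurable space, since it is also used on the
    plane [R * R]. *)
Definition cmeas u : Prop :=
  measurable_fun setT (fun x => Re (u x)) /\
  measurable_fun setT (fun x => Im (u x)).

Lemma cmeas_cst (c : C) : cmeas (fun=> c).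
Proof. by split; exact: measurable_cst. Qed.

Lemma cmeasD u v : cmeas u -> cmeas v -> cmeas (fun x => u x + v x).
Proof.
by move=> [? ?] [? ?]; split; under eq_fun do rewrite !ReImE; exact: measurable_funD.
Qed.

Lemma cmeasN u : cmeas u -> cmeas (fun x => - u x).
Proof.
by move=> [? ?]; split; under eq_fun do rewrite !ReImE; exact: measurableT_comp.
Qed.

Lemma cmeasB u v : cmeas u -> cmeas v -> cmeas (fun x => u x - v x).
Proof. by move=> mu mv; apply: cmeasD => //; exact: cmeasN. Qed.

Lemma cmeasM u v : cmeas u -> cmeas v -> cmeas (fun x => u x * v x).
Proof.
move=> [? ?] [? ?]; split; under eq_fun do rewrite !ReImE.
  by apply: measurable_funB; exact: measurable_funM.
by apply: measurable_funD; exact: measurable_funM.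
Qed.

Lemma cmeasX u n : cmeas u -> cmeas (fun x => u x ^+ n).
Proof.
move=> mu; elim: n => [|n IH]; first exact: cmeas_cst.
by under eq_fun do rewrite exprS; exact: cmeasM.
Qed.

Lemma cmeas_real (f : T -> R) : measurable_fun setT f -> cmeas (fun x => (f x)%:C).
Proof. by move=> mf; split => //=; exact: measurable_cst. Qed.

Lemma cmeas_sum n (F : nat -> T -> C) : (forall i, cmeas (F i)) ->
  cmeas (fun x => \sum_(i < n) F i x).
Proof.
move=> mF; elim: n => [|n IH].
  by under eq_fun do rewrite big_ord0; exact: cmeas_cst.
by under eq_fun do rewrite big_ord_recr/=; exact: cmeasD.
Qed.

Lemma cmeas_cexp u : cmeas u -> cmeas (fun x => cexp (u x)).
Proof.
move=> [m1 m2]; split.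
  under eq_fun do rewrite Re_cexp.
  apply: measurable_funM; apply: measurableT_comp => //.
  by apply: continuous_measurable_fun; exact: continuous_cos.
under eq_fun do rewrite Im_cexp.
apply: measurable_funM; apply: measurableT_comp => //.
by apply: continuous_measurable_fun; exact: continuous_sin.
Qed.

Lemma measurable_normc u : cmeas u -> measurable_fun setT (fun x => normc (u x)).
Proof.
move=> [m1 m2]; rewrite [X in measurable_fun _ X](_ : _ =
  (fun x => Num.sqrt (Re (u x) ^+ 2 + Im (u x) ^+ 2))); last first.
  by apply/funext => x; case: (u x).
apply: measurableT_comp; first by apply: continuous_measurable_fun; exact: sqrt_continuous.
by apply: measurable_funD; exact: measurable_funX.
Qed.

Lemma cmeas_cvg (F : nat -> T -> C) u : (forall n, cmeas (F n)) ->
  (forall x, normc (F n x - u x) @[n --> \oo] --> 0) -> cmeas u.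
Proof.
move=> mF cF; split.
  apply: (@measurable_fun_cvg _ _ _ _ (fun n x => Re (F n x))) => //.
    by move=> n; exact: (mF n).1.
  move=> x _; apply/cvgrPdist_le => e e0; have /cvgrPdist_le/(_ _ e0) := cF x.
  apply: filterS => n; rewrite sub0r normrN ger0_norm ?normc_ge0// => h.
  by rewrite distrC -ReN -ReD (le_trans (normr_Re_le _)).
apply: (@measurable_fun_cvg _ _ _ _ (fun n x => Im (F n x))) => //.
  by move=> n; exact: (mF n).2.
move=> x _; apply/cvgrPdist_le => e e0; have /cvgrPdist_le/(_ _ e0) := cF x.
apply: filterS => n; rewrite sub0r normrN ger0_norm ?normc_ge0// => h.
by rewrite distrC -ImN -ImD (le_trans (normr_Im_le _)).
Qed.

End ComplexMeasurable.

Section ComplexIntegral.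
Context d (T : measurableType d) {R : realType}.
Context (mu : {measure set T -> \bar R}).
Local Notation C := R[i].
Local Notation Re := (@complex.Re R).
Local Notation Im := (@complex.Im R).
Implicit Types (u v : T -> C) (D : set T).

(** Generalizes [cintegral], which is convertible to [cint mu setT]; proofs switch between the two
    by conversion. *)
Definition cint D u : C :=
  (\int[mu]_(x in D) Re (u x)) +i* (\int[mu]_(x in D) Im (u x)).

Definition cinteg D u : Prop :=
  mu.-integrable D (fun x => (Re (u x))%:E) /\
  mu.-integrable D (fun x => (Im (u x))%:E).

Lemma eq_cint D u v : {in D, u =1 v} -> cint D u = cint D v.
Proof.
by move=> uv; congr (_ +i* _); apply: eq_Rintegral => x xD; rewrite uv.
Qed.

Lemma eq_cinteg D u v : measurable D -> {in D, u =1 v} -> cinteg D u -> cinteg D v.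
Proof.
by move=> mD uv [] h1 h2; split; [apply: eq_integrable h1|apply: eq_integrable h2] => // x xD;
  rewrite uv.
Qed.

Lemma cintegD D u v : measurable D -> cinteg D u -> cinteg D v ->
  cinteg D (fun x => u x + v x).
Proof.
by move=> mD [a b] [a' b']; split; under eq_fun do rewrite !ReImE EFinD;
  exact: integrableD.
Qed.

Lemma cintD D u v : measurable D -> cinteg D u -> cinteg D v ->
  cint D (fun x => u x + v x) = cint D u + cint D v.
Proof.
move=> mD [a b] [a' b']; apply: complexP => /=.
  by under eq_Rintegral do rewrite !ReImE; exact: RintegralD.
by under eq_Rintegral do rewrite !ReImE; exact: RintegralD.
Qed.

Lemma integrable_scale D (a : R) (f : T -> R) : measurable D ->
  mu.-integrable D (EFin \o f) -> mu.-integrable D (EFin \o (fun x => a * f x)).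
Proof.
move=> mD i; have := integrableZl mD a i.
by apply: eq_integrable => // x _; rewrite /= EFinM.
Qed.

Lemma cintegZ D (c : C) u : measurable D -> cinteg D u ->
  cinteg D (fun x => c * u x).
Proof.
move=> mD [a b]; split; under eq_fun do rewrite !ReImE.
  under eq_fun do rewrite EFinB !EFinM.
  by apply: integrableB => //; exact: integrableZl.
under eq_fun do rewrite EFinD !EFinM.
by apply: integrableD => //; exact: integrableZl.
Qed.

Lemma cintZ D (c : C) u : measurable D -> cinteg D u ->
  cint D (fun x => c * u x) = c * cint D u.
Proof.
move=> mD [a b]; apply: complexP; rewrite !ReImE /=.
  under eq_Rintegral do rewrite !ReImE.
  rewrite RintegralB ?RintegralZl//.
    exact: integrable_scale.
  exact: integrable_scale.
under eq_Rintegral do rewrite !ReImE.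
rewrite RintegralD ?RintegralZl//.
  exact: integrable_scale.
exact: integrable_scale.
Qed.

Lemma cintegN D u : measurable D -> cinteg D u -> cinteg D (fun x => - u x).
Proof.
move=> mD iu; apply: (@eq_cinteg _ (fun x => -1 * u x)) => //.
  by move=> x _; rewrite mulN1r.
exact: cintegZ.
Qed.

Lemma cintN D u : measurable D -> cinteg D u ->
  cint D (fun x => - u x) = - cint D u.
Proof.
move=> mD iu; rewrite -[RHS]mulN1r -cintZ//.
by apply: eq_cint => x _; rewrite mulN1r.
Qed.

Lemma cintegB D u v : measurable D -> cinteg D u -> cinteg D v ->
  cinteg D (fun x => u x - v x).
Proof. by move=> mD iu iv; apply: cintegD => //; exact: cintegN. Qed.

Lemma cintB D u v : measurable D -> cinteg D u -> cinteg D v ->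
  cint D (fun x => u x - v x) = cint D u - cint D v.
Proof.
by move=> mD iu iv; rewrite cintD//; [rewrite cintN|exact: cintegN].
Qed.

Lemma cinteg_normc D u : measurable D -> cinteg D u ->
  mu.-integrable D (fun x => (normc (u x))%:E).
Proof.
move=> mD [a b].
have ma := measurable_int _ a; have mb := measurable_int _ b.
apply: (@le_integrable _ _ _ mu D mD _ (fun x => `|(Re (u x))%:E| + `|(Im (u x))%:E|)%E).
- apply/measurable_EFinP; rewrite [X in measurable_fun _ X](_ : _ =
    (fun x => Num.sqrt (Re (u x) ^+ 2 + Im (u x) ^+ 2))); last first.
    by apply/funext => x; case: (u x).
  apply: measurableT_comp; first by apply: continuous_measurable_fun; exact: sqrt_continuous.
  by apply: measurable_funD; apply: measurable_funX; exact/measurable_EFinP.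
- move=> x _; rewrite /= lee_fin.
  by rewrite ger0_norm ?normc_ge0// (le_trans (normc_le_ReIm _))// ler_norm.
- by apply: integrableD => //; exact: integrable_abse.
Qed.

Lemma cinteg_le D u (g : T -> R) : measurable D ->
  measurable_fun D (fun x => Re (u x)) -> measurable_fun D (fun x => Im (u x)) ->
  mu.-integrable D (EFin \o g) ->
  (forall x, D x -> normc (u x) <= g x) -> cinteg D u.
Proof.
move=> mD m1 m2 ig ug; split.
- apply: (@le_integrable _ _ _ mu D mD _ (EFin \o g)) => //; first exact/measurable_EFinP.
  move=> x Dx; rewrite /= lee_fin (le_trans (normr_Re_le _))//.
  by rewrite (le_trans (ug _ Dx))// ler_norm.
- apply: (@le_integrable _ _ _ mu D mD _ (EFin \o g)) => //; first exact/measurable_EFinP.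
  move=> x Dx; rewrite /= lee_fin (le_trans (normr_Im_le _))//.
  by rewrite (le_trans (ug _ Dx))// ler_norm.
Qed.

Lemma cinteg_leT u (g : T -> R) : cmeas u -> mu.-integrable setT (EFin \o g) ->
  (forall x, normc (u x) <= g x) -> cinteg setT u.
Proof. by move=> [? ?] ig ug; apply: (@cinteg_le _ _ g). Qed.

(** Multiplying by the unimodular number [k] turns the integral onto the positive real axis, where
    it is the integral of a real part. *)
Lemma normc_cint_le D u : measurable D -> cinteg D u ->
  normc (cint D u) <= \int[mu]_(x in D) normc (u x).
Proof.
move=> mD iu; have inu := cinteg_normc mD iu.
have [->|c0] := eqVneq (cint D u) 0.
  by rewrite normc0 Rintegral_ge0// => x _; exact: normc_ge0.
set c := cint D u in c0 *.
pose k := (conjc c) * ((normc c)^-1)%:C.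
have n0 : normc c != 0 by rewrite normc_eq0.
have ck : normc c = Re (k * c).
  rewrite /k mulrAC ReM [conjc c * c]mulrC.
  have -> : c * conjc c = (normc c ^+ 2)%:C.
    by rewrite normc_sqr; case: (c) => a b; apply: complexP => /=; ring.
  by rewrite /= mul0r subr0 expr2 mulfK.
have nk : normc k = 1.
  rewrite /k normcM normc_real ger0_norm ?invr_ge0 ?normc_ge0//.
  have -> : normc (conjc c) = normc c by case: (c) => a b /=; rewrite sqrrN.
  by rewrite divff.
rewrite ck -cintZ//=; apply: le_Rintegral => //.
- exact: (cintegZ _ mD iu).1.
- by move=> x Dx; rewrite (le_trans (ler_norm _))// (le_trans (normr_Re_le _))// normcM nk mul1r.
Qed.

(** Dominated convergence for the real and imaginary parts. Limits are phrased through [normc] of a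
    difference, so that only real sequences converge. *)
Lemma cint_dominated (F : nat -> T -> C) u (g : T -> R) D : measurable D ->
  (forall n, cmeas (F n)) -> cmeas u ->
  (forall x, D x -> normc (F n x - u x) @[n --> \oo] --> 0) ->
  mu.-integrable D (EFin \o g) ->
  (forall n x, D x -> normc (F n x) <= g x) ->
  cinteg D u /\ normc (cint D (F n) - cint D u) @[n --> \oo] --> 0.
Proof.
move=> mD mF mu' cF ig Fg.
have mFr n : measurable_fun D (fun x => (Re (F n x))%:E).
  by apply/measurable_EFinP/measurable_funTS; exact: (mF n).1.
have mFi n : measurable_fun D (fun x => (Im (F n x))%:E).
  by apply/measurable_EFinP/measurable_funTS; exact: (mF n).2.
have mr : measurable_fun D (fun x => (Re (u x))%:E).
  by apply/measurable_EFinP/measurable_funTS; exact: mu'.1.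
have mi : measurable_fun D (fun x => (Im (u x))%:E).
  by apply/measurable_EFinP/measurable_funTS; exact: mu'.2.
have cr x : D x -> (Re (F n x))%:E @[n --> \oo] --> (Re (u x))%:E.
  move=> Dx; apply/cvg_EFin; first exact: nearW.
  apply/cvgrPdist_le => e e0; have /cvgrPdist_le/(_ _ e0) := cF x Dx.
  apply: filterS => n; rewrite sub0r normrN ger0_norm ?normc_ge0// => h.
  by rewrite distrC -ReN -ReD (le_trans (normr_Re_le _)).
have ci x : D x -> (Im (F n x))%:E @[n --> \oo] --> (Im (u x))%:E.
  move=> Dx; apply/cvg_EFin; first exact: nearW.
  apply/cvgrPdist_le => e e0; have /cvgrPdist_le/(_ _ e0) := cF x Dx.
  apply: filterS => n; rewrite sub0r normrN ger0_norm ?normc_ge0// => h.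
  by rewrite distrC -ImN -ImD (le_trans (normr_Im_le _)).
have [ir _ cvr] := @dominated_convergence _ _ _ mu D mD _ _ (EFin \o g) mFr mr
   (aeW _ cr) ig
   (aeW _ (fun x n Dx => le_trans (normr_Re_le _) (Fg n x Dx))).
have [ii _ cvi] := @dominated_convergence _ _ _ mu D mD _ _ (EFin \o g) mFi mi
   (aeW _ ci) ig
   (aeW _ (fun x n Dx => le_trans (normr_Im_le _) (Fg n x Dx))).
split => //.
have iF n : cinteg D (F n).
  by apply: (@cinteg_le _ _ g) => //; [apply/measurable_EFinP; exact: mFr|apply/measurable_EFinP; exact: mFi|exact: Fg].
have fr : \int[mu]_(x in D) Re (F n x) @[n --> \oo] --> \int[mu]_(x in D) Re (u x).
  by apply: fine_cvg; rewrite fineK//; exact: integrable_fin_num.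
have fi : \int[mu]_(x in D) Im (F n x) @[n --> \oo] --> \int[mu]_(x in D) Im (u x).
  by apply: fine_cvg; rewrite fineK//; exact: integrable_fin_num.
apply: (@squeeze_cvgr _ _ _ _ (cst 0) (fun n =>
   `|\int[mu]_(x in D) Re (F n x) - \int[mu]_(x in D) Re (u x)| +
   `|\int[mu]_(x in D) Im (F n x) - \int[mu]_(x in D) Im (u x)|)).
- apply: nearW => n; rewrite normc_ge0/=.
  exact: (normc_le_ReIm (cint D (F n) - cint D u)).
- exact: cvg_cst.
- rewrite [X in _ --> X](_ : 0 = `|(0:R)| + `|(0:R)|); last by rewrite normr0 addr0.
  by apply: cvgD; apply: cvg_norm; apply/subr_cvg0.
Qed.

Lemma cinteg_sum D n (F : nat -> T -> C) : measurable D -> (forall i, cinteg D (F i)) ->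
  cinteg D (fun x => \sum_(i < n) F i x).
Proof.
move=> mD iF; elim: n => [|n IH].
  apply: (@eq_cinteg _ (fun x => 0 * F 0 x)) => //; last exact: cintegZ.
  by move=> x _; rewrite big_ord0 mul0r.
apply: (@eq_cinteg _ (fun x => \sum_(i < n) F i x + F n x)) => //.
  by move=> x _; rewrite big_ord_recr.
exact: cintegD.
Qed.

Lemma cint_sum D n (F : nat -> T -> C) : measurable D -> (forall i, cinteg D (F i)) ->
  cint D (fun x => \sum_(i < n) F i x) = \sum_(i < n) cint D (F i).
Proof.
move=> mD iF; elim: n => [|n IH].
  rewrite big_ord0; transitivity (0 * cint D (F 0)); last by rewrite mul0r.
  rewrite -cintZ//.
  by apply: eq_cint => x _; rewrite big_ord0 mul0r.
rewrite big_ord_recr/= -IH -cintD//; last exact: cinteg_sum.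
by apply: eq_cint => x _; rewrite big_ord_recr.
Qed.

End ComplexIntegral.

(** * Cauchy theory *)

Section Goursat.
Context {R : realType}.
Local Notation C := R[i].
Local Notation Re := (@complex.Re R).
Local Notation Im := (@complex.Im R).
Local Notation mu := (@lebesgue_measure R).
Implicit Types (g f : C -> C) (z w : C).

(** Epsilon-delta form with the real modulus, as for [cderiv] below; [cdiffP] links the latter to
    [derivable]. *)
Definition ccont g : Prop := forall z (e : R), 0 < e ->
  exists2 d : R, 0 < d & forall w, normc (w - z) < d -> normc (g w - g z) < e.

Definition cderiv f z (l : C) : Prop := forall e : R, 0 < e ->
  exists2 d : R, 0 < d & forall h, normc h < d ->
    normc (f (z + h) - f z - l * h) <= e * normc h.

Definition rcont (u : R -> C) : Prop :=
  continuous (fun t => Re (u t)) /\ continuous (fun t => Im (u t)).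

Lemma rcontP (u : R -> C) :
  (forall t (e : R), 0 < e -> exists2 d : R, 0 < d &
     forall s, `|s - t| < d -> normc (u s - u t) < e) -> rcont u.
Proof.
move=> h; split => t; apply/cvgrPdist_lt => e e0; have [d d0 hd] := h t e e0.
  exists d => //= s; rewrite /ball_/= distrC => /hd; apply: le_lt_trans.
  by rewrite distrC -ReN -ReD normr_Re_le.
exists d => //= s; rewrite /ball_/= distrC => /hd; apply: le_lt_trans.
by rewrite distrC -ImN -ImD normr_Im_le.
Qed.

Lemma rcont_lip g (p : R -> C) : ccont g ->
  (forall s t, normc (p s - p t) <= `|s - t|) -> rcont (g \o p).
Proof.
move=> cg pl; apply: rcontP => t e e0; have [d d0 hd] := cg (p t) e e0.
by exists d => // s st; apply: hd; exact: le_lt_trans st.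
Qed.

Lemma rcontD (u v : R -> C) : rcont u -> rcont v -> rcont (fun t => u t + v t).
Proof.
by move=> [a b] [a' b']; split; under eq_fun do rewrite ReImE;
  move=> t; apply: cvgD; [exact: a|exact: a'|exact: b|exact: b'].
Qed.

Lemma rcontN (u : R -> C) : rcont u -> rcont (fun t => - u t).
Proof.
by move=> [a b]; split; under eq_fun do rewrite ReImE;
  move=> t; apply: cvgN; [exact: a|exact: b].
Qed.

Lemma rcontB (u v : R -> C) : rcont u -> rcont v -> rcont (fun t => u t - v t).
Proof. by move=> cu cv; apply: rcontD => //; exact: rcontN. Qed.

Lemma rcontM (u v : R -> C) : rcont u -> rcont v -> rcont (fun t => u t * v t).
Proof.
move=> [a b] [a' b']; split; under eq_fun do rewrite ReImE; move=> t.
  by apply: cvgB; apply: cvgM; [exact: a|exact: a'|exact: b|exact: b'].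
by apply: cvgD; apply: cvgM; [exact: a|exact: b'|exact: b|exact: a'].
Qed.

Lemma rcont_cst (c : C) : rcont (fun=> c).
Proof. by split => t; exact: cvg_cst. Qed.

Lemma rcont_meas (u : R -> C) : rcont u -> cmeas u.
Proof. by move=> [? ?]; split; exact: continuous_measurable_fun. Qed.

Lemma rcont_cinteg (u : R -> C) a b : rcont u -> cinteg mu `[a, b] u.
Proof.
by move=> [c c']; split; apply: continuous_compact_integrable;
  [exact: segment_compact|exact: continuous_subspaceT|
   exact: segment_compact|exact: continuous_subspaceT].
Qed.

Lemma cint_itv_split (u : R -> C) a c b : rcont u -> a <= c -> c <= b ->
  cint mu `[a, b] u = cint mu `[a, c] u + cint mu `[c, b] u.
Proof.
move=> cu ac cb.
have aux (f : R -> R) : continuous f ->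
  \int[mu]_(x in `[a, b]) f x = \int[mu]_(x in `[a, c]) f x + \int[mu]_(x in `[c, b]) f x.
  move=> cf; have i x y : mu.-integrable `[x, y] (EFin \o f).
    by apply: continuous_compact_integrable; [exact: segment_compact|exact: continuous_subspaceT].
  have := @Rintegral_itvB R f (BLeft a) (BRight b) c (i a b) ac cb.
  rewrite Rintegral_itv_obnd_cbnd; last first.
    by apply: integrableS (i c b) => //; exact: subset_itv_oc_cc.
  by move=> <-; rewrite addrC subrK.
by case: cu => c1 c2; apply: complexP => /=; exact: aux.
Qed.

Lemma cint_itv_cst (c : C) a b : a <= b ->
  cint mu `[a, b] (fun=> c) = c * (b - a)%:C.
Proof.
move=> ab; apply: complexP; rewrite /= Rintegral_cst//= lebesgue_measure_itv/= lte_fin.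
  case: ltP => h; first by case: (c) => x y /=; ring.
  have -> : b = a by apply/le_anti/andP.
  by case: (c) => x y /=; ring.
case: ltP => h; first by case: (c) => x y /=; ring.
have -> : b = a by apply/le_anti/andP.
by case: (c) => x y /=; ring.
Qed.

Lemma cint_itv_addc (u : R -> C) (c : C) a b : rcont u -> a <= b ->
  cint mu `[a, b] (fun t => u t + c) = cint mu `[a, b] u + c * (b - a)%:C.
Proof.
move=> cu ab; rewrite -cint_itv_cst//.
by apply: cintD => //; apply: rcont_cinteg => //; exact: rcont_cst.
Qed.

Lemma normc_cint_itv_le (u : R -> C) a b M : rcont u -> a <= b ->
  (forall t, a <= t <= b -> normc (u t) <= M) ->
  normc (cint mu `[a, b] u) <= M * (b - a).
Proof.
move=> cu ab uM; have iu := rcont_cinteg a b cu.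
apply: (le_trans (normc_cint_le _ iu)) => //.
have -> : M * (b - a) = \int[mu]_(x in `[a, b]) M.
  rewrite Rintegral_cst//= lebesgue_measure_itv/= lte_fin; case: ltP => //= h.
  have -> : b = a by apply/le_anti/andP.
  by rewrite subrr.
apply: le_Rintegral => //.
- by have := cinteg_normc _ iu; exact.
- apply: continuous_compact_integrable; first exact: segment_compact.
  by apply: continuous_subspaceT => t; exact: cvg_cst.
Qed.

(** The contour integral of [g] counterclockwise around the rectangle with lower left corner x + iy,
    width [a] and height [b]. *)
Definition rect_int g (x y a b : R) : C :=
  cint mu `[x, x + a] (fun t => g (t +i* y) - g (t +i* (y + b))) +
  'i%C * cint mu `[y, y + b] (fun t => g ((x + a) +i* t) - g (x +i* t)).

Lemma normc_hline (s t y : R) : normc ((s +i* y) - (t +i* y)) <= `|s - t|.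
Proof. by rewrite /= subrr expr0n addr0 sqrtr_sqr. Qed.

Lemma normc_vline (s t x : R) : normc ((x +i* s) - (x +i* t)) <= `|s - t|.
Proof. by rewrite /= subrr expr0n add0r sqrtr_sqr. Qed.

Lemma rcont_hline g y : ccont g -> rcont (fun t => g (t +i* y)).
Proof. by move=> cg; apply: (@rcont_lip g (fun t => t +i* y)) => // s t; exact: normc_hline. Qed.

Lemma rcont_vline g x : ccont g -> rcont (fun t => g (x +i* t)).
Proof. by move=> cg; apply: (@rcont_lip g (fun t => x +i* t)) => // s t; exact: normc_vline. Qed.

Lemma cintB_itv (u v : R -> C) a b : rcont u -> rcont v ->
  cint mu `[a, b] (fun t => u t - v t) = cint mu `[a, b] u - cint mu `[a, b] v.
Proof. by move=> cu cv; rewrite cintB//; exact: rcont_cinteg. Qed.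

(** The inner edges of the four quarters are traversed twice in opposite directions and cancel. *)
Lemma rect_int_split g (x y a b : R) : ccont g -> 0 <= a -> 0 <= b ->
  rect_int g x y (a + a) (b + b) =
  rect_int g x y a b + rect_int g (x + a) y a b +
  rect_int g x (y + b) a b + rect_int g (x + a) (y + b) a b.
Proof.
move=> cg a0 b0; rewrite /rect_int.
have ch k : rcont (fun t => g (t +i* k)) by exact: rcont_hline.
have cv k : rcont (fun t => g (k +i* t)) by exact: rcont_vline.
rewrite !cintB_itv//.
rewrite !addrA.
have sp (u : R -> C) k l : rcont u -> 0 <= l ->
   cint mu `[k, k + l + l] u = cint mu `[k, k + l] u + cint mu `[k + l, k + l + l] u.
  by move=> cu l0; apply: cint_itv_split => //; rewrite lerDl.
rewrite !(sp _ x a)// !(sp _ y b)//.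
by ring.
Qed.

Lemma rect_int_small g z l (e d x y a b : R) : ccont g ->
  0 <= a -> 0 <= b -> x <= Re z <= x + a -> y <= Im z <= y + b ->
  a + b < d -> 0 <= e ->
  (forall h, normc h < d -> normc (g (z + h) - g z - l * h) <= e * normc h) ->
  normc (rect_int g x y a b) <= e * (a + b) ^+ 2 *+ 2.
Proof.
move=> cg a0 b0 /andP[xz zx] /andP[yz zy] abd e0 hd.
pose p := fun w => g w - g z - l * (w - z).
have pb w : x <= Re w <= x + a -> y <= Im w <= y + b -> normc (p w) <= e * (a + b).
  move=> /andP[xw wx] /andP[yw wy].
  have dw : normc (w - z) <= a + b.
    apply: (le_trans (normc_le_ReIm _)); rewrite !ReImE.
    by apply: lerD; rewrite ler_norml; apply/andP; split; lra.
  have := hd (w - z) (le_lt_trans dw abd); rewrite [z + _]addrC subrK => /le_trans; apply.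
  by rewrite ler_wpM2l.
have cp : ccont p.
  move=> w eps eps0.
  have [d1 d10 h1] := cg w (eps / 2) ltac:(lra).
  pose k := normc l + 1.
  have k0 : 0 < k by rewrite /k; have := normc_ge0 l; lra.
  exists (Num.min d1 (eps / 2 / k)).
    by rewrite lt_min d10/= divr_gt0// divr_gt0.
  move=> v; rewrite lt_min => /andP[v1 v2].
  have -> : p v - p w = (g v - g w) - l * (v - w) by rewrite /p; ring.
  apply: (le_lt_trans (le_normcB _ _)).
  have h2 : normc (l * (v - w)) <= eps / 2.
    rewrite normcM; move: v2; rewrite ltr_pdivlMr// => v2.
    have := normc_ge0 (v - w); rewrite /k in v2 => ?; lra.
  by have := h1 v v1; lra.
(* The linear part contributes - i l a b along the horizontal sides and i l a b along the vertical
   ones. *)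
have -> : rect_int g x y a b = rect_int p x y a b.
  rewrite /rect_int.
  have -> : cint mu `[x, x + a] (fun t => g (t +i* y) - g (t +i* (y + b))) =
      cint mu `[x, x + a] (fun t => p (t +i* y) - p (t +i* (y + b))) -
        l * 'i%C * b%:C * (x + a - x)%:C.
    rewrite -mulNr -cint_itv_addc ?lerDl//; last by apply: rcontB; exact: rcont_hline.
    apply: eq_cint => t _; rewrite /p.
    have -> : t +i* (y + b) = (t +i* y) + 'i%C * b%:C.
      by apply: complexP; rewrite !ReImE/=; ring.
    by ring.
  have -> : cint mu `[y, y + b] (fun t => g ((x + a) +i* t) - g (x +i* t)) =
      cint mu `[y, y + b] (fun t => p ((x + a) +i* t) - p (x +i* t)) +
        l * a%:C * (y + b - y)%:C.
    rewrite -cint_itv_addc ?lerDl//; last by apply: rcontB; exact: rcont_vline.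
    apply: eq_cint => t _; rewrite /p.
    have -> : (x + a) +i* t = (x +i* t) + a%:C.
      by apply: complexP; rewrite !ReImE/=; ring.
    by ring.
  have -> : x + a - x = a by ring.
  have -> : y + b - y = b by ring.
  by ring.
have ab0 : 0 <= e * (a + b) by rewrite mulr_ge0// addr_ge0.
apply: (le_trans (le_normcD _ _)); rewrite normcM normc_i mul1r.
have b1 : normc (cint mu `[x, x + a] (fun t => p (t +i* y) - p (t +i* (y + b)))) <=
    (e * (a + b) *+ 2) * (x + a - x).
  apply: normc_cint_itv_le; first by apply: rcontB; exact: rcont_hline.
    by rewrite lerDl.
  move=> t tx; apply: (le_trans (le_normcB _ _)); rewrite mulr2n.
  by apply: lerD; apply: pb => //=; rewrite lexx ?lerDl ?b0.
have b2 : normc (cint mu `[y, y + b] (fun t => p ((x + a) +i* t) - p (x +i* t))) <=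
    (e * (a + b) *+ 2) * (y + b - y).
  apply: normc_cint_itv_le; first by apply: rcontB; exact: rcont_vline.
    by rewrite lerDl.
  move=> t tx; apply: (le_trans (le_normcB _ _)); rewrite mulr2n.
  by apply: lerD; apply: pb => //=; rewrite lexx ?lerDl ?a0.
apply: (le_trans (lerD b1 b2)).
rewrite le_eqVlt; apply/orP; left; apply/eqP; ring.
Qed.

(** Bisection: some quarter carries at least a fourth of the integral, so after n steps the loss is
    at most 4^n, while [rect_int_small] gains the same 4^n from the size of the rectangle.
    Differentiability is asked on a vertical strip, the preimage of an annulus under [cexp]. *)
Lemma goursat g (x y a b : R) : ccont g -> 0 <= a -> 0 <= b ->
  (forall z, x <= Re z <= x + a -> exists l, cderiv g z l) ->
  rect_int g x y a b = 0.
Proof.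
move=> cg a0 b0 dg.
pose A n : R := a / 2 ^+ n; pose B n : R := b / 2 ^+ n.
have p2 n : (0 : R) < 2 ^+ n by rewrite exprn_gt0.
have A0 n : 0 <= A n by rewrite divr_ge0// ltW.
have B0 n : 0 <= B n by rewrite divr_ge0// ltW.
have AS n : A n = A n.+1 + A n.+1.
  by rewrite /A exprS; field; rewrite gt_eqF.
have BS n : B n = B n.+1 + B n.+1.
  by rewrite /B exprS; field; rewrite gt_eqF.
pose E n (p : R * R) := normc (rect_int g p.1 p.2 (A n) (B n)).
have step : forall np : nat * (R * R), exists p' : R * R,
   [/\ E np.1 np.2 <= 4 * E np.1.+1 p', np.2.1 <= p'.1 <= np.2.1 + A np.1.+1 &
       np.2.2 <= p'.2 <= np.2.2 + B np.1.+1].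
  move=> [n [u v]] /=.
  have : E n (u, v) <= E n.+1 (u, v) + E n.+1 (u + A n.+1, v) +
      E n.+1 (u, v + B n.+1) + E n.+1 (u + A n.+1, v + B n.+1).
    have -> : E n (u, v) = normc (rect_int g u v (A n.+1 + A n.+1) (B n.+1 + B n.+1)).
      by rewrite /E -AS -BS.
    rewrite rect_int_split//.
    by do 3! (apply: (le_trans (le_normcD _ _)); apply: lerD => //).
  move=> h.
  have aS := A0 n.+1; have bS := B0 n.+1.
  case: (leP (E n (u, v)) (4 * E n.+1 (u, v))) => h1.
    by exists (u, v); split => //=; rewrite ?lexx ?lerDl ?aS ?bS.
  case: (leP (E n (u, v)) (4 * E n.+1 (u + A n.+1, v))) => h2.
    by exists (u + A n.+1, v); split => //=; rewrite ?lexx ?lerDl ?aS ?bS.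
  case: (leP (E n (u, v)) (4 * E n.+1 (u, v + B n.+1))) => h3.
    by exists (u, v + B n.+1); split => //=; rewrite ?lexx ?lerDl ?aS ?bS.
  exists (u + A n.+1, v + B n.+1); split => //=; rewrite ?lexx ?lerDl ?aS ?bS//.
  by lra.
have {step} [st stP] := choice step.
pose P := fix P n := if n is m.+1 then st (m, P m) else (x, y).
have P1 n : (P n).1 <= (P n.+1).1 /\ (P n.+1).1 + A n.+1 <= (P n).1 + A n.
  by have [_ /andP[h1 h2] _] := stP (n, P n); split => //=; rewrite (AS n)/= in h2 *; lra.
have P2 n : (P n).2 <= (P n.+1).2 /\ (P n.+1).2 + B n.+1 <= (P n).2 + B n.
  by have [_ _ /andP[h1 h2]] := stP (n, P n); split => //=; rewrite (BS n)/= in h2 *; lra.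
have PE n : E 0 (x, y) <= 4 ^+ n * E n (P n).
  elim: n => [|n IH]; first by rewrite expr0 mul1r.
  have [h _ _] := stP (n, P n).
  rewrite exprSr -mulrA; apply: (le_trans IH).
  by rewrite ler_wpM2l ?exprn_ge0.
(* Nested intervals, applied to each coordinate to find the point common to all rectangles. *)
have nest (X D : nat -> R) : (forall n, 0 <= D n) ->
    (forall n, X n <= X n.+1 /\ X n.+1 + D n.+1 <= X n + D n) ->
    exists s, forall n, X n <= s <= X n + D n.
  move=> D0 XD.
  have Xm n k : X n <= X (n + k)%N /\ X (n + k)%N + D (n + k)%N <= X n + D n.
    elim: k => [|k [h1 h2]]; first by rewrite addn0.
    by rewrite addnS; have [h3 h4] := XD (n + k)%N; split; lra.
  have ub m : ubound (range X) (X m + D m).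
    move=> _ [n _ <-]; case: (leqP m n) => mn.
      have [h1 h2] := Xm m (n - m)%N; rewrite subnKC// in h1 h2.
      by have := D0 n; lra.
    have [h1 h2] := Xm n (m - n)%N; rewrite subnKC ?(ltnW mn)// in h1 h2.
    by have := D0 m; lra.
  exists (sup (range X)) => n; apply/andP; split.
    by apply: ub_le_sup; [exists (X 0 + D 0); exact: ub|exists n].
  by apply: ge_sup; [exists (X 0); exists 0|exact: ub].
have [s1 hs1] := nest _ A A0 P1; have [s2 hs2] := nest _ B B0 P2.
have A00 : A 0 = a by rewrite /A expr0 divr1.
have B00 : B 0 = b by rewrite /B expr0 divr1.
have [l dl] := dg (s1 +i* s2) ltac:(by have := hs1 0; rewrite A00).
apply/eqP; rewrite -normc_eq0 eq_le normc_ge0 andbT; apply/ler_addgt0Pr => e e0.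
rewrite add0r.
(* The final bound is 2 e' (a + b)^2; adding 1 keeps the denominator positive for a degenerate
   rectangle. *)
pose e' := e / (((a + b) ^+ 2 + 1) *+ 2).
have k0 : 0 < ((a + b) ^+ 2 + 1) *+ 2 by rewrite pmulrn_lgt0// ltr_wpDl// sqr_ge0.
have e'0 : 0 < e' by rewrite divr_gt0.
have [d d0 hd] := dl e' e'0.
have [n hn] : exists n, A n + B n < d.
  have : (a + b) * (2^-1) ^+ n @[n --> \oo] --> (a + b) * 0.
    by apply: cvgMr; apply: cvg_expr; rewrite gtr0_norm ?invf_lt1// ltr1n.
  rewrite mulr0 => /cvgrPdist_lt /(_ d d0) [N _ /(_ N (leqnn _))] /=.
  rewrite sub0r normrN => h; exists N; apply: le_lt_trans h.
  by rewrite /A /B -mulrDl exprVn ler_norm.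
have := @rect_int_small g (s1 +i* s2) l e' d (P n).1 (P n).2 (A n) (B n) cg (A0 n) (B0 n)
  (hs1 n) (hs2 n) hn (ltW e'0) hd.
move=> h; have := PE n; rewrite /E /= A00 B00 => /le_trans; apply.
apply: (@le_trans _ _ (4 ^+ n * (e' * (A n + B n) ^+ 2 *+ 2))).
  by rewrite ler_wpM2l ?exprn_ge0.
have -> : 4 ^+ n * (e' * (A n + B n) ^+ 2 *+ 2) = e' * (a + b) ^+ 2 *+ 2.
  rewrite /A /B -mulrDl exprMn exprVn (_ : (2 ^+ n) ^+ 2 = 4 ^+ n).
    by rewrite -!mulrnAr; field; rewrite expf_neq0.
  by rewrite -exprM mulnC exprM; congr (_ ^+ _); rewrite expr2 -natrM.
rewrite /e' -mulrnAr mulrAC ler_pdivrMr// ler_pM2l//.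
by rewrite ler_pMn2r// lerDl.
Qed.

End Goursat.

(** * Complex derivatives in epsilon-delta form *)

Section ComplexDerivative.
Context {R : realType}.
Local Notation C := R[i].
Local Notation Re := (@complex.Re R).
Local Notation Im := (@complex.Im R).
Implicit Types (g f : C -> C) (z w : C).

Definition cdiff f z : Prop := derivable (f : C^o -> C^o) z 1.

Lemma normC_lt z (e : R) : (`|z| < e%:C) = (normc z < e).
Proof. exact: ltcR. Qed.

(** Balls in [C] have radii in [C], but a positive radius is real; this brings epsilons and deltas
    back to [R]. *)
Lemma ltC0_real (e : C) : 0 < e -> exists2 r : R, 0 < r & e = r%:C.
Proof.
case: e => a b; rewrite ltcE /= => /andP[/eqP -> a0].
by exists a.
Qed.

(** The difference quotient is multiplied out by its increment, so that [cderiv] also covers the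
    increment 0. *)
Lemma cdiffP f z : cdiff f z <-> exists l, cderiv f z l.
Proof.
split.
  move=> /cvg_ex[/= l /cvgrPdist_lt h]; exists l => e e0.
  have := h e%:C; rewrite ltcR => /(_ e0).
  rewrite near_withinE => /nbhs_norm0P[/= d /ltC0_real[r r0 ->] hd].
  exists r => // k kr.
  have [->|k0] := eqVneq k 0.
    by rewrite addr0 subrr mulr0 subrr normc0 mulr0.
  have /= := hd k; rewrite normC_lt => /(_ kr k0).
  rewrite -[X in `|X - _|](mulKf k0) /GRing.scale /= -mulrBr mulr1 normC_lt normcM.
  have nk : 0 < normc k by rewrite normc_gt0.
  have -> : normc k^-1 = (normc k)^-1 by rewrite normcV.
  rewrite mulrC ltr_pdivrMr// normcC [k + z]addrC [l * k]mulrC => hh.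
  exact: ltW.
move=> [l h]; apply/cvg_ex; exists l; apply/cvgrPdist_le => e /ltC0_real[r r0 ->].
rewrite nearE /dnbhs /within /=; apply/(@nbhs_norm0P C C^o).
have [d d0 hd] := h r r0.
exists d%:C => /=; first by rewrite ltcR.
move=> k /=; rewrite normC_lt => kd k0.
rewrite -[X in `|X - _|](mulKf k0) /GRing.scale /= -mulrBr mulr1.
have -> : (`|k^-1 * (k * l - (f (k + z) - f z))| <= r%:C) =
  (normc (k^-1 * (k * l - (f (k + z) - f z))) <= r) by exact: lecR.
have nk : 0 < normc k by rewrite normc_gt0.
rewrite normcM normcV mulrC ler_pdivrMr// normcC [k + z]addrC [k * l]mulrC.
exact: hd.
Qed.

Lemma cdiff_cont f z (e : R) : cdiff f z -> 0 < e ->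
  exists2 d : R, 0 < d & forall w, normc (w - z) < d -> normc (f w - f z) < e.
Proof.
move=> /cdiffP[l h] e0; have [d d0 hd] := h 1 ltr01.
have nl := normc_ge0 l.
exists (Num.min d (e / (normc l + 2))).
  by rewrite lt_min d0 divr_gt0//; lra.
move=> w; rewrite lt_min => /andP[w1 w2].
have := hd _ w1; rewrite [z + _]addrC subrK mul1r => h1.
have h2 := lerB_normc (f w - f z) (l * (w - z)).
move: w2; rewrite ltr_pdivlMr; last by lra.
have h3 := normc_ge0 (w - z).
rewrite normcM in h2 => w2; lra.
Qed.

Lemma entire_ccont f : entire f -> ccont f.
Proof. by move=> ef z e e0; exact: (cdiff_cont (ef z) e0). Qed.

Lemma cdiff_cst (c : C) z : cdiff (fun=> c) z. Proof. exact: derivable_cst. Qed.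
Lemma cdiff_id z : cdiff id z. Proof. exact: derivable_id. Qed.
Lemma cdiffB f g z : cdiff f z -> cdiff g z -> cdiff (fun z => f z - g z) z.
Proof. exact: derivableB. Qed.
Lemma cdiffM f g z : cdiff f z -> cdiff g z -> cdiff (fun z => f z * g z) z.
Proof. exact: (@derivableM C C^o f g z 1). Qed.
Lemma cdiffV f z : f z != 0 -> cdiff f z -> cdiff (fun z => (f z)^-1) z.
Proof. exact: (@derivableV C C^o f z 1). Qed.

Lemma cdiff_comp f g z : cdiff f z -> cdiff g (f z) -> cdiff (fun z => g (f z)) z.
Proof.
move=> /derivable1_diffP df /derivable1_diffP dg; apply/derivable1_diffP.
exact: (@differentiable_comp _ (C^o) (C^o) (C^o) f g z df dg).
Qed.

Lemma is_derive_eps (f : R -> R) (x l e : R) : is_derive x 1 f l -> 0 < e ->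
  exists2 d : R, 0 < d & forall h, `|h| < d -> `|f (x + h) - f x - l * h| <= e * `|h|.
Proof.
move=> [df fl] e0.
move/cvg_ex : df => [l' /[dup] /cvg_lim hl /cvgrPdist_le /(_ e e0)].
have -> : l' = l by rewrite -fl /derive hl.
rewrite near_withinE => /nbhs_norm0P[/= d d0 hd].
exists d => // k kd; have [->|k0] := eqVneq k 0.
  by rewrite addr0 subrr mulr0 subrr normr0 mulr0.
have /= := hd k kd k0.
rewrite -[X in `|X - _|](mulKf k0) /GRing.scale /= -mulrBr mulr1 normrM.
have nk : 0 < `|k| by rewrite normr_gt0.
by rewrite normfV mulrC ler_pdivrMr// distrC [k + x]addrC [l * k]mulrC.
Qed.

(** By the functional equation it is enough to expand at 0, where the remainder is controlled by the
    first order expansions of the real exp, cos and sin. *)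
Lemma cdiff_cexp z : cdiff cexp z.
Proof.
apply/cdiffP; exists (cexp z) => e e0.
have nz : 0 < normc (cexp z) by rewrite normc_gt0 cexp_neq0.
(* The constant 16 is 4 + 12, from the bounds on the real and the imaginary part of cexp h - 1 -
   h. *)
have [e' [e'0 e'1 e'e]] : exists e' : R, [/\ 0 < e', e' <= 1 & e' * (normc (cexp z) * 16) <= e].
  exists (Num.min 1 (e / (normc (cexp z) * 16))); split.
  - by rewrite lt_min ltr01/= divr_gt0// mulr_gt0.
  - by rewrite ge_min lexx.
  - by rewrite -ler_pdivlMr ?mulr_gt0// ge_min lexx orbT.
have [d1 d10 h1] := is_derive_eps (is_derive_expR (0 : R)) e'0.
have [d2 d20 h2] := is_derive_eps (is_derive_cos (0 : R)) e'0.
have [d3 d30 h3] := is_derive_eps (is_derive_sin (0 : R)) e'0.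
exists (Num.min (Num.min d1 e') (Num.min d2 d3)).
  by rewrite !lt_min d10 d20 d30 e'0.
move=> h; rewrite !lt_min => /andP[/andP[n1 n0] /andP[n2 n3]].
have -> : cexp (z + h) - cexp z - cexp z * h = cexp z * (cexp h - 1 - h).
  by rewrite cexpD; ring.
rewrite normcM.
case: h n0 n1 n2 n3 => a b; set k := normc (a +i* b) => n0 n1 n2 n3.
have ak : `|a| <= k by exact: (normr_Re_le (a +i* b)).
have bk : `|b| <= k by exact: (normr_Im_le (a +i* b)).
have k0 : 0 <= k by exact: normc_ge0.
have := h1 a (le_lt_trans ak n1); rewrite add0r expR0 mul1r => ha.
have := h2 b (le_lt_trans bk n2); rewrite add0r cos0 sin0 oppr0 mul0r subr0 => hb.
have := h3 b (le_lt_trans bk n3); rewrite add0r sin0 cos0 mul1r subr0 => hc.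
have ea : expR a <= 3.
  have : `|expR a - 1 - a| <= 1.
    apply: (le_trans ha); rewrite -[leRHS]mul1r; apply: ler_pM => //; first exact: ltW.
    by apply: (le_trans ak); lra.
  rewrite ler_norml => /andP[_ hh]; have := ler_norm a; lra.
have ea0 := expR_gt0 a.
have re : `|expR a * cos b - 1 - a| <= e' * k * 4.
  have -> : expR a * cos b - 1 - a = (expR a - 1 - a) + expR a * (cos b - 1) by ring.
  apply: (le_trans (ler_normD _ _)); rewrite normrM (ger0_norm (ltW ea0)).
  have i1 : e' * `|a| <= e' * k by rewrite ler_pM2l.
  have i2 : e' * `|b| <= e' * k by rewrite ler_pM2l.
  have i3 : expR a * `|cos b - 1| <= 3 * (e' * k).
    by apply: ler_pM => //; exact: le_trans i2.
  by move: ha; lra.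
have im : `|expR a * sin b - b| <= e' * k * 12.
  have -> : expR a * sin b - b = expR a * (sin b - b) + (expR a - 1 - a) * b + a * b by ring.
  have i0 : e' * `|b| <= e' * k by rewrite ler_pM2l.
  have i1 : expR a * `|sin b - b| <= 3 * (e' * k).
    by apply: ler_pM => //; exact: le_trans i0.
  have i2 : `|expR a - 1 - a| * `|b| <= e' * k.
    apply: (@le_trans _ _ (k * e')); last by rewrite mulrC.
    apply: ler_pM => //; last by apply: (le_trans bk); lra.
    apply: (le_trans ha); rewrite -[leRHS]mul1r; apply: ler_pM => //; exact: ltW.
  have i3 : `|a| * `|b| <= k * e' by apply: ler_pM => //; apply: (le_trans bk); lra.
  apply: (le_trans (ler_normD _ _)); rewrite normrM.
  apply: (@le_trans _ _ (3 * (e' * k) + e' * k + k * e')).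
    apply: lerD => //; apply: (le_trans (ler_normD _ _)).
    by rewrite !normrM (ger0_norm (ltW ea0)); apply: lerD.
  have : 0 <= e' * k by rewrite mulr_ge0// ltW.
  by rewrite (mulrC k e'); lra.
have nn : normc (cexp (a +i* b) - 1 - (a +i* b)) <= e' * k * 16.
  apply: (le_trans (normc_le_ReIm _)).
  rewrite !(ReD, ImD, ReN, ImN, Re_cexp, Im_cexp)/= subr0.
  by move: re im; lra.
apply: (@le_trans _ _ (normc (cexp z) * (e' * k * 16))); first by rewrite ler_pM2l.
have -> : normc (cexp z) * (e' * k * 16) = e' * (normc (cexp z) * 16) * k by ring.
by rewrite ler_wpM2r.
Qed.

End ComplexDerivative.

(** * Cauchy's theorem on circles, in the coordinate s + i t of the exponential *)

Section Cauchy.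
Context {R : realType}.
Local Notation C := R[i].
Local Notation Re := (@complex.Re R).
Local Notation Im := (@complex.Im R).
Local Notation mu := (@lebesgue_measure R).
Implicit Types (g f : C -> C) (z w : C).

Lemma cst_cvg0 (a : R) : (fun _ : nat => a) @ \oo --> (0 : R) -> a = 0.
Proof. by move/(cvg_lim (@Rhausdorff R)); rewrite lim_cst. Qed.

Lemma ccont_bounded_rect g (a b c d : R) : ccont g ->
  exists M : R, forall z, a <= Re z <= b -> c <= Im z <= d -> normc (g z) <= M.
Proof.
move=> cg.
pose F := fun p : R * R => normc (g (p.1 +i* p.2)).
have cF : continuous F.
  move=> [x y]; apply/cvgrPdist_lt => e e0.
  have [k k0 hk] := cg (x +i* y) e e0.
  have k20 : 0 < k / 2 by rewrite divr_gt0.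
  exists (ball x (k / 2), ball y (k / 2)) => /=; first by split; exact: nbhsx_ballx.
  move=> [x' y'] [/= bx by_].
  have h : normc ((x' +i* y') - (x +i* y)) < k.
    apply: (le_lt_trans (normc_le_ReIm _)); rewrite !ReImE/=.
    move: bx by_; rewrite /ball/= distrC [`|y - _|]distrC => ? ?; lra.
  have := hk _ h; apply: le_lt_trans; rewrite /F/=.
  rewrite ler_norml; apply/andP; split.
    by rewrite lerNl opprB; exact: lerB_normc.
  by rewrite normcC; exact: lerB_normc.
have cK : compact (F @` (`[a, b]%classic `*` `[c, d]%classic)).
  apply: continuous_compact; first exact: continuous_subspaceT.
  by apply: compact_setX; exact: segment_compact.
have [M [_ hM]] := compact_bounded cK.
exists (M + 1) => z za zc; have := hM (M + 1) (ltr_pwDr ltr01 (lexx _)) (F (Re z, Im z)).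
rewrite /F/= (_ : (Re z +i* Im z) = z); last by case: (z).
rewrite ger0_norm ?normc_ge0//; apply.
exists (Re z, Im z); first by split => /=; rewrite in_itv.
by rewrite /=; case: (z).
Qed.

(** For g(z) = F(e^z) e^z this is 1/i times the contour integral of F over the circle of radius
    e^s. *)
Definition vint g (s : R) : C := cint mu `[0, pi *+ 2] (fun t => g (s +i* t)).

Let pi20 : 0 <= pi *+ 2 :> R. Proof. by rewrite mulrn_wge0// pi_ge0. Qed.

(** Goursat on a rectangle one period high: the two horizontal sides cancel by periodicity. *)
Lemma vint_shift g (s a : R) : ccont g -> 0 <= a ->
  (forall z, s <= Re z <= s + a -> cdiff g z) ->
  (forall z, g (z + 0 +i* (pi *+ 2)) = g z) -> vint g (s + a) = vint g s.
Proof.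
move=> cg a0 dg pg.
have := @goursat R g s 0 a (pi *+ 2) cg a0 pi20 (fun z h => (cdiffP g z).1 (dg z h)).
rewrite /rect_int add0r cintB_itv; [|exact: rcont_hline..].
have -> : cint mu `[s, s + a] (fun t => g (t +i* (pi *+ 2))) =
    cint mu `[s, s + a] (fun t => g (t +i* 0)).
  apply: eq_cint => t _; rewrite -[RHS]pg; congr g.
  by apply: complexP => /=; rewrite ?addr0 ?add0r.
rewrite subrr add0r => /eqP; rewrite mulf_eq0 => /orP[|].
  by rewrite eq_complex/= oner_eq0 andbF.
by rewrite cintB_itv; [|exact: rcont_vline..]; rewrite subr_eq0 => /eqP.
Qed.

Lemma vint_const g (s t : R) : ccont g -> s <= t ->
  (forall z, s <= Re z <= t -> cdiff g z) ->
  (forall z, g (z + 0 +i* (pi *+ 2)) = g z) -> vint g s = vint g t.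
Proof.
move=> cg st dg pg; rewrite -[t](subrKC s); apply/esym; apply: vint_shift => //.
  by rewrite subr_ge0.
by move=> z; rewrite subrKC; exact: dg.
Qed.

(** Serves to reach a circle on which [g] is only known to be continuous, as a limit of neighbouring
    circles. *)
Lemma cvg_vint g (s : R^nat) (s0 : R) : ccont g ->
  (forall n, `|s n - s0| <= 1) -> s n @[n --> \oo] --> s0 ->
  normc (vint g (s n) - vint g s0) @[n --> \oo] --> 0.
Proof.
move=> cg s1 cs.
have [M hM] := @ccont_bounded_rect g (s0 - 1) (s0 + 1) 0 (pi *+ 2) cg.
apply: (@cint_dominated _ _ R mu (fun n t => g (s n +i* t)) _ (fun=> M) _ _ _ _ _ _ _).2 => //.
- by move=> n; apply: rcont_meas; exact: rcont_vline.
- by apply: rcont_meas; exact: rcont_vline.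
- move=> t _; apply/cvgrPdist_lt => e e0; have [d d0 hd] := cg (s0 +i* t) e e0.
  move/cvgrPdist_lt : cs => /(_ d d0); apply: filterS => n; rewrite distrC => h.
  rewrite sub0r normrN ger0_norm ?normc_ge0//; apply: hd.
  by apply: le_lt_trans h; exact: normc_hline.
- apply: continuous_compact_integrable; first exact: segment_compact.
  by apply: continuous_subspaceT => t; exact: cvg_cst.
- move=> n t /=; rewrite in_itv/= => tt; apply: hM => //=.
  by have := s1 n; rewrite ler_norml => ?; lra.
Qed.

Lemma normc_vint_le g (s M : R) : ccont g ->
  (forall t, normc (g (s +i* t)) <= M) -> normc (vint g s) <= M * (pi *+ 2).
Proof.
move=> cg hM; have := @normc_cint_itv_le R (fun t => g (s +i* t)) 0 (pi *+ 2) M.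
by rewrite subr0; apply => //; exact: rcont_vline.
Qed.

Lemma cexp_period z : cexp (z + 0 +i* (pi *+ 2)) = cexp z.
Proof.
rewrite cexpD -[RHS]mulr1; congr (_ * _).
by rewrite /cexp/= expR0 mul1r cos2pi sin2pi.
Qed.

Lemma ccont_comp f g : ccont f -> ccont g -> ccont (fun z => g (f z)).
Proof.
move=> cf cg z e e0; have [d d0 hd] := cg (f z) e e0.
have [k k0 hk] := cf z d d0.
by exists k => // w wz; apply: hd; exact: hk.
Qed.

Lemma ccontM f g : ccont f -> ccont g -> ccont (fun z => f z * g z).
Proof.
move=> cf cg z e e0.
pose k := normc (f z) + normc (g z) + 1.
have k0 : 0 < k by rewrite /k; have := normc_ge0 (f z); have := normc_ge0 (g z); lra.
have [d1 d10 h1] := cf z (Num.min 1 (e / 2 / k)) ltac:(by rewrite lt_min ltr01 !divr_gt0).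
have [d2 d20 h2] := cg z (e / 2 / k) ltac:(by rewrite !divr_gt0).
exists (Num.min d1 d2); first by rewrite lt_min d10.
move=> w; rewrite lt_min => /andP[/h1 w1 /h2 w2].
move: w1; rewrite lt_min => /andP[w0 w1].
have -> : f w * g w - f z * g z = (f w - f z) * (g w - g z) + (f w - f z) * g z + f z * (g w - g z) by ring.
have a := normc_ge0 (f w - f z); have b := normc_ge0 (g w - g z).
have a' := normc_ge0 (f z); have b' := normc_ge0 (g z).
apply: (le_lt_trans (le_normcD _ _)); rewrite normcM.
apply: (@le_lt_trans _ _ (normc (g w - g z) + normc (f w - f z) * normc (g z) + normc (f z) * normc (g w - g z))).
  rewrite lerD2r; apply: (le_trans (le_normcD _ _)); rewrite !normcM lerD2r.
  by rewrite ler_piMl// ltW.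
apply: (@le_lt_trans _ _ ((e / 2 / k) * (1 + normc (f z) + normc (g z)))).
  rewrite !mulrDr mulr1.
  have i1 : normc (f w - f z) * normc (g z) <= e / 2 / k * normc (g z).
    by apply: ler_wpM2r => //; exact: ltW.
  have i2 : normc (f z) * normc (g w - g z) <= e / 2 / k * normc (f z).
    by rewrite mulrC; apply: ler_wpM2r => //; exact: ltW.
  by lra.
rewrite (_ : 1 + _ + _ = k); last by rewrite /k; ring.
by rewrite divfK ?gt_eqF//; lra.
Qed.

Lemma cdiff_ccont f : (forall z, cdiff f z) -> ccont f.
Proof. exact: entire_ccont. Qed.

Lemma ccont_cexp : ccont (cexp : C -> C).
Proof. by apply: cdiff_ccont => z; exact: cdiff_cexp. Qed.

(** The difference quotient at [w], filled in by [l]. When [l] is the derivative it is continuous at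
    [w], which is all that is shown about it there. *)
Definition dslope f w (l z : C) : C := if z == w then l else (f z - f w) / (z - w).

Lemma cdiff_dslope f w l z : (forall z, cdiff f z) -> z != w -> cdiff (dslope f w l) z.
Proof.
move=> df zw.
have h : cdiff (fun z => (f z - f w) / (z - w)) z.
  apply: cdiffM; first by apply: cdiffB => //; exact: cdiff_cst.
  apply: cdiffV; first by rewrite subr_eq0.
  by apply: cdiffB; [exact: cdiff_id|exact: cdiff_cst].
move/cdiffP : h => [m hm]; apply/cdiffP; exists m => e e0.
have [d d0 hd] := hm e e0.
exists (Num.min d (normc (z - w))).
  by rewrite lt_min d0 normc_gt0 subr_eq0.
move=> h; rewrite lt_min => /andP[h1 h2].
rewrite /dslope (negbTE zw) ifF; first exact: hd.
apply/negbTE; rewrite -subr_eq0; apply/eqP => e1.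
have : normc (z - w) = normc h.
  by rewrite -[RHS]normcN; congr normc; apply/eqP; rewrite -subr_eq0 opprK addrAC e1.
by move=> e2; rewrite e2 ltxx in h2.
Qed.

Lemma ccont_dslope f w l : (forall z, cdiff f z) -> cderiv f w l -> ccont (dslope f w l).
Proof.
move=> df dl z e e0; have [->|zw] := eqVneq z w; last first.
  by apply: cdiff_cont => //; exact: cdiff_dslope.
have [d d0 hd] := dl (e / 2) ltac:(by rewrite divr_gt0).
exists d => // v vd; rewrite /dslope eqxx; case: eqVneq => [|vw]; first by rewrite subrr normc0.
have n0 : 0 < normc (v - w) by rewrite normc_gt0 subr_eq0.
have := hd _ vd; rewrite [w + _]addrC subrK.
rewrite (_ : f v - f w - l * (v - w) = ((f v - f w) / (v - w) - l) * (v - w)); last first.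
  by rewrite mulrBl divfK// subr_eq0.
by rewrite normcM ler_pM2r// => h; apply: (le_lt_trans h); lra.
Qed.

Lemma normc_expi (s t : R) : normc (cexp (s +i* t)) = expR s.
Proof. by rewrite normc_cexp. Qed.

(** The contour integral of the difference quotient vanishes. As a function of the radius it is
    constant on either side of |w|, and continuity across |w| joins the two constants; the lower one
    is 0 because the circles shrink to a point. *)
Lemma vint_dslope f w s : (forall z, cdiff f z) -> normc w < expR s -> exists l,
  vint (fun z => dslope f w l (cexp z) * cexp z) s = 0.
Proof.
move=> df ws; have /cdiffP[l dl] := df w; exists l.
set g := (fun z => _).
have cg : ccont g.
  apply: ccontM; last exact: ccont_cexp.
  by apply: ccont_comp; [exact: ccont_cexp|exact: ccont_dslope].
have pg z : g (z + 0 +i* (pi *+ 2)) = g z by rewrite /g cexp_period.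
have dg z : expR (Re z) != normc w -> cdiff g z.
  move=> zw; apply: cdiffM; last exact: cdiff_cexp.
  apply: (@cdiff_comp _ cexp); first exact: cdiff_cexp.
  by apply: cdiff_dslope => //; apply: contra_neq zw => <-; rewrite normc_cexp.
(* As [s] tends to minus infinity the circle shrinks to [0], where [g] is
   [cexp] times a bounded function. *)
have small (t : R) : (forall u, u <= t -> vint g u = vint g t) -> vint g t = 0.
  move=> ht; apply/eqP; rewrite -normc_eq0 eq_le normc_ge0 andbT.
  apply/ler_addgt0Pr => e e0; rewrite add0r.
  have [d d0 hd] := ccont_dslope df dl 0 ltr01.
  pose M := normc (dslope f w l 0) + 1.
  have M0 : 0 < M by rewrite /M; have := normc_ge0 (dslope f w l 0); lra.
  have [u [ut ud ue]] : exists u : R, [/\ u <= t, expR u < d & M * expR u * (pi *+ 2) <= e].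
    pose k := Num.min (d / 2) (e / (M * (pi *+ 2))).
    have P0 : 0 < M * (pi *+ 2) by rewrite mulr_gt0// pmulrn_lgt0// pi_gt0.
    have k0 : 0 < k by rewrite /k lt_min !divr_gt0.
    exists (Num.min t (ln k)); split; first by rewrite ge_min lexx.
      apply: (@le_lt_trans _ _ k); last by rewrite /k gt_min; apply/orP; left; lra.
      by rewrite -[leRHS]lnK ?posrE// ler_expR ge_min lexx orbT.
    rewrite mulrAC mulrC -ler_pdivlMr// (@le_trans _ _ k)//; last by rewrite /k ge_min lexx orbT.
    by rewrite -[leRHS]lnK ?posrE// ler_expR ge_min lexx orbT.
  rewrite -(ht u ut); apply: le_trans ue; apply: normc_vint_le => // x.
  rewrite /g normcM normc_expi ler_pM2r ?expR_gt0// /M -lerBlDl.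
  apply: (le_trans (lerB_normc _ _)); apply/ltW/hd.
  by rewrite subr0 normc_expi.
have below t : expR t < normc w -> vint g t = 0.
  move=> tw; apply: small => u ut; apply: vint_const => // z /andP[_ zt].
  by apply: dg; rewrite lt_eqF// (le_lt_trans _ tw)// ler_expR.
have above t u : normc w < expR t -> t <= u -> vint g t = vint g u.
  move=> tw tu; apply: vint_const => // z /andP[tz _].
  by apply: dg; rewrite gt_eqF// (lt_le_trans tw)// ler_expR.
(* For w = 0 every circle lies above the exceptional radius, and shrinking gives the result
   directly. *)
have [w0|w0] := eqVneq w 0.
  apply: small => u us; apply: above => //.
  by rewrite w0 normc0 expR_gt0.
have nw : 0 < normc w by rewrite normc_gt0.
have sw : ln (normc w) < s by rewrite -ltr_expR lnK ?posrE.
set s0 := ln (normc w) in sw.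
have es0 : expR s0 = normc w by rewrite /s0 lnK ?posrE.
have inv1 n : `|(n.+1%:R : R)^-1| <= 1.
  by rewrite ger0_norm ?invr_ge0// invf_le1 ?ler1n// ltr0n.
have ch : n.+1%:R^-1 @[n --> \oo] --> (0 : R) by exact: cvg_harmonic.
(* Approach to the critical circle from inside. *)
have g0 : vint g s0 = 0.
  have := @cvg_vint g (fun n => s0 - n.+1%:R^-1) s0 cg.
  have i n : `|s0 - n.+1%:R^-1 - s0| <= 1.
    by rewrite (_ : _ - _ = - n.+1%:R^-1) ?normrN//; ring.
  move=> /(_ i); have -> : (fun n => normc (vint g (s0 - n.+1%:R^-1) - vint g s0)) = cst (normc (vint g s0)).
    apply/funext => n; rewrite below ?sub0r ?normcN//.
    by rewrite -es0 ltr_expR ltrBlDr ltrDl invr_gt0.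
  have cs : s0 - n.+1%:R^-1 @[n --> \oo] --> s0.
    by rewrite -[X in _ --> X]subr0; apply: cvgB => //; exact: cvg_cst.
  by move=> /(_ cs) /cst_cvg0 /eqP; rewrite normc_eq0 => /eqP.
have same u : s0 < u -> vint g u = vint g s.
  have lt v : s0 < v -> normc w < expR v by rewrite -es0 ltr_expR.
  move=> su; have [us|su'] := leP u s; first exact: (above u s (lt _ su) us).
  exact/esym/(above s u (lt _ sw) (ltW su')).
(* Approach from outside, where the integral has the constant value [vint g s]. *)
have := @cvg_vint g (fun n => s0 + n.+1%:R^-1) s0 cg.
have i n : `|s0 + n.+1%:R^-1 - s0| <= 1.
  by rewrite (_ : _ - _ = n.+1%:R^-1)//; ring.
move=> /(_ i); have -> : (fun n => normc (vint g (s0 + n.+1%:R^-1) - vint g s0)) = cst (normc (vint g s)).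
  by apply/funext => n; rewrite g0 subr0 same// ltrDl invr_gt0.
have cs : s0 + n.+1%:R^-1 @[n --> \oo] --> s0.
  by rewrite -[X in _ --> X]addr0; apply: cvgD => //; exact: cvg_cst.
by move=> /(_ cs) /cst_cvg0 /eqP; rewrite normc_eq0 => /eqP.
Qed.

End Cauchy.

(** * Taylor expansion of entire functions *)

Section Taylor.
Context {R : realType}.
Local Notation C := R[i].
Local Notation Re := (@complex.Re R).
Local Notation Im := (@complex.Im R).
Local Notation mu := (@lebesgue_measure R).
Implicit Types (g f : C -> C) (z w : C).

Lemma cdiffX f z n : cdiff f z -> cdiff (fun z => f z ^+ n) z.
Proof.
move=> df; elim: n => [|n IH].
  by under [X in cdiff X]eq_fun do rewrite expr0; exact: cdiff_cst.
by under [X in cdiff X]eq_fun do rewrite exprS; exact: cdiffM.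
Qed.

Definition circle_coef f (n : nat) (s : R) : C :=
  vint (fun z => f (cexp z) * (cexp z)^-1 ^+ n) s.

Lemma circle_coef_const f n s : (forall z, cdiff f z) ->
  circle_coef f n s = circle_coef f n 0.
Proof.
move=> df; set g := (fun z => f (cexp z) * (cexp z)^-1 ^+ n).
have dg z : cdiff g z.
  apply: cdiffM; first by apply: (@cdiff_comp _ cexp) => //; exact: cdiff_cexp.
  by apply: cdiffX; apply: cdiffV; [exact: cexp_neq0|exact: cdiff_cexp].
have cg : ccont g by exact: cdiff_ccont.
have pg z : g (z + 0 +i* (pi *+ 2)) = g z by rewrite /g cexp_period.
have [s0|s0] := leP s 0; first exact: vint_const.
by apply/esym/vint_const => //; exact: ltW.
Qed.

(** For n > 0 the integral is multiplied by e^{-ns} when the radius becomes e^s, yet it does not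
    depend on the radius; so it is 0. *)
Lemma circle_coef1 n : circle_coef (fun=> 1) n 0 = if n == 0 then (pi *+ 2)%:C else 0.
Proof.
have pi20 : 0 <= pi *+ 2 :> R by rewrite mulrn_wge0// pi_ge0.
have cst_c s : circle_coef (fun=> 1) n s =
    ((expR s)^-1 ^+ n)%:C * circle_coef (fun=> 1) n 0.
  rewrite /circle_coef /vint -cintZ//.
    apply: eq_cint => t _; rewrite !mul1r.
    have -> : s +i* t = s%:C + 0 +i* t by apply: complexP; rewrite /= ?addr0 ?add0r.
    by rewrite cexpD cexp_real invfM exprMn rmorphXn fmorphV.
  apply: rcont_cinteg; apply: (@rcont_vline _ (fun z => 1 * (cexp z)^-1 ^+ n)).
  apply: cdiff_ccont => z; apply: cdiffM; first exact: cdiff_cst.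
  by apply: cdiffX; apply: cdiffV; [exact: cexp_neq0|exact: cdiff_cexp].
case: n cst_c => [|n] cst_c /=.
  rewrite /circle_coef /vint -[RHS]mul1r -[X in (X)%:C]subr0 -cint_itv_cst//.
  by apply: eq_cint => t _; rewrite mul1r expr0.
have := cst_c 1; rewrite circle_coef_const; last by move=> z; exact: cdiff_cst.
set K := circle_coef _ _ _ => /eqP; rewrite -subr_eq0 -{1}[K]mul1r -mulrBl mulf_eq0.
case/orP => [|/eqP//].
rewrite -(rmorph1 (real_complex R)) -rmorphB/= eq_complex/= eqxx andbT subr_eq0 => /eqP e1.
have : (expR 1 : R)^-1 ^+ n.+1 < 1.
  by rewrite exprn_ilt1 ?invr_ge0 ?expR_ge0// invf_lt1 ?expR_gt0// expR_gt1.
by rewrite -e1 ltxx.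
Qed.

(** Cauchy's formula for the n-th coefficient, on the unit circle. *)
Definition taylor_coef f (n : nat) : C := ((pi *+ 2)^-1)%:C * circle_coef f n 0.

(** With q = w / Z on a circle of radius at least twice |w|, the Cauchy kernel is the geometric
    series in q, whose tail after N + 1 terms is q^{N+1} / (1 - q). The rate 2^-N, uniform on the
    disk, is what the later limits use. *)
Lemma taylor_bound f (rho : R) : (forall z, cdiff f z) -> 0 <= rho ->
  exists2 K : R, 0 <= K & forall N w, normc w <= rho ->
    normc (f w - \sum_(n < N.+1) taylor_coef f n * w ^+ n) <= K / 2 ^+ N.
Proof.
move=> df rho0; have cf := cdiff_ccont df.
(* This radius gives |w / Z| <= 1/2, and it is positive even for rho = 0. *)
pose r := rho *+ 2 + 1; have r0 : 0 < r by rewrite /r mulr2n; lra.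
have [M0 hM0] := @ccont_bounded_rect R f (- r) r (- r) r cf.
pose M := Num.max M0 0.
have Mge0 : 0 <= M by rewrite le_max lexx orbT.
have hM z : normc z <= r -> normc (f z) <= M.
  move=> zr; rewrite le_max; apply/orP; left; apply: hM0; rewrite -ler_norml.
    exact: le_trans (normr_Re_le _) zr.
  exact: le_trans (normr_Im_le _) zr.
exists (M * 4); first by rewrite mulr_ge0.
move=> N w wrho.
pose s := ln r; have es : expR s = r by rewrite lnK ?posrE.
have wr : normc w < r by rewrite /r mulr2n; have := normc_ge0 w; lra.
have [l] := @vint_dslope R f w s df ltac:(by rewrite es).
pose Z t := cexp (s +i* t) : C.
have nZ t : normc (Z t) = r by rewrite /Z normc_expi.
have Z0 t : Z t != 0 by exact: cexp_neq0.
have Zw t : Z t - w != 0.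
  by rewrite subr_eq0; apply/eqP => e; move: wr; rewrite -e nZ ltxx.
have cZ : rcont Z by exact: (rcont_vline s ccont_cexp).
have cfZ : rcont (fun t => f (Z t)).
  exact: (@rcont_vline R (fun z => f (cexp z)) s (ccont_comp ccont_cexp cf)).
have cZV n : rcont (fun t => (Z t)^-1 ^+ n).
  apply: (@rcont_vline R (fun z => (cexp z)^-1 ^+ n) s); apply: cdiff_ccont => z.
  by apply: cdiffX; apply: cdiffV; [exact: cexp_neq0|exact: cdiff_cexp].
have cq : rcont (fun t => dslope f w l (Z t) * Z t).
  have /cdiffP[l' dl'] := df w.
  apply: rcontP => t e e0.
  have h : cdiff (fun z => dslope f w l (cexp z) * cexp z) (s +i* t).
    apply: cdiffM; last exact: cdiff_cexp.
    apply: (@cdiff_comp _ cexp); first exact: cdiff_cexp.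
    by apply: cdiff_dslope => //; have := Zw t; rewrite subr_eq0.
  have [d d0 hd] := cdiff_cont h e0.
  by exists d => // u ut; apply: hd; exact: le_lt_trans (normc_vline _ _ _) ut.
pose S := \sum_(n < N.+1) taylor_coef f n * w ^+ n.
(* Pointwise this is (f(Z) - f(w)) times the tail of the geometric series; its integral is 2 pi
   (f(w) - S), since the first term integrates to 0. *)
pose rem t := dslope f w l (Z t) * Z t - \sum_(n < N.+1) w ^+ n * ((f (Z t) - f w) * (Z t)^-1 ^+ n).
have cterm n : rcont (fun t => w ^+ n * ((f (Z t) - f w) * (Z t)^-1 ^+ n)).
  apply: rcontM; first exact: rcont_cst.
  by apply: rcontM => //; apply: rcontB => //; exact: rcont_cst.
have csum : rcont (fun t => \sum_(n < N.+1) w ^+ n * ((f (Z t) - f w) * (Z t)^-1 ^+ n)).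
  elim: (N.+1) => [|n IH].
    by under [X in rcont X]eq_fun do rewrite big_ord0; exact: rcont_cst.
  by under [X in rcont X]eq_fun do rewrite big_ord_recr; exact: rcontD.
have pi20 : 0 < pi *+ 2 :> R by rewrite pmulrn_lgt0// pi_gt0.
have remE : cint mu `[0, pi *+ 2] rem = vint (fun z => dslope f w l (cexp z) * cexp z) s
     - (pi *+ 2)%:C * (S - f w).
  rewrite /rem cintB_itv//; congr (_ - _).
  rewrite (@cint_sum _ _ _ mu _ _ (fun n t => w ^+ n * ((f (Z t) - f w) * (Z t)^-1 ^+ n)))//; last first.
    by move=> n; exact: rcont_cinteg.
  have termE n : cint mu `[0, pi *+ 2] (fun t => w ^+ n * ((f (Z t) - f w) * (Z t)^-1 ^+ n)) =
      (pi *+ 2)%:C * (taylor_coef f n * w ^+ n - (if n == 0 then f w else 0)).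
    rewrite cintZ//; last first.
      by apply: rcont_cinteg; apply: rcontM => //; apply: rcontB => //; exact: rcont_cst.
    have -> : cint mu `[0, pi *+ 2] (fun t => (f (Z t) - f w) * (Z t)^-1 ^+ n) =
        circle_coef f n s - f w * circle_coef (fun=> 1) n s.
      rewrite /circle_coef /vint -cintZ//; last first.
        by apply: rcont_cinteg; apply: rcontM => //; exact: rcont_cst.
      rewrite -cintB_itv; last 2 first.
      - exact: rcontM.
      - by apply: rcontM; [exact: rcont_cst|apply: rcontM => //; exact: rcont_cst].
      by apply: eq_cint => t _; rewrite mul1r mulrBl.
    rewrite circle_coef_const// (circle_coef_const n s (fun z => @cdiff_cst R 1 z)) circle_coef1.
    have -> : circle_coef f n 0 = (pi *+ 2)%:C * taylor_coef f n.
      by rewrite /taylor_coef mulrA -rmorphM/= divff ?mul1r// gt_eqF.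
    case: n => [|n] /=; first by rewrite expr0; ring.
    by ring.
  rewrite (eq_bigr (fun n : 'I_N.+1 => (pi *+ 2)%:C *
    (taylor_coef f n * w ^+ n - (if n == 0 :> nat then f w else 0)))); last by move=> n _; exact: termE.
  rewrite -big_distrr/= sumrB; congr (_ * (_ - _)).
  by rewrite big_ord_recl/= big1 ?addr0// => n _.
move=> v0; rewrite v0 sub0r -mulrN opprB in remE.
have qE t : w / Z t = w * (Z t)^-1 by [].
have nq t : normc (w / Z t) <= 2^-1.
  have rE : r = rho + rho + 1 by rewrite /r mulr2n.
  by rewrite normcM normcV nZ ler_pdivrMr// rE; lra.
have q1 t : 2^-1 <= normc (1 - w / Z t).
  by apply: le_trans (lerB_normc _ _); rewrite normc1; have := nq t; lra.
have q10 t : 1 - w / Z t != 0 by rewrite -normc_gt0 (lt_le_trans _ (q1 t))// invr_gt0.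
have nrem t : normc (rem t) <= M * 4 / 2 ^+ N.
  have -> : rem t = (f (Z t) - f w) * (w / Z t) ^+ N.+1 / (1 - w / Z t).
    have -> : rem t = (f (Z t) - f w) * ((1 - w / Z t)^-1 - \sum_(n < N.+1) (w / Z t) ^+ n).
      rewrite mulrBr /rem; congr (_ - _).
        rewrite /dslope ifF; last by apply/negbTE; rewrite -subr_eq0; exact: Zw.
        rewrite -mulrA; congr (_ * _).
        have -> : 1 - w / Z t = (Z t - w) / Z t by rewrite mulrBl divff.
        by rewrite invf_div mulrC.
      rewrite big_distrr/=; apply: eq_bigr => n _.
      by rewrite exprMn mulrCA.
    rewrite -mulrA; congr (_ * _).
    apply: (mulIf (q10 t)); rewrite mulrBl mulVf// divfK//.
    have := subrX1 (w / Z t) N.+1; rewrite -opprB => /eqP.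
    rewrite eqr_oppLR => /eqP; rewrite -mulNr opprB => e.
    by rewrite mulrC -e; ring.
  rewrite !normcM normcX normcV.
  have h1 : normc (f (Z t) - f w) <= M + M.
    by apply: (le_trans (le_normcB _ _)); apply: lerD; apply: hM; rewrite ?nZ// ltW.
  have h2 : normc (w / Z t) ^+ N.+1 <= 2^-1 ^+ N.+1.
    by rewrite lerXn2r// ?nnegrE ?normc_ge0.
  have h3 : (normc (1 - w / Z t))^-1 <= 2.
    by rewrite -[leRHS]invrK lef_pV2 ?posrE ?invr_gt0// normc_gt0.
  apply: (@le_trans _ _ ((M + M) * 2^-1 ^+ N.+1 * 2)).
    apply: ler_pM => //; rewrite ?invr_ge0 ?normc_ge0 ?mulr_ge0 ?normc_ge0 ?exprn_ge0 ?normc_ge0//.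
    by apply: ler_pM => //; rewrite ?normc_ge0 ?exprn_ge0 ?normc_ge0.
  rewrite exprS exprVn.
  have k0 : 0 <= M * (2 ^+ N)^-1 by rewrite mulr_ge0// invr_ge0 exprn_ge0.
  have -> : (M + M) * (2^-1 * (2 ^+ N)^-1) * 2 = M * (2 ^+ N)^-1 * 2 by field; rewrite expf_neq0.
  have -> : M * 4 / 2 ^+ N = M * (2 ^+ N)^-1 * 4 by rewrite mulrAC.
  by rewrite ler_wpM2l// ler_nat.
have crem : rcont rem by exact: rcontB.
have := @normc_cint_itv_le R rem 0 (pi *+ 2) _ crem (ltW pi20) (fun t _ => nrem t).
rewrite remE normcM normc_real ger0_norm ?(ltW pi20)// subr0 [_ * (pi *+ 2)]mulrC.
by rewrite ler_pM2l.
Qed.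

End Taylor.

(** * Complex Gaussian integrals *)

Section RealDerivative.
Context {R : realType}.
Local Notation C := R[i].
Local Notation Re := (@complex.Re R).
Local Notation Im := (@complex.Im R).
Local Notation mu := (@lebesgue_measure R).
Implicit Types (u v : R -> C).

Definition rderiv u u' : Prop := forall x : R,
  is_derive x 1 (fun t => Re (u t)) (Re (u' x)) /\
  is_derive x 1 (fun t => Im (u t)) (Im (u' x)).

Lemma rderiv_cst (c : C) : rderiv (fun=> c) (fun=> 0).
Proof. by move=> x; split => /=; exact: is_derive_cst. Qed.

Lemma rderiv_real (f f' : R -> R) : (forall x : R, is_derive x 1 f (f' x)) ->
  rderiv (fun x => (f x)%:C) (fun x => (f' x)%:C).
Proof. by move=> h x; split => //=; exact: is_derive_cst. Qed.

Lemma rderivD u u' v v' : rderiv u u' -> rderiv v v' ->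
  rderiv (fun x => u x + v x) (fun x => u' x + v' x).
Proof.
move=> du dv x; have [a b] := du x; have [a' b'] := dv x.
by split; under eq_fun do rewrite ReImE; rewrite ReImE; exact: is_deriveD.
Qed.

Lemma rderivM u u' v v' : rderiv u u' -> rderiv v v' ->
  rderiv (fun x => u x * v x) (fun x => u' x * v x + u x * v' x).
Proof.
move=> du dv x; have [a b] := du x; have [a' b'] := dv x.
split; under eq_fun do rewrite ReImE; rewrite !ReImE.
  apply: (is_derive_eq (is_deriveB (is_deriveM a a') (is_deriveM b b'))).
  by rewrite /GRing.scale /=; ring.
apply: (is_derive_eq (is_deriveD (is_deriveM a b') (is_deriveM b a'))).
by rewrite /GRing.scale /=; ring.
Qed.

Lemma rderivZ (c : C) u u' : rderiv u u' -> rderiv (fun x => c * u x) (fun x => c * u' x).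
Proof.
move=> du; have := rderivM (rderiv_cst c) du.
by under [X in rderiv _ X -> _]eq_fun do rewrite mul0r add0r.
Qed.

Lemma rderiv_eq u u' v v' : (forall x, u x = v x) -> (forall x, u' x = v' x) ->
  rderiv u u' -> rderiv v v'.
Proof. by move=> /funext -> /funext ->. Qed.

Lemma rderiv_cexp u u' : rderiv u u' ->
  rderiv (fun x => cexp (u x)) (fun x => u' x * cexp (u x)).
Proof.
move=> du x; have [a b] := du x.
split; [under eq_fun do rewrite Re_cexp|under eq_fun do rewrite Im_cexp];
  rewrite ReImE Re_cexp Im_cexp.
  apply: (is_derive_eq (is_deriveM (is_derive1_comp (is_derive_expR _) a)
    (is_derive1_comp (is_derive_cos _) b))).
  by rewrite /GRing.scale /=; ring.
apply: (is_derive_eq (is_deriveM (is_derive1_comp (is_derive_expR _) a)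
    (is_derive1_comp (is_derive_sin _) b))).
by rewrite /GRing.scale /=; ring.
Qed.

Lemma rderiv_id : rderiv (fun x => x%:C) (fun=> 1).
Proof.
by apply: (@rderiv_eq (fun x => x%:C) (fun x => (1 : R)%:C)) => //; exact: rderiv_real.
Qed.

Lemma rderivX u u' n : rderiv u u' ->
  rderiv (fun x => u x ^+ n) (fun x => n%:R * u' x * u x ^+ n.-1).
Proof.
move=> du; elim: n => [|n IH].
  apply: (rderiv_eq _ _ (rderiv_cst 1)) => x; rewrite ?expr0//.
  by rewrite !mul0r.
apply: (rderiv_eq _ _ (rderivM du IH)) => x; first by rewrite exprS.
case: n {IH} => [|n] /=; first by rewrite expr0; ring.
by rewrite !exprS -natr1; ring.
Qed.

Lemma rderiv_rcont u u' : rderiv u u' -> rcont u.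
Proof.
by move=> du; split => x; have [[a _] [b _]] := du x; apply: differentiable_continuous;
  exact/derivable1_diffP.
Qed.

Lemma rderiv0_cst u x y : rderiv u (fun=> 0) -> u x = u y.
Proof.
by move=> du; apply: complexP;
  [apply: (@is_derive_0_is_cst R (fun t => Re (u t)))|
   apply: (@is_derive_0_is_cst R (fun t => Im (u t)))] => t; have [] := du t.
Qed.

Lemma FTC_itv u u' a b : rderiv u u' -> rcont u' -> a < b ->
  cint mu `[a, b] u' = u b - u a.
Proof.
move=> du [c1 c2] ab.
have aux (F f : R -> R) : (forall x : R, is_derive x 1 F (f x)) -> continuous f ->
    \int[mu]_(x in `[a, b]) f x = F b - F a.
  move=> dF cf; rewrite /Rintegral (@continuous_FTC2 R f F)//.
  - exact: continuous_subspaceT.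
  - have cF : continuous F.
      by move=> x; apply: differentiable_continuous; apply/derivable1_diffP; have [] := dF x.
    split.
    + by move=> x _; have [] := dF x.
    + exact/cvg_at_right_filter/cF.
    + exact/cvg_at_left_filter/cF.
  - by move=> x _; rewrite derive1E; have [_ ->] := dF x.
apply: complexP; rewrite !ReImE /=.
  by apply: (aux (fun t => Re (u t))) => // x; have [] := du x.
by apply: (aux (fun t => Im (u t))) => // x; have [] := du x.
Qed.

Definition gdec u : Prop := exists K c : R, 0 < c /\
  forall x, normc (u x) <= K * expR (- (c * x ^+ 2)).

(** Up to its peak value the integrand is the normal density of mean [m] and variance 1 / (2c),
    whose mass is 1. *)
Lemma gaussian_integral (c m : R) : 0 < c ->
  mu.-integrable setT (EFin \o (fun x => expR (- (c * (x - m) ^+ 2)))) /\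
  (\int[mu]_x (expR (- (c * (x - m) ^+ 2)))%:E = (Num.sqrt (pi / c))%:E)%E.
Proof.
move=> c0.
pose s := Num.sqrt ((c *+ 2)^-1).
have c20 : 0 < c *+ 2 by rewrite pmulrn_lgt0.
have s2 : s ^+ 2 = (c *+ 2)^-1 by rewrite sqr_sqrtr// invr_ge0 ltW.
have s0 : s != 0 by rewrite gt_eqF// sqrtr_gt0 invr_gt0.
have s2' : s ^+ 2 *+ 2 = c^-1 by rewrite s2 -(mulr_natr c) -[LHS]mulr_natr invfM divfK.
have nf x : normal_fun m s x = expR (- (c * (x - m) ^+ 2)).
  by rewrite /normal_fun s2' invrK mulNr mulrC.
have pk : (normal_peak s)^-1 = Num.sqrt (pi / c).
  rewrite /normal_peak invrK; congr Num.sqrt.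
  by rewrite -mulrnAl s2' mulrC.
have pk0 := normal_peak_gt0 s0.
have pdf : normal_pdf m s = fun x => normal_peak s * expR (- (c * (x - m) ^+ 2)).
  by rewrite normal_pdfE//; apply/funext => x; rewrite nf.
have ip := integrable_normal_pdf m s.
have i : mu.-integrable setT (EFin \o (fun x => expR (- (c * (x - m) ^+ 2)))).
  have := @integrable_scale _ _ R mu setT (normal_peak s)^-1 _ measurableT ip.
  apply: eq_integrable => // x _; rewrite /= pdf mulrA mulVf ?mul1r// gt_eqF//.
split => //.
have := @integral_normal_pdf R m s; rewrite pdf.
under eq_integral do rewrite EFinM.
rewrite integralZl// => h.
rewrite -pk; move: h; rewrite -(fineK (integrable_fin_num measurableT i)) -EFinM => -[h].
by congr EFin; rewrite -[RHS]mulr1 -h mulKf// gt_eqF.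
Qed.

(** Growth slower than every Gaussian. The class is closed under sums and products, contains
    polynomials and exponentials of linear functions, and multiplies [gdec] into itself. *)
Definition subgauss u : Prop := forall e : R, 0 < e ->
  exists2 K : R, 0 <= K & forall x, normc (u x) <= K * expR (e * x ^+ 2).

Lemma subgaussM u v : subgauss u -> subgauss v -> subgauss (fun x => u x * v x).
Proof.
move=> su sv e e0; have e20 : 0 < e / 2 by rewrite divr_gt0.
have [K K0 hK] := su _ e20; have [L L0 hL] := sv _ e20.
exists (K * L) => [|x]; first by rewrite mulr_ge0.
rewrite normcM; apply: (@le_trans _ _ (K * expR (e / 2 * x ^+ 2) * (L * expR (e / 2 * x ^+ 2)))).
  by apply: ler_pM; rewrite ?normc_ge0.
by rewrite mulrACA -expRD -mulrDl -splitr.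
Qed.

Lemma subgaussD u v : subgauss u -> subgauss v -> subgauss (fun x => u x + v x).
Proof.
move=> su sv e e0.
have [K K0 hK] := su _ e0; have [L L0 hL] := sv _ e0.
exists (K + L) => [|x]; first by rewrite addr_ge0.
by rewrite (le_trans (le_normcD _ _))// mulrDl; apply: lerD.
Qed.

Lemma subgauss_cst (c : C) : subgauss (fun=> c).
Proof.
move=> e e0; exists (normc c) => [|x]; first exact: normc_ge0.
by rewrite ler_peMr ?normc_ge0// -expR0 ler_expR mulr_ge0 ?sqr_ge0// ltW.
Qed.

Lemma subgauss_id : subgauss (fun x => x%:C).
Proof.
move=> e e0; exists (1 + e^-1) => [|x]; first by rewrite addr_ge0// invr_ge0 ltW.
rewrite normc_real; apply: (@le_trans _ _ ((1 + e^-1) * (1 + e * x ^+ 2))); last first.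
  by rewrite ler_wpM2l ?expR_ge1Dx// addr_ge0// invr_ge0 ltW.
have -> : (1 + e^-1) * (1 + e * x ^+ 2) = 1 + x ^+ 2 + (e^-1 + e * x ^+ 2).
  by field; rewrite gt_eqF.
have h1 : 0 <= e^-1 + e * x ^+ 2.
  have a := ltW e0; have b : 0 <= e^-1 by rewrite invr_ge0.
  have c := mulr_ge0 a (sqr_ge0 x); lra.
have h2 : `|x| <= 1 + x ^+ 2.
  rewrite -[x ^+ 2]real_normK ?num_real//; have := sqr_ge0 (`|x| - 1); have := normr_ge0 x.
  by nra.
by lra.
Qed.

Lemma subgaussX u n : subgauss u -> subgauss (fun x => u x ^+ n).
Proof.
move=> su; elim: n => [|n IH]; first exact: subgauss_cst.
by under [X in subgauss X]eq_fun do rewrite exprS; exact: subgaussM.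
Qed.

(** Completing the square in e x^2 - (Re b) x yields the constant exp((Re b)^2 / (4 e)). *)
Lemma subgauss_cexp (b : C) : subgauss (fun x => cexp (b * x%:C)).
Proof.
move=> e e0; exists (expR (Re b ^+ 2 / (4 * e))) => [|x]; first exact: expR_ge0.
rewrite normc_cexp ReM/= mulr0 subr0 -expRD ler_expR.
rewrite -subr_ge0 (_ : _ - _ = (2 * e * x - Re b) ^+ 2 / (4 * e)).
  by rewrite divr_ge0 ?sqr_ge0// mulr_ge0// ltW.
by field; rewrite gt_eqF.
Qed.

Lemma gdecM u v : subgauss u -> gdec v -> gdec (fun x => u x * v x).
Proof.
move=> su [K [c [c0 hv]]]; have c20 : 0 < c / 2 by rewrite divr_gt0.
have [L L0 hu] := su _ c20; exists (L * K), (c / 2); split => // x.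
rewrite normcM; apply: (@le_trans _ _ (L * expR (c / 2 * x ^+ 2) * (K * expR (- (c * x ^+ 2))))).
  by apply: ler_pM; rewrite ?normc_ge0.
rewrite mulrACA -expRD -mulNr -mulrDl.
by rewrite (_ : c / 2 - c = - (c / 2)) ?mulNr//; lra.
Qed.

Lemma gdec_cinteg u : cmeas u -> gdec u -> cinteg mu setT u.
Proof.
move=> mu_ [K [c [c0 hu]]].
have [i _] := gaussian_integral 0 c0.
have i' := integrable_scale K measurableT i.
have := @cinteg_leT _ _ R mu u _ mu_ i'.
by apply => x; rewrite subr0.
Qed.

Lemma gdec_cvg u (s : R^nat) : gdec u -> (forall n, n.+1%:R <= `|s n|) ->
  normc (u (s n)) @[n --> \oo] --> 0.
Proof.
move=> [K [c [c0 hu]]] hs.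
have K0 : 0 <= K.
  by have := le_trans (normc_ge0 _) (hu 0); rewrite expr0n/= mulr0 oppr0 expR0 mulr1.
apply: (@squeeze_cvgr _ _ _ _ (cst 0) (fun n => K / c * n.+1%:R^-1)); last 2 first.
- exact: cvg_cst.
- by rewrite -[X in _ --> X](mulr0 (K / c)); apply: cvgMr; exact: cvg_harmonic.
apply: nearW => n; rewrite normc_ge0/=; apply: (le_trans (hu _)).
rewrite -mulrA; apply: ler_wpM2l => //.
rewrite expRN -invfM lef_pV2 ?posrE ?expR_gt0 ?mulr_gt0 ?ltr0n//.
have h1 : 1 <= n.+1%:R :> R by rewrite ler1n.
apply: (@le_trans _ _ (c * s n ^+ 2)); last by apply: le_trans (expR_ge1Dx _); rewrite lerDr.
rewrite ler_pM2l// -[s n ^+ 2]real_normK ?num_real//.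
have := hs n; have := normr_ge0 (s n); nra.
Qed.

Lemma measurable_patch (f : R -> R) (D : set R) : measurable D ->
  measurable_fun setT f -> measurable_fun setT (f \_ D).
Proof.
by move=> mD mf; apply: (measurable_restrictT f mD).1; exact: measurable_funTS.
Qed.

(** On [-n-1, n+1] the integral of [u'] is a difference of boundary values, which tend to 0;
    dominated convergence identifies the limit with the full integral. *)
Lemma cint_deriv0 u u' : rderiv u u' -> rcont u' -> gdec u -> gdec u' ->
  cint mu setT u' = 0.
Proof.
move=> du cu' gu gu'.
pose I n : set R := `[- n.+1%:R, n.+1%:R]%classic.
have mI n : measurable (I n) by exact: measurable_itv.
pose F n x := if x \in I n then u' x else 0.
have mF n : cmeas (F n).
  split.
    have -> : (fun x => Re (F n x)) = ((fun x => Re (u' x)) \_ (I n)).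
      by apply/funext => x; rewrite patchE /F; case: ifP.
    exact: (measurable_patch (mI n) (rcont_meas cu').1).
  have -> : (fun x => Im (F n x)) = ((fun x => Im (u' x)) \_ (I n)).
    by apply/funext => x; rewrite patchE /F; case: ifP.
  exact: (measurable_patch (mI n) (rcont_meas cu').2).
have iF n : cint mu setT (F n) = u n.+1%:R - u (- n.+1%:R).
  rewrite -(FTC_itv du cu'); last by rewrite gtrN// ltr0n.
  apply: complexP => /=; rewrite [RHS]Rintegral_mkcond; apply: eq_Rintegral => x _;
    by rewrite patchE /F; case: ifP.
have iu' := cinteg_normc measurableT (gdec_cinteg (rcont_meas cu') gu').
have cvF x : setT x -> normc (F n x - u' x) @[n --> \oo] --> 0.
  move=> _; apply: (@cvg_near_cst _ _ 0); have hN := truncnS_gt `|x|; set N := (Num.truncn _).+1 in hN.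
  exists N => // n /= Nn; rewrite /F ifT ?subrr ?normc0//.
  rewrite inE /I/= in_itv/= -ler_norml; apply: (le_trans (ltW hN)).
  by rewrite ler_nat leqW.
have bF n x : setT x -> normc (F n x) <= normc (u' x).
  by move=> _; rewrite /F; case: ifP => // _; rewrite normc0 normc_ge0.
have [_ cv] := @cint_dominated _ _ R mu F u' (fun x => normc (u' x)) setT measurableT mF (rcont_meas cu')
   cvF iu' bF.
have c1 : normc (u n.+1%:R) @[n --> \oo] --> 0.
  by apply: (@gdec_cvg u (fun n => n.+1%:R)) => // n; rewrite ger0_norm.
have c2 : normc (u (- n.+1%:R)) @[n --> \oo] --> 0.
  by apply: (@gdec_cvg u (fun n => - n.+1%:R)) => // n; rewrite normrN ger0_norm.
apply/eqP; rewrite -normc_eq0; apply/eqP/cst_cvg0.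
apply: (@squeeze_cvgr _ _ _ _ (cst 0) (fun n =>
   normc (cint mu setT (F n) - cint mu setT u') + (normc (u n.+1%:R) + normc (u (- n.+1%:R))))).
- apply: nearW => n; apply/andP; split; first exact: normc_ge0.
  rewrite iF.
  rewrite -[X in normc X <= _](subKr (u n.+1%:R - u (- n.+1%:R))).
  apply: (le_trans (le_normcB _ _)); rewrite addrC lerD2l.
  exact: le_normcB.
- exact: cvg_cst.
- by rewrite -[X in _ --> X]addr0; apply: cvgD => //; rewrite -[X in _ --> X]addr0; exact: cvgD.
Qed.

End RealDerivative.

(** * The Gaussian integral with complex parameters *)

Section ComplexGaussian.
Context {R : realType}.
Local Notation C := R[i].
Local Notation Re := (@complex.Re R).
Local Notation Im := (@complex.Im R).
Local Notation mu := (@lebesgue_measure R).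

Lemma Re_scale (x : R) (z : C) : Re (x%:C * z) = x * Re z.
Proof. by rewrite ReM /= mul0r subr0. Qed.
Lemma Im_scale (x : R) (z : C) : Im (x%:C * z) = x * Im z.
Proof. by rewrite ImM /= mul0r addr0. Qed.

(** Differentiation under the integral sign. The dominating function may depend on a bound for the
    parameter; at [a] the bound |a| + 1 is used. *)
Lemma rderiv_under (k k' : R -> R -> C) :
  (forall x, rderiv (k ^~ x) (k' ^~ x)) -> (forall t, cinteg mu setT (k t)) ->
  (forall T : R, exists2 g : R -> R, mu.-integrable setT (EFin \o g) &
     forall t x, `|t| < T -> normc (k' t x) <= g x) ->
  rderiv (fun t => cint mu setT (k t)) (fun t => cint mu setT (k' t)).
Proof.
move=> dk ik hg a.
have [g ig hb] := hg (`|a| + 1).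
have g0 x : 0 <= g x.
  by apply: le_trans (hb a x _); rewrite ?normc_ge0// ltrDl.
pose I : set R := `](- (`|a| + 1)), (`|a| + 1)[%classic.
have Ia : I a by rewrite /I/= in_itv/= -ltr_norml ltrDl.
have I_lt x : I x -> `|x| < `|a| + 1 by rewrite /I/= in_itv/= -ltr_norml.
have aux (f f' : R -> R -> R) :
    (forall x y : R, is_derive x (1:R) (f ^~ y) (f' x y)) ->
    (forall t, mu.-integrable setT (EFin \o f t)) ->
    (forall x y, `|x| < `|a| + 1 -> `|f' x y| <= g y) ->
    is_derive a (1:R) (fun t => \int[mu]_y f t y) (\int[mu]_y f' a y).
  move=> df if_ bf.
  have pf x y : partial1of2 f x y = f' x y.
    by rewrite partial1of2E; have [_ ->] := df x y.
  have der x y : I x -> setT y -> derivable (f^~ y) x 1 by move=> _ _; have [] := df x y.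
  have bd x y : I x -> setT y -> `|partial1of2 f x y| <= g y.
    by move=> /I_lt xI _; rewrite pf; exact: bf.
  apply: DeriveDef.
    exact: (derivable_under_integral measurableT Ia (fun x _ => if_ x) der g0 ig bd).
  rewrite -derive1E (differentiation_under_integral measurableT Ia (fun x _ => if_ x) der g0 ig bd).
  by apply: eq_Rintegral => y _; rewrite pf.
split.
  apply: (aux (fun t y => Re (k t y)) (fun t y => Re (k' t y))).
  - by move=> x y; have [] := dk y x.
  - by move=> t; exact: (ik t).1.
  - by move=> x y xa; rewrite (le_trans (normr_Re_le _))// hb.
apply: (aux (fun t y => Im (k t y)) (fun t y => Im (k' t y))).
- by move=> x y; have [] := dk y x.
- by move=> t; exact: (ik t).2.
- by move=> x y xa; rewrite (le_trans (normr_Im_le _))// hb.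
Qed.

Definition gk (a b : C) (x : R) : C := cexp (- a * x%:C ^+ 2 + b * x%:C).

Implicit Types a b : C.

Lemma normc_gk a b x : normc (gk a b x) = expR (- Re a * x ^+ 2 + Re b * x).
Proof. by rewrite /gk normc_cexp; congr expR; rewrite !expr2 !ReImE/=; ring. Qed.

Lemma gkE a b x : gk a b x = cexp (b * x%:C) * gk a 0 x.
Proof. by rewrite /gk -cexpD; congr cexp; ring. Qed.

Lemma gdec_gk a b (P : R -> C) : 0 < Re a -> subgauss P ->
  gdec (fun x => P x * gk a b x).
Proof.
move=> a0 sP.
have -> : (fun x => P x * gk a b x) = (fun x => (P x * cexp (b * x%:C)) * gk a 0 x).
  by apply/funext => x; rewrite gkE mulrA.
apply: gdecM; first by apply: subgaussM => //; exact: subgauss_cexp.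
exists 1, (Re a); split => // x.
by rewrite normc_gk/= mul0r addr0 mul1r mulNr.
Qed.

Lemma rderiv_gk a b : rderiv (gk a b) (fun x => (b - 2 * a * x%:C) * gk a b x).
Proof.
have d1 := rderivZ (- a) (rderivX 2 (@rderiv_id R)).
have d2 := rderivZ b (@rderiv_id R).
apply: rderiv_eq (rderiv_cexp (rderivD d1 d2)) => // x.
by rewrite /gk; congr (_ * _); rewrite expr1; ring.
Qed.

Lemma rcont_gk a b : rcont (gk a b).
Proof. exact: rderiv_rcont (rderiv_gk a b). Qed.

Lemma rcont_real : rcont (fun x : R => x%:C).
Proof. exact: rderiv_rcont (@rderiv_id R). Qed.

Lemma gk_integ a b (P : R -> C) : 0 < Re a -> rcont P -> subgauss P ->
  cinteg mu setT (fun x => P x * gk a b x).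
Proof.
move=> a0 cP sP; apply: gdec_cinteg; last exact: gdec_gk.
by apply: rcont_meas; apply: rcontM => //; exact: rcont_gk.
Qed.

Lemma gk_integ1 a b : 0 < Re a -> cinteg mu setT (gk a b).
Proof.
move=> a0; have := @gk_integ a b (fun=> 1) a0 (@rcont_cst R 1) (@subgauss_cst R 1).
by under eq_fun do rewrite mul1r.
Qed.

(** The integrand is the derivative of P times the Gaussian. The moment identities and the Hermite
    calculus are instances. *)
Lemma gk_ibp a b (P P' : R -> C) : 0 < Re a -> rderiv P P' -> rcont P' ->
  subgauss P -> subgauss P' ->
  cint mu setT (fun x => (P' x + (b - 2 * a * x%:C) * P x) * gk a b x) = 0.
Proof.
move=> a0 dP cP' sP sP'.
have sl : subgauss (fun x => b - 2 * a * x%:C).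
  apply: subgaussD; first exact: subgauss_cst.
  under [X in subgauss X]eq_fun do rewrite -mulNr.
  by apply: subgaussM; [exact: subgauss_cst|exact: subgauss_id].
have cl : rcont (fun x => b - 2 * a * x%:C).
  by apply: rcontB; [exact: rcont_cst|apply: rcontM; [exact: rcont_cst|exact: rcont_real]].
apply: (@cint_deriv0 R (fun x => P x * gk a b x)).
- apply: rderiv_eq (rderivM dP (rderiv_gk a b)) => // x; ring.
- apply: rcontM; last exact: rcont_gk.
  by apply: rcontD => //; apply: rcontM => //; exact: rderiv_rcont dP.
- exact: gdec_gk.
- by apply: gdec_gk => //; apply: subgaussD => //; exact: subgaussM.
Qed.

Lemma gk_moment1 a b : 0 < Re a ->
  2 * a * cint mu setT (fun x => x%:C * gk a b x) = b * cint mu setT (gk a b).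
Proof.
move=> a0; have := @gk_ibp a b (fun=> 1) (fun=> 0) a0 (@rderiv_cst R 1) (@rcont_cst R 0)
  (@subgauss_cst R 1) (@subgauss_cst R 0).
have -> : cint mu setT (fun x => (0 + (b - 2 * a * x%:C) * 1) * gk a b x) =
    cint mu setT (fun x => b * gk a b x - (2 * a) * (x%:C * gk a b x)).
  by apply: eq_cint => x _; ring.
have i1 := gk_integ1 b a0.
have i2 := gk_integ b a0 rcont_real (@subgauss_id R).
rewrite cintB//; [|exact: cintegZ..].
by rewrite !cintZ// => /eqP; rewrite subr_eq0 => /eqP.
Qed.

Lemma gk_moment2 a : 0 < Re a ->
  2 * a * cint mu setT (fun x => x%:C ^+ 2 * gk a 0 x) = cint mu setT (gk a 0).
Proof.
move=> a0; have := @gk_ibp a 0 (fun x => x%:C) (fun=> 1) a0 (@rderiv_id R) (@rcont_cst R 1)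
  (@subgauss_id R) (@subgauss_cst R 1).
have -> : cint mu setT (fun x => (1 + (0 - 2 * a * x%:C) * x%:C) * gk a 0 x) =
    cint mu setT (fun x => gk a 0 x - (2 * a) * (x%:C ^+ 2 * gk a 0 x)).
  by apply: eq_cint => x _; ring.
have i1 := gk_integ1 0 a0.
have i2 : cinteg mu setT (fun x => x%:C ^+ 2 * gk a 0 x).
  apply: gk_integ => //; last by apply: subgaussX; exact: subgauss_id.
  by rewrite /=; under [X in rcont X]eq_fun do rewrite expr2; apply: rcontM; exact: rcont_real.
rewrite cintB//; last exact: cintegZ.
by rewrite cintZ// => /eqP; rewrite subr_eq0 => /eqP.
Qed.

(** For complex [b] the square is completed by a differential equation: F(t), the integral with tb
    in place of b, satisfies F' = (t b^2 / (2a)) F by the first moment identity, so F(t) exp(- t^2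
    b^2 / (4a)) has the same value at 0 and 1. *)
Lemma gk_shift a b : 0 < Re a ->
  cint mu setT (gk a b) = cexp (b ^+ 2 / (4 * a)) * cint mu setT (gk a 0).
Proof.
move=> a0.
have an0 : a != 0 by apply/eqP => e; move: a0; rewrite e ltxx.
have dk : rderiv (fun t => cint mu setT (gk a (t%:C * b)))
    (fun t => cint mu setT (fun x => b * (x%:C * gk a (t%:C * b) x))).
  apply: (@rderiv_under (fun t => gk a (t%:C * b)) (fun t x => b * (x%:C * gk a (t%:C * b) x))).
  - move=> x.
    have d := rderivM (rderivM (@rderiv_id R) (rderiv_cst b)) (rderiv_cst x%:C).
    apply: rderiv_eq (rderiv_cexp (rderivD (rderiv_cst (- a * x%:C ^+ 2)) d)) => // t.
    by rewrite /gk; ring.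
  - by move=> t; exact: gk_integ1.
  - move=> T.
    (* For |t| < T the linear exponent is at most k |x|, so the two real kernels with parameters k
       and -k dominate together. *)
    pose k : R := `|T| * `|Re b|.
    pose h x := (b * x%:C) * gk a k%:C x; pose h' x := (b * x%:C) * gk a (- k)%:C x.
    have cb : rcont (fun x => b * x%:C).
      by apply: rcontM; [exact: rcont_cst|exact: rcont_real].
    have sb : subgauss (fun x => b * x%:C).
      by apply: subgaussM; [exact: subgauss_cst|exact: subgauss_id].
    have i1 := cinteg_normc measurableT (gk_integ k%:C a0 cb sb).
    have i2 := cinteg_normc measurableT (gk_integ (- k)%:C a0 cb sb).
    exists (fun x => normc (h x) + normc (h' x)); first exact: integrableD i1 i2.
    move=> t x tT; rewrite mulrA normcM /h /h' !(normcM (b * x%:C)) -mulrDr.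
    apply: ler_wpM2l; first exact: normc_ge0.
    have rt : Re (t%:C * b) = t * Re b by rewrite ReM/= mul0r subr0.
    rewrite !normc_gk rt /=.
    have tk : t * Re b * x <= k * `|x|.
      rewrite (le_trans (ler_norm _))// !normrM ler_wpM2r// /k ler_wpM2r//.
      by rewrite (le_trans (ltW tT))// ler_norm.
    have [x0|x0] := leP 0 x.
      rewrite ger0_norm// in tk; rewrite -[leLHS]addr0 lerD ?expR_ge0//.
      by rewrite ler_expR lerD2l.
    rewrite ltr0_norm// in tk; rewrite -[leLHS]add0r lerD ?expR_ge0//.
    by rewrite ler_expR lerD2l mulNr -mulrN.
have dq : rderiv (fun t => cexp (- (t%:C ^+ 2 * b ^+ 2 / (4 * a))))
    (fun t => - (t%:C * b ^+ 2 / (2 * a)) * cexp (- (t%:C ^+ 2 * b ^+ 2 / (4 * a)))).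
  have d := rderivZ (- (b ^+ 2 / (4 * a))) (rderivX 2 (@rderiv_id R)).
  apply: rderiv_eq (rderiv_cexp d) => t; first by congr cexp; ring.
  rewrite -[in RHS]mulrN; congr (_ * cexp _); last by ring.
  by rewrite expr1; field.
set F := fun t : R => cint mu setT (gk a (t%:C * b)) in dk.
set Q := fun t : R => cexp (- (t%:C ^+ 2 * b ^+ 2 / (4 * a))) in dq.
have d0 : rderiv (fun t => F t * Q t) (fun=> 0).
  apply: rderiv_eq (rderivM dk dq) => // t.
  have i2 := gk_integ (t%:C * b) a0 rcont_real (@subgauss_id R).
  rewrite cintZ//.
  have h := gk_moment1 (t%:C * b) a0.
  have -> : cint mu setT (fun x => x%:C * gk a (t%:C * b) x) = t%:C * b * F t / (2 * a).
    by rewrite /F -h [X in _ = X / _]mulrC mulfK// mulf_neq0// pnatr_eq0.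
  by rewrite -/(Q t); move: (F t) (Q t) => X Y; field.
have := rderiv0_cst 1 0 d0.
rewrite /F /Q mul1r mul0r expr1n mul1r expr0n /= mul0r mul0r oppr0 cexp0 mulr1 => <-.
by rewrite mulrCA -cexpD subrr cexp0 mulr1.
Qed.

Lemma gk_real (p x : R) : gk p%:C 0 x = (expR (- (p * (x - 0) ^+ 2)))%:C.
Proof.
rewrite /gk mul0r addr0 -cexp_real; congr cexp.
by rewrite subr0 -rmorphXn -rmorphN -rmorphM/= mulNr.
Qed.

Lemma gauss_rderiv (p : R) : 0 < p ->
  rderiv (fun s => cint mu setT (gk (p%:C - 'i%C * s%:C) 0))
    (fun s => cint mu setT (fun x => 'i%C * (x%:C ^+ 2 * gk (p%:C - 'i%C * s%:C) 0 x))).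
Proof.
move=> p0; apply: (@rderiv_under (fun s => gk (p%:C - 'i%C * s%:C) 0)
   (fun s x => 'i%C * (x%:C ^+ 2 * gk (p%:C - 'i%C * s%:C) 0 x))).
- move=> x.
  have d := rderivZ ('i%C * x%:C ^+ 2) (@rderiv_id R).
  apply: rderiv_eq (rderiv_cexp (rderivD (rderiv_cst (- p%:C * x%:C ^+ 2)) d)) => // s.
    by rewrite /gk; congr cexp; ring.
  rewrite /gk add0r mulr1 -mulrA; congr (_ * (_ * cexp _)); ring.
- by move=> s; apply: gk_integ1; rewrite !ReImE/= !mul0r mulr0 !subr0.
- move=> T.
  have c2 : rcont (fun x : R => x%:C ^+ 2).
    by under [X in rcont X]eq_fun do rewrite expr2; apply: rcontM; exact: rcont_real.
  have i1 := cinteg_normc measurableT (@gk_integ p%:C 0 _ p0 c2 (subgaussX 2 (@subgauss_id R))).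
  eexists; first exact: i1.
  move=> s x _; rewrite le_eqVlt; apply/orP; left; apply/eqP.
  rewrite (normcM 'i%C) normc_i mul1r !(normcM (x%:C ^+ 2)) !normc_gk; congr (_ * expR _).
  by rewrite !ReImE/=; ring.
Qed.

(** The imaginary part of [a] is deformed to 0: with A(s) = p - i s, the derivative of J(s)^2 A(s)
    vanishes by the second moment identity, and s = 0 is the real Gaussian integral. *)
Lemma gauss_sqr a : 0 < Re a -> cint mu setT (gk a 0) ^+ 2 * a = pi%:C.
Proof.
move=> a0; pose p := Re a; pose A (s : R) := p%:C - 'i%C * s%:C.
have ReA s : Re (A s) = p by rewrite /A !ReImE/= !mul0r mulr0 !subr0.
have -> : a = A (- Im a) by rewrite /A; apply: complexP; rewrite !ReImE/=; ring.
pose J s := cint mu setT (gk (A s) 0).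
rewrite -/(J _).
have dJ := gauss_rderiv a0.
have dA : rderiv A (fun=> - 'i%C).
  have d := rderivD (rderiv_cst p%:C) (rderivZ (- 'i%C) (@rderiv_id R)).
  by apply: rderiv_eq d => s; rewrite /A; ring.
have dH : rderiv (fun s => J s ^+ 2 * A s) (fun=> 0).
  apply: rderiv_eq (rderivM (rderivX 2 dJ) dA) => // s.
  rewrite -/(A s).
  have cs : rcont (fun x : R => x%:C ^+ 2).
    by under [X in rcont X]eq_fun do rewrite expr2; apply: rcontM; exact: rcont_real.
  have i2 : cinteg mu setT (fun x => x%:C ^+ 2 * gk (A s) 0 x).
    by apply: gk_integ; rewrite ?ReA//; apply: subgaussX; exact: subgauss_id.
  rewrite cintZ// -/(J s) expr1.
  have As : 0 < Re (A s) by rewrite ReA.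
  have h := gk_moment2 As; rewrite -/(J s) in h.
  by rewrite -[in J s ^+ 2]h -h; ring.
rewrite (rderiv0_cst (- Im a) 0 dH).
have -> : A 0 = p%:C by rewrite /A mulr0 subr0.
have -> : J 0 = (Num.sqrt (pi / p))%:C.
  rewrite /J; have -> : A 0 = p%:C by rewrite /A mulr0 subr0.
  have [_ h] := gaussian_integral 0 a0.
  transitivity (cint mu setT (fun x => (expR (- (p * (x - 0) ^+ 2)))%:C)).
    by apply: eq_cint => x _; rewrite gk_real.
  by apply: complexP; rewrite /cint /= /Rintegral ?h ?integral0.
rewrite -rmorphXn -rmorphM/= sqr_sqrtr ?divr_ge0 ?pi_ge0 ?ltW//.
by rewrite divfK// gt_eqF.
Qed.

Lemma sqr_Re_neq0 (z : C) : 0 < Re (z ^+ 2) -> Re z != 0.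
Proof.
move=> h; apply/eqP => z0; move: h; rewrite expr2 ReM z0 mul0r sub0r oppr_gt0.
by rewrite -expr2 ltNge sqr_ge0.
Qed.

Lemma Re_inv_gt0 (z : C) : 0 < Re z -> 0 < Re z^-1.
Proof.
case: z => x y /= x0; rewrite divr_gt0// ltr_pwDl ?sqr_ge0//.
by rewrite exprn_gt0.
Qed.

(** This fixes the branch of the square root. J(s)^2 = pi / A(s) has positive real part, so Re J(s)
    never vanishes; it is continuous in s and positive at s = 0. *)
Lemma Re_gauss_gt0 a : 0 < Re a -> 0 < Re (cint mu setT (gk a 0)).
Proof.
move=> a0; pose p := Re a; pose A (s : R) := p%:C - 'i%C * s%:C.
have ReA s : Re (A s) = p by rewrite /A !ReImE/= !mul0r mulr0 !subr0.
have aE : a = A (- Im a) by rewrite /A; apply: complexP; rewrite !ReImE/=; ring.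
pose J s := cint mu setT (gk (A s) 0).
have nz s : Re (J s) != 0.
  apply: sqr_Re_neq0; have As : 0 < Re (A s) by rewrite ReA.
  have An0 : A s != 0 by apply/eqP => e; move: As; rewrite e ltxx.
  have -> : J s ^+ 2 = pi%:C * (A s)^-1 by rewrite -(gauss_sqr As) mulfK.
  by rewrite Re_scale mulr_gt0 ?pi_gt0//; exact: Re_inv_gt0.
have J0 : 0 < Re (J 0).
  rewrite lt_neqAle eq_sym nz andTb /J.
  have -> : A 0 = p%:C by rewrite /A mulr0 subr0.
  apply: (@Rintegral_ge0 _ _ _ mu setT (fun x => Re (gk p%:C 0 x))) => x _.
  by rewrite gk_real; exact: expR_ge0.
have cJ : continuous (fun s => Re (J s)) by exact: (rderiv_rcont (gauss_rderiv a0)).1.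
rewrite aE -/(J _) ltNge; apply/negP => Jn.
have [c _ Jc] : exists2 c, c \in `[Num.min 0 (- Im a), Num.max 0 (- Im a)] & Re (J c) = 0.
  have [h|h] := leP 0 (- Im a).
    apply: IVT => //; first exact: continuous_subspaceT.
    by rewrite ge_min le_max Jn (ltW J0) orbT.
  apply: IVT; first exact: ltW; first exact: continuous_subspaceT.
  by rewrite ge_min le_max Jn (ltW J0) orbT.
by have := nz c; rewrite Jc eqxx.
Qed.

Lemma Re_sqrtc_gt0 a : 0 < Re a -> 0 < Re (sqrtc a).
Proof.
case: a => x y /= x0; rewrite sqrtr_gt0 divr_gt0// ltr_pwDr// sqrtr_ge0.
Qed.

(** [gauss_sqr] leaves a sign open; both the integral and 1 / sqrtc a have positive real part. *)
Lemma gauss_val a : 0 < Re a ->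
  cint mu setT (gk a 0) = (Num.sqrt pi)%:C / sqrtc a.
Proof.
move=> a0; have s0 := Re_sqrtc_gt0 a0; have J0 := Re_gauss_gt0 a0.
have sn0 : sqrtc a != 0 by apply/eqP => e; move: s0; rewrite e ltxx.
set J := cint _ _ _ in J0 *.
have : (J * sqrtc a) ^+ 2 == ((Num.sqrt pi)%:C) ^+ 2.
  by rewrite exprMn sqr_sqrtc gauss_sqr// -rmorphXn/= sqr_sqrtr// pi_ge0.
rewrite eqf_sqr => /orP[/eqP <-|/eqP h]; first by rewrite mulfK.
have : J = - (Num.sqrt pi)%:C * (sqrtc a)^-1 by rewrite -h mulfK.
move=> JE; move: J0; rewrite JE mulNr ReN Re_scale oppr_gt0 => /lt_geF.
by rewrite ltW// mulr_gt0 ?Re_inv_gt0// sqrtr_gt0 pi_gt0.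
Qed.

Lemma gauss_integral_complex a b : 0 < Re a ->
  cint mu setT (gk a b) = cexp (b ^+ 2 / (4 * a)) * ((Num.sqrt pi)%:C / sqrtc a).
Proof. by move=> a0; rewrite gk_shift// gauss_val. Qed.

End ComplexGaussian.

(** * Taylor coefficients of Fock functions *)

Section PlaneRotation.
Context {R : realType}.
Local Notation mu := (@lebesgue_measure R).
Local Notation mu2 := (mu \x mu)%E.

Lemma ge0_integral_translate (a : R) (f : R -> \bar R) : measurable_fun setT f ->
  (forall x, (0 <= f x)%E) -> (\int[mu]_x f (x + a)%R = \int[mu]_x f x)%E.
Proof.
move=> mf f0.
pose phi : measurableTypeR R -> measurableTypeR R := fun x : R => x + a.
have mt : measurable_fun setT phi.
  by apply: measurable_funD => //; exact: measurable_cst.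
have := @ge0_integral_pushforward _ _ _ _ R phi mt mu setT f measurableT mf (fun y _ => f0 y).
rewrite preimage_setT => <-.
apply: eq_measure_integral => A mA _ /=.
apply/esym/lebesgue_measure_unique => //= _ [[c d] _ <-].
rewrite /pushforward.
have -> : phi @^-1` `]c, d]%classic = `]c - a, d - a]%classic.
  by apply/seteqP; split => x /=; rewrite !in_itv/= ltrBlDr lerBrDr.
rewrite !lebesgue_measure_itv/= !lte_fin ltrD2r.
by case: ifP => // _; rewrite -!EFinB; congr EFin; ring.
Qed.

(** By Tonelli, a shear is a translation in each inner integral. *)
Lemma ge0_integral_shear1 (t : R) (G : R * R -> \bar R) : measurable_fun setT G ->
  (forall p, (0 <= G p)%E) ->
  (\int[mu2]_p G (p.1 + t * p.2, p.2)%R = \int[mu2]_p G p)%E.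
Proof.
move=> mG G0.
have ms : measurable_fun setT (fun p : R * R => (p.1 + t * p.2, p.2)).
  apply/measurable_fun_pairP; split => /=; last exact: measurable_snd.
  apply: measurable_funD; first exact: measurable_fst.
  by apply: measurable_funM => //; exact: measurable_snd.
rewrite (@fubini_tonelli2 _ _ _ _ R mu mu _ (measurableT_comp mG ms) (fun p => G0 _)).
rewrite (@fubini_tonelli2 _ _ _ _ R mu mu G mG G0); apply: eq_integral => y _.
rewrite /fubini_G /=; apply: (ge0_integral_translate (t * y) (f := fun x => G (x, y))) => //.
by apply: measurableT_comp => //; exact: pair2_measurable.
Qed.

Lemma ge0_integral_shear2 (t : R) (G : R * R -> \bar R) : measurable_fun setT G ->
  (forall p, (0 <= G p)%E) ->
  (\int[mu2]_p G (p.1, p.2 + t * p.1)%R = \int[mu2]_p G p)%E.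
Proof.
move=> mG G0.
have ms : measurable_fun setT (fun p : R * R => (p.1, p.2 + t * p.1)).
  apply/measurable_fun_pairP; split => /=; first exact: measurable_fst.
  apply: measurable_funD; first exact: measurable_snd.
  by apply: measurable_funM => //; exact: measurable_fst.
rewrite (@fubini_tonelli1 _ _ _ _ R mu mu _ (measurableT_comp mG ms) (fun p => G0 _)).
rewrite (@fubini_tonelli1 _ _ _ _ R mu mu G mG G0); apply: eq_integral => x _.
rewrite /fubini_F /=; apply: (ge0_integral_translate (t * x) (f := fun y => G (x, y))) => //.
by apply: measurableT_comp => //; exact: pair1_measurable.
Qed.

Definition rot (c s : R) (p : R * R) : R * R := (c * p.1 - s * p.2, s * p.1 + c * p.2).

Lemma measurable_rot c s : measurable_fun setT (rot c s).
Proof.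
apply/measurable_fun_pairP; split => /=.
  apply: measurable_funB; exact: measurable_funM.
apply: measurable_funD; exact: measurable_funM.
Qed.

(* A rotation by an angle outside [pi Z] is a product of three shears. *)
Lemma ge0_integral_rot_neq0 c s (G : R * R -> \bar R) : c ^+ 2 + s ^+ 2 = 1 -> s != 0 ->
  measurable_fun setT G -> (forall p, (0 <= G p)%E) ->
  (\int[mu2]_p G (rot c s p) = \int[mu2]_p G p)%E.
Proof.
(* For c = cos theta and s = sin theta this is - tan (theta / 2). *)
move=> cs s0 mG G0; pose a := (c - 1) / s.
pose sh1 (p : R * R) := (p.1 + a * p.2, p.2); pose sh2 (p : R * R) := (p.1, p.2 + s * p.1).
have m1 : measurable_fun setT sh1.
  apply/measurable_fun_pairP; split => /=; last exact: measurable_snd.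
  apply: measurable_funD; first exact: measurable_fst.
  by apply: measurable_funM => //; exact: measurable_snd.
have m2 : measurable_fun setT sh2.
  apply/measurable_fun_pairP; split => /=; first exact: measurable_fst.
  apply: measurable_funD; first exact: measurable_snd.
  by apply: measurable_funM => //; exact: measurable_fst.
rewrite -(ge0_integral_shear1 a mG G0).
rewrite -(ge0_integral_shear2 s (measurableT_comp mG m1) (fun p => G0 _)).
rewrite -(ge0_integral_shear1 a (measurableT_comp (measurableT_comp mG m1) m2) (fun p => G0 _)).
apply: eq_integral => -[x y] _ /=; congr (G (_, _)); rewrite /sh1 /sh2/= /a.
  have -> : s * y = (1 - c ^+ 2) / s * y by rewrite -cs; field.
  by field.
by field.
Qed.

Lemma ge0_integral_rot c s (G : R * R -> \bar R) : c ^+ 2 + s ^+ 2 = 1 ->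
  measurable_fun setT G -> (forall p, (0 <= G p)%E) ->
  (\int[mu2]_p G (rot c s p) = \int[mu2]_p G p)%E.
Proof.
move=> cs mG G0; have [s0|s0] := eqVneq s 0; last exact: ge0_integral_rot_neq0.
have e1 : (0:R) ^+ 2 + 1 ^+ 2 = 1 by rewrite expr0n expr1n add0r.
(* The half-turn is the square of a quarter-turn. *)
move: cs; rewrite s0 expr0n addr0 => /eqP; rewrite sqrf_eq1 => /orP[|] /eqP ->.
  by apply: eq_integral => -[x y] _; congr G; rewrite /rot/= !mul1r !mul0r subr0 add0r.
rewrite -(ge0_integral_rot_neq0 e1 (oner_neq0 _) mG G0).
rewrite -(ge0_integral_rot_neq0 e1 (oner_neq0 _) (measurableT_comp mG (measurable_rot 0 1)) (fun p => G0 _)).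
by apply: eq_integral => -[x y] _; congr G; rewrite /rot/=; congr (_, _); ring.
Qed.

End PlaneRotation.

(** * Moments of the Gaussian measure on the plane *)

Section FockMoments.
Context {R : realType}.
Local Notation C := R[i].
Local Notation Re := (@complex.Re R).
Local Notation Im := (@complex.Im R).
Local Notation mu := (@lebesgue_measure R).
Local Notation mu2 := (mu \x mu)%E.

(** Integration by parts in x at fixed y, applied to x (x^2 + y^2)^n against exp(-x^2). *)
Lemma radial_ibp (y : R) n :
  (\int[mu]_x (2 * x ^+ 2 * (x ^+ 2 + y ^+ 2) ^+ n * expR (- x ^+ 2))%:E =
   \int[mu]_x (((x ^+ 2 + y ^+ 2) ^+ n + n%:R * (2 * x ^+ 2 * (x ^+ 2 + y ^+ 2) ^+ n.-1))
      * expR (- x ^+ 2))%:E)%E.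
Proof.
pose r x : C := x%:C ^+ 2 + (y ^+ 2)%:C.
have dr : rderiv r (fun x => 2 * x%:C).
  apply: rderiv_eq (rderivD (rderivX 2 (@rderiv_id R)) (rderiv_cst (y ^+ 2)%:C)) => // x.
  by rewrite expr1 addr0 mulr1.
have dP := rderivM (@rderiv_id R) (rderivX n dr).
have sr : subgauss r.
  by apply: subgaussD; [apply: subgaussX; exact: subgauss_id|exact: subgauss_cst].
have s2 : subgauss (fun x => n%:R * (2 * x%:C) * r x ^+ n.-1).
  apply: subgaussM; last exact: subgaussX.
  apply: subgaussM; first exact: subgauss_cst.
  by apply: subgaussM; [exact: subgauss_cst|exact: subgauss_id].
have sP : subgauss (fun x => x%:C * r x ^+ n).
  by apply: subgaussM; [exact: subgauss_id|exact: subgaussX].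
have sP' : subgauss (fun x => 1 * r x ^+ n + x%:C * (n%:R * (2 * x%:C) * r x ^+ n.-1)).
  apply: subgaussD; last by apply: subgaussM; [exact: subgauss_id|].
  by apply: subgaussM; [exact: subgauss_cst|exact: subgaussX].
have cr : rcont r by exact: rderiv_rcont dr.
have cX (u : R -> C) k : rcont u -> rcont (fun x => u x ^+ k).
  move=> cu; elim: k => [|k IH]; first exact: rcont_cst.
  by under [X in rcont X]eq_fun do rewrite exprS; exact: rcontM.
have cid := @rcont_real R.
have c2 : rcont (fun x => n%:R * (2 * x%:C) * r x ^+ n.-1).
  apply: rcontM; last exact: cX.
  by apply: rcontM; [exact: rcont_cst|apply: rcontM => //; exact: rcont_cst].
have cP' : rcont (fun x => 1 * r x ^+ n + x%:C * (n%:R * (2 * x%:C) * r x ^+ n.-1)).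
  apply: rcontD; last exact: rcontM.
  by apply: rcontM; [exact: rcont_cst|exact: cX].
have one0 : 0 < Re (1 : C) by rewrite /= ltr01.
have ibp := gk_ibp 0 one0 dP cP' sP sP'.
have sA : subgauss (fun x => 2 * x%:C ^+ 2 * r x ^+ n).
  apply: subgaussM; last exact: subgaussX.
  by apply: subgaussM; [exact: subgauss_cst|apply: subgaussX; exact: subgauss_id].
have cA : rcont (fun x => 2 * x%:C ^+ 2 * r x ^+ n).
  by apply: rcontM; [apply: rcontM; [exact: rcont_cst|exact: cX]|exact: cX].
have iA := gk_integ 0 one0 cA sA.
have iB := gk_integ 0 one0 cP' sP'.
have rr x : r x = (x ^+ 2 + y ^+ 2)%:C by rewrite /r -rmorphXn -rmorphD.
have g1 (x : R) : gk 1 0 x = (expR (- x ^+ 2))%:C.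
  by have := gk_real 1 x; rewrite mul1r subr0.
have eA x : Re (2 * x%:C ^+ 2 * r x ^+ n * gk 1 0 x) =
    2 * x ^+ 2 * (x ^+ 2 + y ^+ 2) ^+ n * expR (- x ^+ 2).
  rewrite rr g1 -!rmorphXn -(rmorph_nat (real_complex R)) -!rmorphM //.
have eB x : Re ((1 * r x ^+ n + x%:C * (n%:R * (2 * x%:C) * r x ^+ n.-1)) * gk 1 0 x) =
    ((x ^+ 2 + y ^+ 2) ^+ n + n%:R * (2 * x ^+ 2 * (x ^+ 2 + y ^+ 2) ^+ n.-1)) * expR (- x ^+ 2).
  have -> : 1 * r x ^+ n + x%:C * (n%:R * (2 * x%:C) * r x ^+ n.-1) =
    ((x ^+ 2 + y ^+ 2) ^+ n + n%:R * (2 * x ^+ 2 * (x ^+ 2 + y ^+ 2) ^+ n.-1))%:C.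
    by rewrite !rr -!rmorphXn; apply: complexP; rewrite !ReImE /=; ring.
  by rewrite g1 -rmorphM.
have : cint mu setT (fun x => (1 * r x ^+ n + x%:C * (n%:R * (2 * x%:C) * r x ^+ n.-1)) * gk 1 0 x) =
    cint mu setT (fun x => 2 * x%:C ^+ 2 * r x ^+ n * gk 1 0 x).
  apply/eqP; rewrite -subr_eq0 -cintB//; apply/eqP; rewrite -[RHS]ibp.
  by apply: eq_cint => x _; ring.
move=> /(congr1 Re); rewrite /cint /Rintegral /= => h.
under eq_integral do rewrite -eA.
under [RHS]eq_integral do rewrite -eB.
rewrite -(fineK (integrable_fin_num measurableT iA.1)) -(fineK (integrable_fin_num measurableT iB.1)).
by congr EFin; rewrite h.
Qed.

Definition fock_weight (p : R * R) : R := pi^-1 * expR (- normc (p.1 +i* p.2) ^+ 2).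

Lemma normc_pair2 (p : R * R) : normc (p.1 +i* p.2) ^+ 2 = p.1 ^+ 2 + p.2 ^+ 2.
Proof. exact: normc_sqr. Qed.

Lemma cmeas_pair : cmeas (fun p : R * R => p.1 +i* p.2).
Proof. by split => /=; [exact: measurable_fst|exact: measurable_snd]. Qed.

Lemma fock_weight_ge0 p : 0 <= fock_weight p.
Proof. by rewrite mulr_ge0 ?expR_ge0// invr_ge0 pi_ge0. Qed.

Lemma measurable_fock_weight : measurable_fun setT fock_weight.
Proof.
apply: measurable_funM => //; apply: measurableT_comp => //.
apply: measurableT_comp => //; apply: measurable_funX.
exact: measurable_normc cmeas_pair.
Qed.

Lemma fock_weightE p : fock_weight p = pi^-1 * expR (- p.1 ^+ 2) * expR (- p.2 ^+ 2).
Proof. by rewrite /fock_weight normc_pair2 opprD expRD mulrA. Qed.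

Lemma fock_weight_rot c s p : c ^+ 2 + s ^+ 2 = 1 -> fock_weight (rot c s p) = fock_weight p.
Proof.
move=> cs; rewrite /fock_weight !normc_pair2 /rot/=; congr (_ * expR (- _)).
have -> : (c * p.1 - s * p.2) ^+ 2 + (s * p.1 + c * p.2) ^+ 2 =
  (c ^+ 2 + s ^+ 2) * (p.1 ^+ 2 + p.2 ^+ 2) by ring.
by rewrite cs mul1r.
Qed.

Let rho (p : R * R) : R := p.1 ^+ 2 + p.2 ^+ 2.
Let rho_ge0 p : 0 <= rho p. Proof. by rewrite addr_ge0 ?sqr_ge0. Qed.
Let measurable_rho : measurable_fun setT rho.
Proof.
by apply: measurable_funD; apply: measurable_funX; [exact: measurable_fst|exact: measurable_snd].
Qed.
Let mI n : measurable_fun setT (fun p : R * R => (rho p ^+ n * fock_weight p)%:E).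
Proof.
apply/measurable_EFinP; apply: measurable_funM; last exact: measurable_fock_weight.
exact: measurable_funX.
Qed.
Let mA n : measurable_fun setT (fun p : R * R => (p.1 ^+ 2 * rho p ^+ n * fock_weight p)%:E).
Proof.
apply/measurable_EFinP; apply: measurable_funM; last exact: measurable_fock_weight.
by apply: measurable_funM; apply: measurable_funX => //; exact: measurable_fst.
Qed.
Let mA' n : measurable_fun setT (fun p : R * R => (p.2 ^+ 2 * rho p ^+ n * fock_weight p)%:E).
Proof.
apply/measurable_EFinP; apply: measurable_funM; last exact: measurable_fock_weight.
by apply: measurable_funM; apply: measurable_funX => //; exact: measurable_snd.
Qed.
Let I0 n p : (0 <= (rho p ^+ n * fock_weight p)%:E)%E.
Proof. by rewrite lee_fin mulr_ge0 ?exprn_ge0 ?fock_weight_ge0. Qed.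
Let A0 n p : (0 <= (p.1 ^+ 2 * rho p ^+ n * fock_weight p)%:E)%E.
Proof. exact: (mulr_ge0 (mulr_ge0 (sqr_ge0 _) (exprn_ge0 n (rho_ge0 p))) (fock_weight_ge0 p)). Qed.
Let A0' n p : (0 <= (p.2 ^+ 2 * rho p ^+ n * fock_weight p)%:E)%E.
Proof. exact: (mulr_ge0 (mulr_ge0 (sqr_ge0 _) (exprn_ge0 n (rho_ge0 p))) (fock_weight_ge0 p)). Qed.

Let intD (f g : R * R -> R) : measurable_fun setT (fun p : R * R => (f p)%:E) ->
  (forall p, (0 <= (f p)%:E)%E) -> measurable_fun setT (fun p : R * R => (g p)%:E) ->
  (forall p, (0 <= (g p)%:E)%E) ->
  (\int[mu2]_p (f p)%:E + \int[mu2]_p (g p)%:E = \int[mu2]_p (f p + g p)%:E)%E.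
Proof.
move=> mf f0 mg g0; rewrite -(ge0_integralD mu2 measurableT (fun p _ => f0 p) mf (fun p _ => g0 p) mg).
by apply: eq_integral => p _; rewrite EFinD.
Qed.

Let I n := (\int[mu2]_p (rho p ^+ n * fock_weight p)%:E)%E.
Let A n := (\int[mu2]_p (p.1 ^+ 2 * rho p ^+ n * fock_weight p)%:E)%E.

Let IS n : I n.+1 = (A n + A n)%E.
Proof.
(* A quarter-turn exchanges the squares of the two coordinates. *)
have AE : A n = (\int[mu2]_p (p.2 ^+ 2 * rho p ^+ n * fock_weight p)%:E)%E.
  have cs : (0:R) ^+ 2 + 1 ^+ 2 = 1 by rewrite expr0n expr1n add0r.
  rewrite -(ge0_integral_rot cs (mA' n) (A0' n)).
  apply: eq_integral => p _; congr EFin; rewrite fock_weight_rot//.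
  by rewrite /rho /rot/=; congr (_ * _ ^+ _ * _); ring.
rewrite {2}AE /A (intD (mA n) (A0 n) (mA' n) (A0' n)); apply: eq_integral => p _.
by congr EFin; rewrite exprS /rho; ring.
Qed.

Let AS n : (A n + A n = I n + n%:R%:E * I n)%E.
Proof.
have D2 (f : R * R -> R) : measurable_fun setT (fun p : R * R => (f p)%:E) -> (forall p, (0 <= (f p)%:E)%E) ->
    (\int[mu2]_p (f p)%:E = \int[mu]_y \int[mu]_x (f (x, y))%:E)%E.
  by move=> mf f0; rewrite (@fubini_tonelli2 _ _ _ _ R mu mu _ mf f0).
have -> : (A n + A n = \int[mu2]_p (2 * p.1 ^+ 2 * rho p ^+ n * fock_weight p)%:E)%E.
  rewrite /A (intD (mA n) (A0 n) (mA n) (A0 n)); apply: eq_integral => p _.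
  by congr EFin; ring.
have -> : (I n + n%:R%:E * I n = \int[mu2]_p ((rho p ^+ n + n%:R * (2 * p.1 ^+ 2 * rho p ^+ n.-1)) * fock_weight p)%:E)%E.
  (* This is [IS] for the predecessor of n; for n = 0 both sides carry the factor 0. *)
  have -> : (n%:R%:E * I n = \int[mu2]_p (n%:R * (2 * p.1 ^+ 2 * rho p ^+ n.-1) * fock_weight p)%:E)%E.
    case: n => [|n].
      rewrite mul0e; apply/esym; under eq_integral do rewrite !mul0r; exact: integral0.
    rewrite IS /A (intD (mA n) (A0 n) (mA n) (A0 n)) -ge0_integralZl_EFin//; last 2 first.
    - by move=> p _; rewrite EFinD adde_ge0.
    - exact: (emeasurable_funD (mA n) (mA n)).
    by apply: eq_integral => p _; rewrite -EFinM; congr EFin => /=; ring.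
  rewrite /I (intD (mI n) (I0 n)).
  - by apply: eq_integral => p _; rewrite -mulrDl.
  - apply/measurable_EFinP; apply: measurable_funM; last exact: measurable_fock_weight.
    apply: measurable_funM => //; apply: measurable_funM; last exact: measurable_funX.
    by apply: measurable_funM => //; apply: measurable_funX; exact: measurable_fst.
  - move=> p; exact: (mulr_ge0 (mulr_ge0 (ler0n _ n) (mulr_ge0 (mulr_ge0 (ler0n _ 2) (sqr_ge0 _)) (exprn_ge0 n.-1 (rho_ge0 p)))) (fock_weight_ge0 p)).
set F := fun p : R * R => 2 * p.1 ^+ 2 * rho p ^+ n * fock_weight p.
set G := fun p : R * R => (rho p ^+ n + n%:R * (2 * p.1 ^+ 2 * rho p ^+ n.-1)) * fock_weight p.
have mF : measurable_fun setT (fun p : R * R => (F p)%:E).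
  apply/measurable_EFinP; apply: measurable_funM; last exact: measurable_fock_weight.
  apply: measurable_funM; last exact: measurable_funX.
  by apply: measurable_funM => //; apply: measurable_funX; exact: measurable_fst.
have mG : measurable_fun setT (fun p : R * R => (G p)%:E).
  apply/measurable_EFinP; apply: measurable_funM; last exact: measurable_fock_weight.
  apply: measurable_funD; first exact: measurable_funX.
  apply: measurable_funM => //; apply: measurable_funM; last exact: measurable_funX.
  by apply: measurable_funM => //; apply: measurable_funX; exact: measurable_fst.
have two0 : 0 <= 2 :> R by [].
have F0 p : (0 <= (F p)%:E)%E.
  exact: (mulr_ge0 (mulr_ge0 (mulr_ge0 two0 (sqr_ge0 _)) (exprn_ge0 n (rho_ge0 p))) (fock_weight_ge0 p)).
have G0 p : (0 <= (G p)%:E)%E.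
  exact: (mulr_ge0 (addr_ge0 (exprn_ge0 n (rho_ge0 p)) (mulr_ge0 (ler0n _ n) (mulr_ge0 (mulr_ge0 two0 (sqr_ge0 _)) (exprn_ge0 n.-1 (rho_ge0 p))))) (fock_weight_ge0 p)).
rewrite (D2 F mF F0) (D2 G mG G0); apply: eq_integral => y _.
pose k := pi^-1 * expR (- y ^+ 2).
have k0 : 0 <= k by rewrite mulr_ge0 ?expR_ge0// invr_ge0 pi_ge0.
have mx j : measurable_fun setT (fun x : R => (x ^+ 2 + y ^+ 2) ^+ j).
  by apply: measurable_funX; apply: measurable_funD => //; exact: measurable_funX.
have mexp : measurable_fun setT (fun x : R => expR (- x ^+ 2)).
  by apply: measurableT_comp => //; apply: measurableT_comp => //; exact: measurable_funX.
have xy0 (x : R) : 0 <= x ^+ 2 + y ^+ 2 by rewrite addr_ge0 ?sqr_ge0.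
have split_y (h : R -> R) : measurable_fun setT h -> (forall x, 0 <= h x) ->
    (\int[mu]_x (h x * fock_weight (x, y))%:E = k%:E * \int[mu]_x (h x * expR (- x ^+ 2))%:E)%E.
  move=> mh h0; rewrite -ge0_integralZl_EFin//.
  - by apply: eq_integral => x _; rewrite -EFinM fock_weightE/= /k; congr EFin; ring.
  - by move=> x _; rewrite lee_fin mulr_ge0 ?expR_ge0.
  - by apply/measurable_EFinP; exact: measurable_funM.
rewrite /F /G /rho /= split_y; last 2 first.
- apply: measurable_funM => //; apply: measurable_funM => //; exact: measurable_funX.
- by move=> x; exact: (mulr_ge0 (mulr_ge0 two0 (sqr_ge0 _)) (exprn_ge0 n (xy0 x))).
rewrite split_y; last 2 first.
- apply: measurable_funD => //; apply: measurable_funM => //; apply: measurable_funM => //.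
  by apply: measurable_funM => //; exact: measurable_funX.
- by move=> x; exact: (addr_ge0 (exprn_ge0 n (xy0 x)) (mulr_ge0 (ler0n _ n) (mulr_ge0 (mulr_ge0 two0 (sqr_ge0 _)) (exprn_ge0 n.-1 (xy0 x))))).
by congr (_ * _)%E; exact: radial_ibp.
Qed.

(** [IS] and [AS] combine to the recurrence I(n+1) = (n + 1) I(n), and I(0) = 1 is a product of two
    real Gaussian integrals. *)
Lemma fock_moment n : (\int[mu2]_p (normc (p.1 +i* p.2) ^+ n.*2 * fock_weight p)%:E = (n`!%:R)%:E)%E.
Proof.
transitivity (I n).
  by apply: eq_integral => p _; rewrite -mul2n exprM normc_pair2.
elim: n => [|n IH]; last first.
  by rewrite IS AS IH -EFinM -EFinD factS natrM -natr1 mulrDl mul1r addrC.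
rewrite /I (@fubini_tonelli2 _ _ _ _ R mu mu _ (mI 0) (I0 0)) /fubini_G /=.
have [i e] := gaussian_integral (0 : R) (ltr01 : 0 < (1 : R)).
have e' : (\int[mu]_x (expR (- x ^+ 2))%:E = (Num.sqrt pi)%:E :> \bar R)%E.
  rewrite -[X in Num.sqrt X]divr1 -e; apply: eq_integral => x _.
  by rewrite subr0 mul1r.
have mexp : measurable_fun setT (fun x : R => (expR (- x ^+ 2))%:E).
  apply/measurable_EFinP; apply: measurableT_comp => //; exact: measurableT_comp.
have E0 (x : R) : (0 <= (expR (- x ^+ 2))%:E :> \bar R)%E by rewrite lee_fin expR_ge0.
transitivity (\int[mu]_y ((Num.sqrt pi / pi)%:E * (expR (- y ^+ 2))%:E))%E.
  apply: eq_integral => y _.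
  transitivity (\int[mu]_x ((pi^-1 * expR (- y ^+ 2))%:E * (expR (- x ^+ 2))%:E))%E.
    by apply: eq_integral => x _; rewrite expr0 mul1r fock_weightE -EFinM/=; congr EFin; ring.
  rewrite ge0_integralZl_EFin ?e'//; last by rewrite mulr_ge0 ?expR_ge0// invr_ge0 pi_ge0.
  by rewrite -!EFinM; congr EFin; ring.
rewrite ge0_integralZl_EFin ?e'//; last by rewrite divr_ge0 ?sqrtr_ge0 ?pi_ge0.
rewrite -EFinM; congr EFin.
by rewrite mulrAC -expr2 sqr_sqrtr ?pi_ge0// divff// gt_eqF// pi_gt0.
Qed.

End FockMoments.

(** * The finite Fourier transform on roots of unity *)

Section FiniteFourier.
Context {R : realType}.
Local Notation C := R[i].
Local Notation Re := (@complex.Re R).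
Local Notation Im := (@complex.Im R).

Lemma normc_conj (z : C) : (normc z ^+ 2)%:C = z * conjc z.
Proof. by rewrite normc_sqr; case: z => a b; apply: complexP; rewrite /=; ring. Qed.

Lemma conjcM (z w : C) : conjc (z * w) = conjc z * conjc w.
Proof. exact: rmorphM. Qed.

Lemma conjc_sum (I : Type) (r : seq I) (P : pred I) (F : I -> C) :
  conjc (\sum_(i <- r | P i) F i) = \sum_(i <- r | P i) conjc (F i).
Proof. exact: rmorph_sum. Qed.

Lemma conjcX (z : C) n : conjc (z ^+ n) = conjc z ^+ n.
Proof. exact: rmorphXn. Qed.

Context (N : nat) (N0 : (0 < N)%N).

Definition unit_root : C := cexp (0 +i* (pi *+ 2 / N%:R)).
Local Notation w := unit_root.

Lemma unit_rootX j : w ^+ j = cexp (0 +i* (j%:R * (pi *+ 2 / N%:R))).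
Proof.
rewrite /w cexpX; congr cexp; apply: complexP; rewrite !ReImE/=; ring.
Qed.

Lemma unit_root1 : w ^+ N = 1.
Proof.
rewrite unit_rootX mulrCA divff ?mulr1 ?pnatr_eq0 ?gtn_eqF//.
by rewrite /cexp/= expR0 mul1r cos2pi sin2pi.
Qed.

Lemma normc_unit_root : normc w = 1.
Proof. by rewrite normc_cexp/= expR0. Qed.

Lemma unit_root_neq0 : w != 0. Proof. exact: cexp_neq0. Qed.

Lemma conjc_unit_root : conjc w = w^-1.
Proof.
apply: (mulfI unit_root_neq0); rewrite divff ?unit_root_neq0//.
by rewrite -normc_conj normc_unit_root expr1n.
Qed.

(** The real part is cos t = 1 - 2 sin^2 (t/2), with t/2 strictly between 0 and pi. *)
Lemma unit_root_prim j : (0 < j < N)%N -> w ^+ j != 1.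
Proof.
move=> /andP[j0 jN]; apply/eqP; rewrite unit_rootX => /(congr1 Re).
rewrite Re_cexp/= expR0 mul1r.
set t := _ * _; have -> : t = (t / 2) *+ 2 by rewrite -mulr_natr divfK.
have Npos : (0 : R) < N%:R by rewrite ltr0n.
have s0 : 0 < sin (t / 2).
  apply: sin_gt0_pi; apply/andP; split.
    by rewrite !divr_gt0// mulr_gt0 ?ltr0n// divr_gt0// pmulrn_lgt0// pi_gt0.
  have -> : t / 2 = pi * (j%:R / N%:R).
    by rewrite /t -mulr_natr; field; rewrite gt_eqF.
  by rewrite gtr_pMr ?pi_gt0// ltr_pdivrMr// mul1r ltr_nat.
rewrite mulr2n cosD; have := cos2Dsin2 (t / 2); have := mulr_gt0 s0 s0.
by rewrite !expr2; lra.
Qed.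

Lemma geom_root (x : C) : x ^+ N = 1 -> x != 1 -> \sum_(n < N) x ^+ n = 0.
Proof.
move=> xN x1; have := subrX1 x N; rewrite xN subrr => /esym/eqP.
by rewrite mulf_eq0 subr_eq0 (negbTE x1)/= => /eqP.
Qed.

Lemma unit_root_orth (k l : nat) : (k < N)%N -> (l < N)%N ->
  \sum_(n < N) (w^-1 ^+ k * w ^+ l) ^+ n = if k == l then N%:R else 0.
Proof.
move=> kN lN; case: eqVneq => [->|kl].
  under eq_bigr do rewrite -exprMn mulVf ?unit_root_neq0// expr1n expr1n.
  by rewrite sumr_const card_ord.
apply: geom_root.
  by rewrite exprMn (exprAC _ k) (exprAC _ l) exprVn unit_root1 invr1 !expr1n mulr1.
(* Exchanging k and l inverts the root of unity, so being different from 1 is symmetric in them. *)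
wlog kl' : k l kN lN kl / (k < l)%N => [hw|].
  move: kl; rewrite neq_ltn => /orP[h|h]; first by apply: hw => //; rewrite neq_ltn h.
  apply/eqP => e; have /eqP := hw l k lN kN ltac:(by rewrite neq_ltn h) h; apply.
  apply: (mulfI (expf_neq0 l (unit_root_neq0))).
  rewrite mulrA exprVn divff ?expf_neq0 ?unit_root_neq0// mul1r mulr1.
  by rewrite -[LHS]mulr1 -e mulrA -exprMn mulfV ?unit_root_neq0// expr1n mul1r.
have -> : w^-1 ^+ k * w ^+ l = w ^+ (l - k).
  by rewrite -{1}(subnKC (ltnW kl')) exprD mulrA -exprMn mulVf ?unit_root_neq0// expr1n mul1r.
by apply: unit_root_prim; rewrite subn_gt0 kl'/= (leq_ltn_trans (leq_subr _ _)).
Qed.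

Definition dft (c : nat -> C) (n : nat) : C :=
  N%:R^-1 * \sum_(k < N) (w^-1 ^+ k) ^+ n * c k.

Let Nn0 : (N%:R : C) != 0. Proof. by rewrite pnatr_eq0 gtn_eqF. Qed.

Lemma dft_parseval (c : nat -> C) :
  \sum_(n < N) normc (dft c n) ^+ 2 = N%:R^-1 * \sum_(k < N) normc (c k) ^+ 2.
Proof.
apply: (@complexI R); rewrite rmorphM rmorph_sum/= fmorphV rmorph_nat rmorph_sum/=.
under eq_bigr do rewrite normc_conj /dft conjcM conjc_sum mulrACA mulr_suml.
have cwV : conjc w^-1 = w by rewrite conjc_inv conjc_unit_root invrK.
have cN : conjc (N%:R^-1 : C) = N%:R^-1 by rewrite fmorphV rmorph_nat.
under eq_bigr => n _.
  rewrite cN.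
  under eq_bigr => k _.
    rewrite mulr_sumr.
    under eq_bigr => l _ do rewrite conjcM !conjcX cwV mulrACA -exprMn.
    over.
  over.
rewrite -mulr_sumr -!mulrA; congr (_ * _).
apply: (mulfI Nn0); rewrite mulrA divff// mul1r.
rewrite exchange_big/= mulr_sumr; apply: eq_bigr => k _.
rewrite exchange_big/= (bigD1 k)//= [X in _ + X]big1 ?addr0.
  by rewrite -mulr_suml unit_root_orth// eqxx normc_conj.
move=> l lk; rewrite -mulr_suml unit_root_orth// ifF ?mul0r//.
by apply/negbTE; rewrite eq_sym.
Qed.

(** Sampled at the N rotations of z, a polynomial of degree below N is separated into its
    homogeneous terms; the factor 1/N in [dft] makes this exact. *)
Lemma dft_monomials (a : nat -> C) (z : C) n : (n < N)%N ->
  dft (fun k => \sum_(m < N) a m * (w ^+ k * z) ^+ m) n = a n * z ^+ n.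
Proof.
move=> nN; rewrite /dft.
under eq_bigr do rewrite mulr_sumr.
rewrite exchange_big/= (bigD1 (Ordinal nN))//= [X in _ + X]big1 ?addr0.
  rewrite (eq_bigr (fun=> a n * z ^+ n)) => [|k _]; last first.
    have e : w^-1 ^+ k * w ^+ k = 1 by rewrite -exprMn mulVf ?unit_root_neq0// expr1n.
    have e2 : (w^-1 ^+ k) ^+ n * (w ^+ k) ^+ n = 1 by rewrite -[LHS]exprMn e expr1n.
    by rewrite (exprMn n (w ^+ k) z) [a n * _]mulrCA [LHS]mulrA e2 mul1r.
  have -> : \sum_(k < N) a n * z ^+ n = N%:R * (a n * z ^+ n).
    by rewrite sumr_const card_ord mulr_natl.
  by rewrite mulKf.
move=> m mn.
rewrite (eq_bigr (fun k : 'I_N => (a m * z ^+ m) * (w^-1 ^+ n * w ^+ m) ^+ k)) => [|k _]; last first.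
  rewrite (exprMn m (w ^+ k) z) (exprMn k (w^-1 ^+ n)).
  by rewrite (exprAC w^-1 n) (exprAC w m); ring.
rewrite -mulr_sumr unit_root_orth// ifF ?mulr0//.
by apply/negbTE; apply: contra mn => /eqP e; apply/eqP/val_inj.
Qed.

Lemma dftB (c d : nat -> C) n : dft c n - dft d n = dft (fun k => c k - d k) n.
Proof.
rewrite /dft -mulrBr -sumrB; congr (_ * _).
by apply: eq_bigr => k _; rewrite mulrBr.
Qed.

Lemma normc_dft_le (c : nat -> C) (M : R) n : (forall k, normc (c k) <= M) ->
  normc (dft c n) <= M.
Proof.
move=> cM; rewrite /dft normcM normcV.
have -> : normc (N%:R : C) = N%:R by rewrite -(rmorph_nat (real_complex R)) normc_real normr_nat.
rewrite mulrC ler_pdivrMr ?ltr0n//; apply: (le_trans (normc_sum _ _ _)).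
apply: (@le_trans _ _ (\sum_(k < N) M)); last by rewrite sumr_const card_ord mulr_natr.
apply: ler_sum => k _; rewrite normcM !normcX normcV normc_unit_root invr1 !expr1n mul1r.
exact: cM.
Qed.

End FiniteFourier.

(** * The coefficient bound for Fock functions *)

Section FockCoefficients.
Context {R : realType}.
Local Notation C := R[i].
Local Notation Re := (@complex.Re R).
Local Notation Im := (@complex.Im R).
Local Notation mu := (@lebesgue_measure R).
Local Notation mu2 := (mu \x mu)%E.
Implicit Types (f : C -> C) (z w : C).

Lemma ler_sum_ord (F : nat -> R) m n : (forall i, 0 <= F i) -> (m <= n)%N ->
  \sum_(i < m) F i <= \sum_(i < n) F i.
Proof.
move=> F0 /subnKC <-; rewrite big_split_ord/= lerDl.
by apply: sumr_ge0 => i _; exact: F0.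
Qed.

Lemma cvg_K2 (K : R) : K / 2 ^+ n @[n --> \oo] --> 0.
Proof.
rewrite -[X in _ --> X](mulr0 K); apply: cvgMr.
rewrite [X in X @ _](_ : _ = (fun n => 2^-1 ^+ n)); last by apply/funext => n; rewrite exprVn.
by apply: cvg_expr; rewrite gtr0_norm ?invf_lt1// ltr1n.
Qed.

Lemma taylor_cvg f z : entire f ->
  normc (f z - \sum_(n < N.+1) taylor_coef f n * z ^+ n) @[N --> \oo] --> 0.
Proof.
move=> ef; have [K K0 hK] := taylor_bound ef (normc_ge0 z).
apply: (@squeeze_cvgr _ _ _ _ (cst 0) (fun N => K / 2 ^+ N)).
- by apply: nearW => N; rewrite normc_ge0/= hK.
- exact: cvg_cst.
- exact: cvg_K2.
Qed.

(** A pointwise limit of Taylor polynomials. *)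
Lemma cmeas_entire f : entire f -> cmeas (fun p : R * R => f (p.1 +i* p.2)).
Proof.
move=> ef.
have mS N : cmeas (fun p : R * R => \sum_(n < N.+1) taylor_coef f n * (p.1 +i* p.2) ^+ n).
  have mt n : cmeas (fun p : R * R => taylor_coef f n * (p.1 +i* p.2) ^+ n).
    by apply: cmeasM; [exact: cmeas_cst|apply: cmeasX; exact: cmeas_pair].
  exact: (cmeas_sum N.+1 mt).
apply: (cmeas_cvg mS) => p; have := taylor_cvg (p.1 +i* p.2) ef.
by under eq_fun do rewrite normcC.
Qed.

Lemma measurable_fock_integrand f : entire f ->
  measurable_fun setT (fun p : R * R => (normc (f (p.1 +i* p.2)) ^+ 2 * fock_weight p)%:E).
Proof.
move=> ef; apply/measurable_EFinP; apply: measurable_funM; last exact: measurable_fock_weight.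
by apply: measurable_funX; apply: measurable_normc; exact: cmeas_entire.
Qed.

Lemma fock_integrand_ge0 f (p : R * R) :
  (0 <= (normc (f (p.1 +i* p.2)) ^+ 2 * fock_weight p)%:E)%E.
Proof. exact: (mulr_ge0 (sqr_ge0 _) (fock_weight_ge0 p)). Qed.

Lemma rot_complex (c : C) (p : R * R) :
  let q := rot (Re c) (Im c) p in q.1 +i* q.2 = c * (p.1 +i* p.2).
Proof. by case: c => a b; apply: complexP; rewrite /=; ring. Qed.

Lemma entire_rotate f (c : C) : entire f -> entire (fun z => f (c * z)).
Proof.
move=> ef z; apply: (@cdiff_comp _ (fun z => c * z)); last exact: ef.
by apply: cdiffM; [exact: cdiff_cst|exact: cdiff_id].
Qed.

Lemma fock_normsq_rotate f (c : C) : entire f -> normc c = 1 ->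
  fock_normsq (fun z => f (c * z)) = fock_normsq f.
Proof.
move=> ef c1.
have cs : Re c ^+ 2 + Im c ^+ 2 = 1 by rewrite -normc_sqr c1 expr1n.
rewrite /fock_normsq -[RHS](ge0_integral_rot cs (measurable_fock_integrand ef) (@fock_integrand_ge0 f)).
apply: eq_integral => p _; congr EFin; rewrite fock_weight_rot// -rot_complex//.
Qed.

Lemma fock_rotate f (c : C) : fock f -> normc c = 1 -> fock (fun z => f (c * z)).
Proof.
by move=> [ef nf] c1; split; [exact: entire_rotate|rewrite fock_normsq_rotate].
Qed.

(** [dft] recovers the terms of the Taylor polynomial exactly, and as an average with unimodular
    weights it does not enlarge the Taylor remainder. *)
Lemma dft_taylor f (rho : R) : entire f -> 0 <= rho -> exists2 K : R, 0 <= K &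
  forall N n z, (n <= N)%N -> normc z <= rho ->
    normc (dft N.+1 (fun k => f (unit_root N.+1 ^+ k * z)) n - taylor_coef f n * z ^+ n) <= K / 2 ^+ N.
Proof.
move=> ef rho0; have [K K0 hK] := taylor_bound ef rho0.
exists K => // N n z nN zr.
rewrite -(@dft_monomials R N.+1 isT (taylor_coef f) z n)// dftB.
apply: normc_dft_le => // k; apply: hK.
by rewrite normcM normcX normc_unit_root expr1n mul1r.
Qed.

(** Parseval bounds the sum of M squared components of f by the mean of |f|^2 over rotations, and
    each rotation has the same Fock norm. As the number of rotations grows, the components tend to
    the Taylor terms; Fatou passes to the limit, and [fock_moment] supplies n!. *)
Lemma fock_coef_bound f M : fock f ->
  ((\sum_(n < M) n`!%:R * normc (taylor_coef f n) ^+ 2)%:E <= fock_normsq f)%E.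
Proof.
move=> [ef nf].
(* With M + j + 1 rotations all frequencies below M are available for every j, and j tends to
   infinity. *)
pose P (j n : nat) (p : R * R) : C :=
  dft (M + j).+1 (fun k => f (unit_root (M + j).+1 ^+ k * (p.1 +i* p.2))) n.
pose g (j : nat) (p : R * R) : R := (\sum_(n < M) normc (P j n p) ^+ 2) * fock_weight p.
pose h (p : R * R) : R := (\sum_(n < M) normc (taylor_coef f n * (p.1 +i* p.2) ^+ n) ^+ 2) * fock_weight p.
have mP j n : cmeas (P j n).
  apply: cmeasM; first exact: cmeas_cst.
  have mt k : cmeas (fun p : R * R => (unit_root (M + j).+1)^-1 ^+ k ^+ n *
      f (unit_root (M + j).+1 ^+ k * (p.1 +i* p.2))).
    apply: cmeasM; first exact: cmeas_cst.
    exact: (@cmeas_entire (fun z => f (unit_root (M + j).+1 ^+ k * z)) (@entire_rotate f _ ef)).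
  exact: (cmeas_sum _ mt).
have mg j : measurable_fun setT (fun p : R * R => (g j p)%:E).
  apply/measurable_EFinP; apply: measurable_funM; last exact: measurable_fock_weight.
  apply: (measurable_sum _ (h := fun (n : 'I_M) p => normc (P j n p) ^+ 2)) => n.
  by apply: measurable_funX; exact: measurable_normc.
have g0 j p : (0 <= (g j p)%:E)%E.
  rewrite lee_fin mulr_ge0 ?fock_weight_ge0//.
  by apply: sumr_ge0 => i _; exact: sqr_ge0.
have [S fS] : exists S : R, fock_normsq f = S%:E.
  exists (fine (fock_normsq f)); rewrite fineK// ge0_fin_numE//.
  by apply: integral_ge0 => p _; exact: fock_integrand_ge0.
have intg j : (\int[mu2]_p (g j p)%:E <= S%:E)%E.
  set N := (M + j).+1.
  pose G (k : nat) (p : R * R) := N%:R^-1 * (normc (f (unit_root N ^+ k * (p.1 +i* p.2))) ^+ 2 * fock_weight p).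
  have ek k : entire (fun z => f (unit_root N ^+ k * z)) by exact: entire_rotate.
  have mG (k : 'I_N) : measurable_fun setT (fun p : R * R => (G k p)%:E).
    apply/measurable_EFinP; apply: measurable_funM => //.
    by apply/measurable_EFinP; exact: (measurable_fock_integrand (ek k)).
  have Nge0 : (0 : R) <= N%:R^-1 by rewrite invr_ge0.
  have G0 (k : 'I_N) (p : R * R) : setT p -> (0 <= (G k p)%:E)%E.
    move=> _; rewrite lee_fin mulr_ge0//.
    by exact: (fock_integrand_ge0 (fun z => f (unit_root N ^+ k * z)) p).
  have intG (k : 'I_N) : (\int[mu2]_p (G k p)%:E = (N%:R^-1 * S)%:E)%E.
    rewrite EFinM -fS -(fock_normsq_rotate ef (_ : normc (unit_root N ^+ k) = 1)); last first.
      by rewrite normcX normc_unit_root expr1n.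
    rewrite -(ge0_integralZl_EFin mu2 measurableT (fun p _ => fock_integrand_ge0 (fun z => f (unit_root N ^+ k * z)) p) (measurable_fock_integrand (ek k)) Nge0).
    by apply: eq_integral => p _; rewrite EFinM.
  apply: (@le_trans _ _ (\int[mu2]_p (\sum_(k < N) (G k p)%:E))%E).
    apply: ge0_le_integral => //.
    - exact: mg.
    - exact: (emeasurable_sum _ mG).
    - move=> p _; rewrite sumEFin lee_fin /g /G -mulr_sumr -mulr_suml mulrA.
      rewrite ler_wpM2r ?fock_weight_ge0//.
      rewrite -(@dft_parseval R N isT (fun k => f (unit_root N ^+ k * (p.1 +i* p.2)))).
      apply: (@ler_sum_ord (fun n => normc (P j n p) ^+ 2)) => [i|]; first exact: sqr_ge0.
      by rewrite /N -addnS leq_addr.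
  rewrite (ge0_integral_sum mu2 measurableT mG G0).
  rewrite (eq_bigr (fun=> (N%:R^-1 * S)%:E)) => [|k _]; last exact: intG.
  rewrite sumEFin sumr_const card_ord -[_ *+ N]mulr_natl mulrA mulfV ?mul1r//.
  by rewrite pnatr_eq0.
have cvgg p : (g j p)%:E @[j --> \oo] --> (h p)%:E.
  apply/cvg_EFin; first exact: nearW.
  rewrite /g /h; apply: cvgMl.
  apply: (cvg_big (op := +%R) (@add_continuous R^o)) => n _.
  rewrite expr2; under eq_fun do rewrite expr2.
  have cn : normc (P j n p) @[j --> \oo] --> normc (taylor_coef f n * (p.1 +i* p.2) ^+ n).
    have [K K0 hK] := dft_taylor ef (normc_ge0 (p.1 +i* p.2)).
    apply/cvgrPdist_le => e e0.
    have /cvgrPdist_le/(_ _ e0) := cvg_K2 K.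
    apply: filterS => j; rewrite sub0r normrN => hj.
    apply: le_trans hj; rewrite distrC.
    have h1 : normc (P j n p - taylor_coef f n * (p.1 +i* p.2) ^+ n) <= K / 2 ^+ j.
      apply: (le_trans (hK (M + j)%N n _ _ (lexx _))).
        by rewrite (leq_trans (ltnW (ltn_ord n)))// leq_addr.
      rewrite ler_wpM2l// lef_pV2 ?posrE ?exprn_gt0//.
      by rewrite ler_weXn2l ?ler1n// leq_addl.
    rewrite [leRHS]ger0_norm ?divr_ge0 ?exprn_ge0//.
    apply: le_trans h1; rewrite ler_norml lerNl opprB lerB_normc andbT normcC.
    exact: lerB_normc.
  exact: cvgM.
have -> : (\sum_(n < M) n`!%:R * normc (taylor_coef f n) ^+ 2)%:E = (\int[mu2]_p (h p)%:E)%E.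
  pose H (n : 'I_M) (p : R * R) := ((normc (taylor_coef f n) ^+ 2)%:E * (normc (p.1 +i* p.2) ^+ n.*2 * fock_weight p)%:E)%E.
  have m0 n : measurable_fun setT (fun p : R * R => (normc (p.1 +i* p.2) ^+ n.*2 * fock_weight p)%:E).
    apply/measurable_EFinP; apply: measurable_funM; last exact: measurable_fock_weight.
    by apply: measurable_funX; apply: measurable_normc; exact: cmeas_pair.
  have p0 n (p : R * R) : (0 <= (normc (p.1 +i* p.2) ^+ n.*2 * fock_weight p)%:E)%E.
    by rewrite lee_fin mulr_ge0 ?fock_weight_ge0// exprn_ge0// normc_ge0.
  have mH n : measurable_fun setT (H n) by exact: measurable_funeM.
  have H0 n p : setT p -> (0 <= H n p)%E by move=> _; rewrite mule_ge0// lee_fin sqr_ge0.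
  transitivity (\int[mu2]_p (\sum_(n < M) H n p))%E; last first.
    apply: eq_integral => p _; rewrite /H /h mulr_suml -sumEFin; apply: eq_bigr => n _.
    rewrite -EFinM mulrA; congr (_ * _)%:E.
    by rewrite (normcM (taylor_coef f n)) (exprMn 2 (normc (taylor_coef f n))) normcX -(exprM (normc _) n 2) muln2.
  rewrite (ge0_integral_sum mu2 measurableT mH H0) -sumEFin; apply: eq_bigr => n _.
  rewrite (ge0_integralZl_EFin mu2 measurableT (fun p _ => p0 n p) (m0 n) (sqr_ge0 _)).
  by rewrite fock_moment -EFinM mulrC.
have fat := fatou mu2 measurableT mg (fun j p _ => g0 j p).
rewrite fS; apply: (@le_trans _ _ (limn_einf (fun j => \int[mu2]_p (g j p)%:E))%E).
  apply: le_trans fat; rewrite le_eqVlt; apply/orP; left; apply/eqP.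
  apply: eq_integral => p _; apply/esym.
  rewrite is_cvg_limn_einfE; last by apply/cvg_ex; eexists; exact: cvgg.
  by apply/cvg_lim => //; exact: cvgg.
rewrite limn_einf_lim; apply: lime_le; first exact: is_cvg_einfs.
apply: nearW => j; apply: le_trans (intg j).
by apply: ereal_inf_lbound; exists j => //=.
Qed.

End FockCoefficients.

(** * The space L^2 *)

Section SquareIntegrable.
Context d (T : measurableType d) {R : realType}.
Context (mu : {measure set T -> \bar R}).
Local Notation C := R[i].
Local Notation Re := (@complex.Re R).
Local Notation Im := (@complex.Im R).
Implicit Types (u v : T -> C).

Definition sqnorm u : \bar R := (\int[mu]_x (normc (u x) ^+ 2)%:E)%E.

Definition sqint u : Prop := cmeas u /\ (sqnorm u < +oo)%E.

Lemma sqnorm_ge0 u : (0 <= sqnorm u)%E.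
Proof. by apply: integral_ge0 => x _; rewrite lee_fin sqr_ge0. Qed.

Lemma measurable_sqnorm u : cmeas u -> measurable_fun setT (fun x => (normc (u x) ^+ 2)%:E).
Proof.
move=> mu_; apply/measurable_EFinP; apply: measurable_funX; exact: measurable_normc.
Qed.

Lemma eq_sqnorm u v : (forall x, u x = v x) -> sqnorm u = sqnorm v.
Proof. by move=> uv; apply: eq_integral => x _; rewrite uv. Qed.

Lemma sqint_integrable u : sqint u -> mu.-integrable setT (EFin \o (fun x => normc (u x) ^+ 2)).
Proof.
move=> [mu_ nu]; apply/integrableP; split; first exact: measurable_sqnorm.
under eq_integral do rewrite gee0_abs ?lee_fin ?sqr_ge0//.
exact: nu.
Qed.

Lemma sqint_fin u : sqint u -> sqnorm u = (\int[mu]_x (normc (u x) ^+ 2))%:E.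
Proof.
move=> [_ nu]; rewrite /Rintegral fineK// ge0_fin_numE//; exact: sqnorm_ge0.
Qed.

Lemma sqnorm_scale u (a : R) : cmeas u -> (\int[mu]_x (a ^+ 2 * normc (u x) ^+ 2)%:E = (a ^+ 2)%:E * sqnorm u)%E.
Proof.
move=> mu_; under eq_integral do rewrite EFinM.
rewrite ge0_integralZl_EFin ?sqr_ge0//; last exact: measurable_sqnorm.
by move=> x _; rewrite lee_fin sqr_ge0.
Qed.

Lemma sqnormZ (c : C) u : cmeas u -> (sqnorm (fun x => c * u x)%R = (normc c ^+ 2)%:E * sqnorm u)%E.
Proof.
move=> mu_; rewrite -sqnorm_scale//; apply: eq_integral => x _.
by rewrite (normcM c) (exprMn 2 (normc c)).
Qed.

Lemma sqintZ (c : C) u : sqint u -> sqint (fun x => c * u x).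
Proof.
move=> su; split; first by apply: cmeasM su.1; exact: cmeas_cst.
by rewrite sqnormZ ?(sqint_fin su) ?ltry//; exact: su.1.
Qed.

(** From |a + b|^2 <= 2 |a|^2 + 2 |b|^2 pointwise. *)
Lemma sqnormD_le u v : cmeas u -> cmeas v ->
  (sqnorm (fun x => u x + v x)%R <= 2%:E * sqnorm u + 2%:E * sqnorm v)%E.
Proof.
move=> mu_ mv.
have p0 (w : T -> C) x : setT x -> (0 <= (normc (w x) ^+ 2)%:E)%E by move=> _; rewrite lee_fin sqr_ge0.
have p2 (w : T -> C) x : setT x -> (0 <= 2%:E * (normc (w x) ^+ 2)%:E)%E.
  by move=> _; rewrite mule_ge0// lee_fin ?sqr_ge0.
rewrite -(ge0_integralZl_EFin mu measurableT (p0 u) (measurable_sqnorm mu_) (ler0n _ 2)).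
rewrite -(ge0_integralZl_EFin mu measurableT (p0 v) (measurable_sqnorm mv) (ler0n _ 2)).
rewrite -ge0_integralD//; last 4 first.
- exact: p2.
- by apply: measurable_funeM; exact: measurable_sqnorm.
- exact: p2.
- by apply: measurable_funeM; exact: measurable_sqnorm.
apply: ge0_le_integral => //.
- by move=> x _; rewrite lee_fin sqr_ge0.
- by apply: measurable_sqnorm; exact: cmeasD.
- by apply: emeasurable_funD; apply: measurable_funeM; exact: measurable_sqnorm.
move=> x _; rewrite -!EFinM -EFinD lee_fin.
have h : normc (u x + v x) <= normc (u x) + normc (v x) by exact: le_normcD.
apply: (@le_trans _ _ ((normc (u x) + normc (v x)) ^+ 2)).
  by rewrite ler_pXn2r// nnegrE ?addr_ge0// normc_ge0.
have := sqr_ge0 (normc (u x) - normc (v x)); rewrite sqrrB (sqrrD (normc (u x))).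
lra.
Qed.

Lemma sqintD u v : sqint u -> sqint v -> sqint (fun x => u x + v x).
Proof.
move=> su sv; split; first exact: cmeasD su.1 sv.1.
apply: (le_lt_trans (sqnormD_le su.1 sv.1)).
by rewrite (sqint_fin su) (sqint_fin sv) -!EFinM -EFinD ltry.
Qed.

Lemma sqnormN u : sqnorm (fun x => - u x) = sqnorm u.
Proof. by apply: eq_integral => x _; rewrite normcN. Qed.

Lemma sqintN u : sqint u -> sqint (fun x => - u x).
Proof. by move=> [m n]; split; [exact: cmeasN|rewrite sqnormN]. Qed.

Lemma sqintB u v : sqint u -> sqint v -> sqint (fun x => u x - v x).
Proof. by move=> su sv; apply: sqintD => //; exact: sqintN. Qed.

Lemma sqnormB_le u v : cmeas u -> cmeas v ->
  (sqnorm (fun x => u x - v x)%R <= 2%:E * sqnorm u + 2%:E * sqnorm v)%E.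
Proof.
by move=> mu_ mv; rewrite -(sqnormN v); apply: sqnormD_le => //; exact: cmeasN.
Qed.

Lemma sqnorm_triangle u v w : cmeas u -> cmeas v -> cmeas w ->
  (sqnorm (fun x => u x - w x)%R <=
   2%:E * sqnorm (fun x => u x - v x)%R + 2%:E * sqnorm (fun x => v x - w x)%R)%E.
Proof.
move=> mu_ mv mw; rewrite (@eq_sqnorm _ (fun x => (u x - v x) + (v x - w x))).
  by apply: sqnormD_le; exact: cmeasB.
by move=> x; rewrite addrA subrK.
Qed.

Lemma ae_eq_sqnorm u v : cmeas u -> cmeas v -> {ae mu, forall x, u x = v x} ->
  sqnorm u = sqnorm v.
Proof.
move=> mu_ mv uv; apply: ae_eq_integral => //; try exact: measurable_sqnorm.
by apply: filterS uv => x /= -> _.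
Qed.

Lemma sqintM_integ u v : sqint u -> sqint v -> cinteg mu setT (fun x => u x * v x).
Proof.
move=> su sv.
have i := integrableD measurableT (sqint_integrable su) (sqint_integrable sv).
apply: (@cinteg_leT _ _ _ _ _ (fun x => normc (u x) ^+ 2 + normc (v x) ^+ 2)).
- exact: cmeasM su.1 sv.1.
- by apply: eq_integrable i => // x _; rewrite /= EFinD.
move=> x; rewrite (normcM (u x)).
move: (normc (u x)) (normc (v x)) => a b; nra.
Qed.

(* Weighted AM-GM, which replaces the Cauchy-Schwarz inequality. *)
Lemma normc_cintM_le u v (A B t : R) : sqint u -> sqint v -> 0 < t ->
  (sqnorm u <= A%:E)%E -> (sqnorm v <= B%:E)%E ->
  normc (cint mu setT (fun x => u x * v x)) <= t * A + B / t.
Proof.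
move=> su sv t0; rewrite (sqint_fin su) (sqint_fin sv) !lee_fin => hA hB.
apply: (le_trans (normc_cint_le measurableT (sqintM_integ su sv))).
have iu := integrable_scale t measurableT (sqint_integrable su).
have iv := integrable_scale t^-1 measurableT (sqint_integrable sv).
apply: (@le_trans _ _ (\int[mu]_x (t * normc (u x) ^+ 2 + t^-1 * normc (v x) ^+ 2))).
  apply: le_Rintegral => //.
  - exact: (cinteg_normc measurableT (sqintM_integ su sv)).
  - have i := integrableD measurableT iu iv.
    by apply: eq_integrable i => // x _; rewrite /= EFinD.
  move=> x _; rewrite (normcM (u x)).
  move: (normc (u x)) (normc (v x)) => a b.
  have t'0 : 0 < t^-1 by rewrite invr_gt0.
  have e1 : t * t^-1 = 1 by rewrite mulfV// gt_eqF.
  have h1 : 0 <= t^-1 * (t * a - b) ^+ 2 by rewrite mulr_ge0 ?sqr_ge0// ltW.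
  have h2 : t^-1 * (t * a - b) ^+ 2 = t * t^-1 * t * a ^+ 2 - 2 * (t * t^-1) * a * b + t^-1 * b ^+ 2 by ring.
  move: h1; rewrite h2 e1 => h1.
  have h3 : 0 <= t * a ^+ 2 + t^-1 * b ^+ 2.
    by apply: addr_ge0; apply: mulr_ge0 (sqr_ge0 _); exact: ltW.
  by lra.
rewrite RintegralD// !RintegralZl//; try exact: sqint_integrable.
by rewrite lerD// ?ler_pM2l// mulrC ler_pM2r// invr_gt0.
Qed.

(** Fatou with a bound on the integrals that holds only from some index [K] on; the sequence is
    shifted by [K]. *)
Lemma fatou_bound (g : nat -> T -> R) (h : T -> R) (S : \bar R) :
  (forall k, measurable_fun setT (g k)) -> (forall k x, 0 <= g k x) ->
  (forall x, g k x @[k --> \oo] --> h x) ->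
  (\forall k \near \oo, \int[mu]_x (g k x)%:E <= S)%E -> (\int[mu]_x (h x)%:E <= S)%E.
Proof.
move=> mg g0 gh [K _ hS].
have cg x : (g (k + K)%N x)%:E @[k --> \oo] --> (h x)%:E.
  apply/cvg_EFin; first exact: nearW.
  by rewrite (cvg_shiftn K (fun k => g k x)); exact: gh.
have mg' k : measurable_fun setT (fun x => (g (k + K)%N x)%:E) by exact/measurable_EFinP.
have fat := fatou mu measurableT mg' (fun k x _ => g0 (k + K)%N x).
apply: (@le_trans _ _ (limn_einf (fun k => \int[mu]_x (g (k + K)%N x)%:E))%E).
  apply: le_trans fat; rewrite le_eqVlt; apply/orP; left; apply/eqP.
  apply: eq_integral => x _; apply/esym.
  rewrite is_cvg_limn_einfE; last by apply/cvg_ex; eexists; exact: cg.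
  by apply/cvg_lim => //; exact: cg.
rewrite limn_einf_lim; apply: lime_le; first exact: is_cvg_einfs.
apply: nearW => k; apply: (@le_trans _ _ (\int[mu]_x (g (k + K)%N x)%:E)%E).
  by apply: ereal_inf_lbound; exists k => //=.
by apply: hS => /=; rewrite leq_addl.
Qed.

Lemma cvg_normc_sqr (F : nat -> C) z : normc (F n - z) @[n --> \oo] --> 0 ->
  normc (F n) ^+ 2 @[n --> \oo] --> normc z ^+ 2.
Proof.
move=> Fz; rewrite expr2; under eq_fun do rewrite expr2.
have cn : normc (F n) @[n --> \oo] --> normc z.
  apply/cvgrPdist_le => e e0.
  have /cvgrPdist_le/(_ _ e0) := Fz.
  apply: filterS => n; rewrite sub0r normrN ger0_norm ?normc_ge0// => h.
  apply: le_trans h; rewrite ler_norml lerNl opprB lerB_normc/= normcC.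
  exact: lerB_normc.
exact: (cvgM cn cn).
Qed.

Lemma sqnorm_fatou (F : nat -> T -> C) u (S : \bar R) : (forall k, cmeas (F k)) ->
  (forall x, normc (F k x - u x) @[k --> \oo] --> 0) ->
  (\forall k \near \oo, sqnorm (F k) <= S)%E -> (sqnorm u <= S)%E.
Proof.
move=> mF Fu nS; apply: (@fatou_bound (fun k x => normc (F k x) ^+ 2)) nS.
- by move=> k; apply: measurable_funX; exact: measurable_normc.
- by move=> k x; exact: sqr_ge0.
- by move=> x; exact: cvg_normc_sqr.
Qed.

End SquareIntegrable.

(** * Completeness of L^2 *)

Section Completeness.
Context d (T : measurableType d) {R : realType}.
Context (mu : {measure set T -> \bar R}).
Local Notation C := R[i].
Local Notation Re := (@complex.Re R).
Local Notation Im := (@complex.Im R).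
Implicit Types (u v : T -> C).

(** Adding 2K / 2^k makes the sequence nonincreasing, subtracting it gives a lower bound; monotone
    convergence then applies. *)
Lemma geometric_cvg (v : R^nat) (K : R) : 0 <= K ->
  (forall k, `|v k.+1 - v k| <= K / 2 ^+ k) -> cvgn v.
Proof.
move=> K0 hv.
pose w k := v k + 2 * (K / 2 ^+ k).
have p2 k : (0 : R) <= K / 2 ^+ k by rewrite divr_ge0// exprn_ge0.
have e2 k : 2 * (K / 2 ^+ k.+1) = K / 2 ^+ k by rewrite exprS invfM; field; rewrite expf_neq0.
have noninc : nonincreasing_seq w.
  apply/nonincreasing_seqP => k; rewrite /w e2.
  have := hv k; rewrite ler_norml => /andP[_ h]; have := p2 k; lra.
have lb k : v 0%N - 2 * K <= v k - 2 * (K / 2 ^+ k).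
  elim: k => [|k IH]; first by rewrite expr0 divr1.
  apply: (le_trans IH); rewrite e2.
  have := hv k; rewrite ler_norml => /andP[h _]; have := p2 k; lra.
have cw : cvgn w.
  apply: nonincreasing_is_cvgn => //; exists (v 0%N - 2 * K) => _ [k _ <-].
  by apply: (le_trans (lb k)); rewrite /w; have := p2 k; lra.
have c0 : 2 * (K / 2 ^+ k) @[k --> \oo] --> (0 : R).
  have := cvg_K2 (2 * K); apply: cvg_trans; apply: near_eq_cvg.
  by apply: nearW => k; rewrite mulrA.
have : (w k - 2 * (K / 2 ^+ k)) @[k --> \oo] --> limn w - 0 by apply: cvgB.
rewrite subr0 => c; apply/cvg_ex; exists (limn w).
by apply: cvg_trans c; apply: near_eq_cvg; apply: nearW => k; rewrite /w addrK.
Qed.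

(* Along a subsequence with increments [D k] of squared norm at most [8^-k],
   the sum [W] of [4^k |D k|^2] is integrable, and [|D k| <= (1 + W) / 2^k]. *)
Lemma sqint_complete (u : nat -> T -> C) : (forall k, sqint mu (u k)) ->
  (forall e : R, 0 < e -> exists N, forall m n, (N <= m)%N -> (N <= n)%N ->
     (sqnorm mu (fun x => u m x - u n x)%R <= e%:E)%E) ->
  exists2 h, sqint mu h & forall e : R, 0 < e ->
    \forall n \near \oo, (sqnorm mu (fun x => u n x - h x)%R <= e%:E)%E.
Proof.
move=> su cau.
have p8 k : (0 : R) < 8^-1 ^+ k by rewrite exprn_gt0// invr_gt0.
have [N hN] := choice (fun k => cau _ (p8 k)).
(* Summing the thresholds makes the subsequence monotone and keeps [m k] above [N k]. *)
pose m k := (\sum_(j < k.+1) N j)%N.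
have Nm k : (N k <= m k)%N by rewrite /m big_ord_recr/= leq_addl.
have mS k : (m k <= m k.+1)%N by rewrite /m [leqRHS]big_ord_recr/= leq_addr.
have mmono : {homo m : i j / (i <= j)%N} by apply: homo_leq => //; exact: leq_trans.
pose v k := u (m k).
have mv k : cmeas (v k) := (su (m k)).1.
pose D k x := v k.+1 x - v k x.
have mD k : cmeas (D k) by exact: cmeasB.
have nD k : (sqnorm mu (D k) <= (8^-1 ^+ k)%:E)%E.
  by apply: hN => //; exact: leq_trans (Nm k) (mS k).
pose wD k x := ((2 ^+ k) ^+ 2 * normc (D k x) ^+ 2)%:E.
have mwD k : measurable_fun setT (wD k).
  apply/measurable_EFinP; apply: measurable_funM; first exact: measurable_cst.
  by apply: measurable_funX; exact: measurable_normc.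
have wD0 k x : (0 <= wD k x)%E by rewrite lee_fin mulr_ge0 ?sqr_ge0.
pose W x := (\sum_(k <oo) wD k x)%E.
have mW : measurable_fun setT W.
  apply: (ge0_emeasurable_sum (P := xpredT)); first by move=> k x _ _; exact: wD0.
  by move=> k _; exact: mwD.
have W0 x : (0 <= W x)%E by apply: nneseries_ge0 => k _ _; exact: wD0.
have iW : (\int[mu]_x W x <= 2%:E)%E.
  rewrite /W integral_nneseries//.
  apply: lime_le.
    by apply: is_cvg_nneseries => k _ _; apply: integral_ge0 => x _; exact: wD0.
  apply: nearW => n.
  apply: (@le_trans _ _ (\sum_(0 <= k < n) ((2^-1) ^+ k)%:E)%E).
    apply: lee_sum => k _; rewrite (sqnorm_scale mu _ (mD k)).
    apply: (@le_trans _ _ (((2 ^+ k) ^+ 2)%:E * (8^-1 ^+ k)%:E)%E).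
      by apply: lee_wpmul2l (nD k); rewrite lee_fin sqr_ge0.
    rewrite -EFinM lee_fin -exprM mulnC exprM -exprMn.
    by rewrite (_ : 2 ^+ 2 / 8 = 2^-1 :> R)//; field.
  rewrite sumEFin lee_fin big_mkord.
  suff : \sum_(k < n) (2^-1 : R) ^+ k <= 2 - 2 * 2^-1 ^+ n.
    have : (0 : R) <= 2^-1 ^+ n by rewrite exprn_ge0.
    lra.
  elim: n => [|n IH]; first by rewrite big_ord0 expr0; lra.
  by rewrite big_ord_recr/= exprS; lra.
have aeW : {ae mu, forall x, (W x < +oo)%E}.
  have iW' : mu.-integrable setT W.
    apply/integrableP; split => //.
    under eq_integral do rewrite gee0_abs//.
    by apply: le_lt_trans iW _; exact: ltry.
  by apply: filterS (integrable_ae measurableT iW') => x /(_ I); rewrite fin_numElt => /andP[].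
(* Replacing the values by 0 on the null set where W is infinite gives a sequence that converges
   everywhere, so the limit is measurable. *)
pose w k x := if (W x < +oo)%E then v k x else 0.
have mw k : cmeas (w k).
  have mb : measurable_fun setT (fun x => (W x < +oo)%E) by apply: measurable_fun_lte.
  split.
    rewrite (_ : (fun x => _) = (fun x => if (W x < +oo)%E then Re (v k x) else 0)).
      by apply: measurable_fun_ifT => //; exact: (mv k).1.
    by apply/funext => x; rewrite /w; case: ifP.
  rewrite (_ : (fun x => _) = (fun x => if (W x < +oo)%E then Im (v k x) else 0)).
    by apply: measurable_fun_ifT => //; exact: (mv k).2.
  by apply/funext => x; rewrite /w; case: ifP.
have wv k : {ae mu, forall x, w k x = v k x} by apply: filterS aeW => x h; rewrite /w h.
have hw k x : normc (w k.+1 x - w k x) <= (1 + fine (W x)) / 2 ^+ k.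
  rewrite /w; case: ifPn => [Wx|_]; last first.
    by rewrite subr0 normc0 divr_ge0 ?exprn_ge0// addr_ge0// fine_ge0.
  have h1 : (((2 ^+ k) ^+ 2 * normc (D k x) ^+ 2)%:E <= W x)%E.
    apply: le_trans (nneseries_lim_ge k.+1 (fun n _ _ => wD0 n x)).
    by rewrite big_nat_recr//= leeDr// sume_ge0.
  have := h1; rewrite -{1}(fineK (_ : W x \is a fin_num)) ?ge0_fin_numE// lee_fin.
  have p2 : (0 : R) < 2 ^+ k by rewrite exprn_gt0.
  rewrite ler_pdivlMr// -/(D k x).
  have -> : 2 ^+ k ^+ 2 * normc (D k x) ^+ 2 = (normc (D k x) * 2 ^+ k) * (normc (D k x) * 2 ^+ k) by ring.
  have := fine_ge0 (W0 x); have : 0 <= normc (D k x) * 2 ^+ k.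
    by rewrite mulr_ge0 ?normc_ge0// ltW.
  move: (fine (W x)) (_ * 2 ^+ k) => b a; nra.
pose h x := limn (fun k => Re (w k x)) +i* limn (fun k => Im (w k x)).
have W1 x : 0 <= 1 + fine (W x) by rewrite addr_ge0// fine_ge0.
have wh x : normc (w k x - h x) @[k --> \oo] --> 0.
  have c1 : Re (w k x) @[k --> \oo] --> Re (h x).
    apply: (@geometric_cvg _ _ (W1 x)) => k; apply: le_trans (hw k x).
    by apply: le_trans (normr_Re_le _); rewrite !(ReD, ReN).
  have c2 : Im (w k x) @[k --> \oo] --> Im (h x).
    apply: (@geometric_cvg _ _ (W1 x)) => k; apply: le_trans (hw k x).
    by apply: le_trans (normr_Im_le _); rewrite !(ImD, ImN).
  apply: (@squeeze_cvgr _ _ _ _ (cst 0) (fun k => `|Re (w k x) - Re (h x)| + `|Im (w k x) - Im (h x)|)).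
  - apply: nearW => k; rewrite normc_ge0/=.
    by apply: (le_trans (normc_le_ReIm _)); rewrite !(ReD, ReN, ImD, ImN).
  - exact: cvg_cst.
  - rewrite -(addr0 0); apply: cvgD; apply/norm_cvg0P.
      by rewrite -(subrr (Re (h x))); apply: cvgB => //; exact: cvg_cst.
    by rewrite -(subrr (Im (h x))); apply: cvgB => //; exact: cvg_cst.
have mh : cmeas h := cmeas_cvg mw wh.
(* Fatou in j for u n - w j, with n fixed; this covers the whole sequence and not only the
   subsequence. *)
have key k n : (N k <= n)%N -> (sqnorm mu (fun x => u n x - h x)%R <= (8^-1 ^+ k)%:E)%E.
  move=> kn; apply: (@sqnorm_fatou _ _ _ mu (fun j x => u n x - w j x)).
  - by move=> j; apply: cmeasB => //; exact: (su n).1.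
  - move=> x; have := wh x; apply: cvg_trans; apply: near_eq_cvg; apply: nearW => j.
    by rewrite [in RHS]opprB [in RHS]addrC addrA subrK normcC.
  exists k => // j /= kj.
  rewrite (@ae_eq_sqnorm _ _ _ mu _ (fun x => u n x - v j x)).
  - by apply: hN => //; apply: leq_trans (Nm k) _; exact: mmono.
  - by apply: cmeasB => //; exact: (su n).1.
  - by apply: cmeasB => //; exact: (su n).1.
  - by apply: filterS (wv j) => x ->.
exists h.
  split => //.
  apply: le_lt_trans (_ : (_ <= 2%:E * sqnorm mu (u (N 0%N)) + 2%:E * sqnorm mu (fun x => u (N 0%N) x - h x)%R)%E) _.
    rewrite (@eq_sqnorm _ _ _ mu h (fun x => u (N 0%N) x - (u (N 0%N) x - h x))).
      apply: sqnormB_le; first exact: (su _).1.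
      by apply: cmeasB => //; exact: (su _).1.
    by move=> x; rewrite opprB addrC subrK.
  have := key 0%N _ (leqnn _).
  have := sqint_fin (su (N 0%N)) => ->.
  have := sqnorm_ge0 mu (fun x => u (N 0%N) x - h x).
  case: (sqnorm mu (fun x => u (N 0%N) x - h x)) => // r _ _.
  by rewrite -!EFinM -EFinD ltry.
move=> e e0.
have [k hk] : exists k : nat, (8^-1 : R) ^+ k <= e.
  have h8 : `|8^-1 : R| < 1 by rewrite ger0_norm; lra.
  have /cvgrPdist_le/(_ _ e0) [k _ /(_ k (leqnn _))] := cvg_expr h8.
  by rewrite sub0r normrN ger0_norm ?exprn_ge0// => hk; exists k.
exists (N k) => // n /= kn; apply: (le_trans (key k n kn)).
by rewrite lee_fin.
Qed.
End Completeness.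

(** * Comparison with the norms of the statement *)

Section LebesgueNorms.
Context {R : realType}.
Local Notation C := R[i].
Local Notation mu := (@lebesgue_measure R).
Implicit Types (u : R -> C).

Lemma norm2E u : norm2 u = ((sqnorm mu u) `^ 2^-1)%E.
Proof.
rewrite /norm2 unlock /=; congr (_ `^ _)%E; apply: eq_integral => x _.
by rewrite ger0_norm ?normc_ge0// powR_mulrn ?normc_ge0.
Qed.

Lemma inL2P u : inL2 u <-> sqint mu u.
Proof.
rewrite /inL2 /sqint norm2E; split => -[mu_ nu]; split => //.
  exact: lty_poweRy nu.
exact: poweR_lty.
Qed.

Lemma norm2_lt u (e : R) : 0 < e ->
  (norm2 u < e%:E)%E <-> (sqnorm mu u < (e ^+ 2)%:E)%E.
Proof.
move=> e0; rewrite norm2E; have := sqnorm_ge0 mu u.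
case: (sqnorm mu u) => [r| |] //= r0; last first.
  by rewrite invr_eq0 pnatr_eq0/=; split => // /ltW; rewrite leye_eq.
rewrite !lte_fin powR12_sqrt//.
rewrite -[in X in X <-> _](@ltr_pXn2r _ 2%N)// ?nnegrE ?sqrtr_ge0 ?(ltW e0)//.
by rewrite sqr_sqrtr.
Qed.

Lemma inL1P u : inL1 u <-> cmeas u /\ cinteg mu setT u.
Proof.
have e : norm1 u = (\int[mu]_x `|(normc (u x))%:E|)%E by rewrite /norm1 Lnorm1.
rewrite /inL1 e; split => -[mu_].
  move=> nu; split; first exact: mu_; apply: (@cinteg_leT _ _ R mu u (fun x => normc (u x)) mu_) => //.
  by apply/integrableP; split => //; apply/measurable_EFinP; exact: measurable_normc.
by move=> iu; split; first exact: mu_; have /integrableP[] := cinteg_normc measurableT iu.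
Qed.

End LebesgueNorms.

(** * Hermite functions *)

Section Hermite.
Context {R : realType}.
Local Notation C := R[i].
Local Notation Re := (@complex.Re R).
Local Notation Im := (@complex.Im R).
Local Notation mu := (@lebesgue_measure R).

(* Orthogonal for the weight [exp(-2x^2)], hence [4] in place of the usual [2]. *)
Fixpoint hermite (n : nat) (x : R) : C :=
  match n with
  | 0 => 1
  | m.+1 => 4 * x%:C * hermite m x - 4 * m%:R * (if m is k.+1 then hermite k x else 0)
  end.

Lemma hermiteS n x : hermite n.+1 x = 4 * x%:C * hermite n x - 4 * n%:R * hermite n.-1 x.
Proof. by case: n => //=; rewrite !(mulr0, mul0r). Qed.

Lemma hermite_Im n x : Im (hermite n x) = 0.
Proof.
elim/ltn_ind: n => -[|n] IH; first by [].
rewrite hermiteS !ReImE (IH n)// (IH n.-1) ?ltnS ?leq_pred//=.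
by rewrite !(mulr0, mul0r, addr0, subr0).
Qed.

Lemma rderiv_hermite n : rderiv (hermite n) (fun x => 4 * n%:R * hermite n.-1 x).
Proof.
elim/ltn_ind: n => -[|n] IH.
  by apply: rderiv_eq (@rderiv_cst R 1) => // x; rewrite mulr0 mul0r.
apply: rderiv_eq (rderivD (rderivM (rderivZ 4 (@rderiv_id R)) (IH n _))
    (rderivZ (- (4 * n%:R)) (IH n.-1 _))) => //.
- by move=> x; rewrite hermiteS mulNr.
- move=> x; case: n {IH} => [|n] /=; first by rewrite /=; ring.
  rewrite -/(hermite n.+1 x) hermiteS -!natr1; ring.
- by rewrite ltnS leq_pred.
Qed.

Lemma subgauss_hermite n : subgauss (hermite n).
Proof.
elim/ltn_ind: n => -[|n] IH; first exact: subgauss_cst.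
rewrite (_ : hermite n.+1 = fun x => 4 * x%:C * hermite n x + (- (4 * n%:R)) * hermite n.-1 x).
  apply: subgaussD; apply: subgaussM.
  - by apply: subgaussM; [exact: subgauss_cst|exact: subgauss_id].
  - exact: IH.
  - exact: subgauss_cst.
  - by apply: IH; rewrite ltnS leq_pred.
by apply/funext => x; rewrite hermiteS mulNr.
Qed.

Lemma rcont_hermite n : rcont (hermite n).
Proof. exact: rderiv_rcont (rderiv_hermite n). Qed.

Let two_gt0 : 0 < Re (2 : C).
Proof. by rewrite Re_nat. Qed.

(** The recurrence says that the derivative of hermite n times exp(-2x^2) is minus hermite (n+1)
    times exp(-2x^2). Integration by parts moves that derivative onto Q(x) exp(bx), which produces
    Q' + bQ. *)
Lemma hermite_ibp n b (Q Q' : R -> C) : rderiv Q Q' -> rcont Q' ->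
  subgauss Q -> subgauss Q' ->
  cint mu setT (fun x => hermite n.+1 x * Q x * gk 2 b x) =
  cint mu setT (fun x => hermite n x * (Q' x + b * Q x) * gk 2 b x).
Proof.
move=> dQ cQ' sQ sQ'.
have cQ : rcont Q := rderiv_rcont dQ.
have sb : subgauss (fun x => Q' x + b * Q x).
  by apply: subgaussD => //; apply: subgaussM => //; exact: subgauss_cst.
have cb : rcont (fun x => Q' x + b * Q x).
  by apply: rcontD => //; apply: rcontM => //; exact: rcont_cst.
have cH' : rcont (fun x => 4 * n%:R * hermite n.-1 x).
  by apply: rcontM; [exact: rcont_cst|exact: rcont_hermite].
have sH' : subgauss (fun x => 4 * n%:R * hermite n.-1 x).
  by apply: subgaussM; [exact: subgauss_cst|exact: subgauss_hermite].
have cP' : rcont (fun x => 4 * n%:R * hermite n.-1 x * Q x + hermite n x * Q' x).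
  by apply: rcontD; apply: rcontM => //; exact: rcont_hermite.
have sP' : subgauss (fun x => 4 * n%:R * hermite n.-1 x * Q x + hermite n x * Q' x).
  by apply: subgaussD; apply: subgaussM => //; exact: subgauss_hermite.
have := gk_ibp b two_gt0 (rderivM (rderiv_hermite n) dQ) cP'
  (subgaussM (subgauss_hermite n) sQ) sP'.
set J := cint _ _ _.
have -> : J = cint mu setT (fun x => hermite n x * (Q' x + b * Q x) * gk 2 b x -
    hermite n.+1 x * Q x * gk 2 b x).
  by apply: eq_cint => x _; rewrite hermiteS; ring.
rewrite cintB//.
- by move=> /eqP; rewrite subr_eq0 => /eqP.
- apply: gk_integ => //; first by apply: rcontM => //; exact: rcont_hermite.
  by apply: subgaussM => //; exact: subgauss_hermite.
- apply: gk_integ => //; first by apply: rcontM => //; exact: rcont_hermite.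
  by apply: subgaussM => //; exact: subgauss_hermite.
Qed.

Definition gauss2 : C := cint mu setT (gk 2 0).

(** Each integration by parts lowers both indices and yields a factor 4(m + 1), until one index is
    0; then the derivative of a constant appears. *)
Lemma hermite_orth n m : cint mu setT (fun x => hermite n x * hermite m x * gk 2 0 x) =
  if n == m then 4 ^+ n * n`!%:R * gauss2 else 0.
Proof.
elim: n m => [|n IH] [|m].
- rewrite eqxx expr0 fact0 !mul1r /gauss2; apply: eq_cint => x _.
  by rewrite /= !mul1r.
- transitivity (cint mu setT (fun x => hermite m.+1 x * 1 * gk 2 0 x)).
    by apply: eq_cint => x _; rewrite [hermite 0 x]/= mul1r mulr1.
  rewrite (hermite_ibp m 0 (@rderiv_cst R 1) (@rcont_cst R 0) (@subgauss_cst R 1) (@subgauss_cst R 0)).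
  transitivity (0 * cint mu setT (gk 2 0)); last by rewrite mul0r.
  rewrite -cintZ//; last exact: gk_integ1.
  by apply: eq_cint => x _; ring.
- transitivity (cint mu setT (fun x => hermite n.+1 x * 1 * gk 2 0 x)).
    by apply: eq_cint.
  rewrite (hermite_ibp n 0 (@rderiv_cst R 1) (@rcont_cst R 0) (@subgauss_cst R 1) (@subgauss_cst R 0)).
  transitivity (0 * cint mu setT (gk 2 0)); last by rewrite mul0r.
  rewrite -cintZ//; last exact: gk_integ1.
  by apply: eq_cint => x _; ring.
have cH' : rcont (fun x => 4 * m.+1%:R * hermite m x).
  by apply: rcontM; [exact: rcont_cst|exact: rcont_hermite].
have sH' : subgauss (fun x => 4 * m.+1%:R * hermite m x).
  by apply: subgaussM; [exact: subgauss_cst|exact: subgauss_hermite].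
rewrite (hermite_ibp n 0 (rderiv_hermite m.+1) cH' (subgauss_hermite m.+1) sH').
transitivity (4 * m.+1%:R * cint mu setT (fun x => hermite n x * hermite m x * gk 2 0 x)).
  rewrite -cintZ//; first by apply: eq_cint => x _; rewrite [m.+1.-1]/=; ring.
  apply: gk_integ => //; first by apply: rcontM; exact: rcont_hermite.
  by apply: subgaussM; exact: subgauss_hermite.
rewrite IH eqSS; case: eqP => [->|_]; last by rewrite mulr0.
by rewrite factS natrM exprS; ring.
Qed.

Lemma hermite_gauss n b : cint mu setT (fun x => hermite n x * gk 2 b x) =
  b ^+ n * cint mu setT (gk 2 b).
Proof.
elim: n => [|n IH].
  by rewrite expr0 mul1r; apply: eq_cint => x _; rewrite /= mul1r.
rewrite exprS -mulrA -IH -cintZ//; last first.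
  by apply: gk_integ => //; [exact: rcont_hermite|exact: subgauss_hermite].
transitivity (cint mu setT (fun x => hermite n.+1 x * 1 * gk 2 b x)).
  by apply: eq_cint => x _; rewrite mulr1.
rewrite (hermite_ibp n b (@rderiv_cst R 1) (@rcont_cst R 0) (@subgauss_cst R 1) (@subgauss_cst R 0)).
by apply: eq_cint => x _; ring.
Qed.

End Hermite.

(** * Normalized Hermite functions and Bessel's identity *)

Section HermiteBasis.
Context {R : realType}.
Local Notation C := R[i].
Local Notation Re := (@complex.Re R).
Local Notation Im := (@complex.Im R).
Local Notation mu := (@lebesgue_measure R).
Implicit Types (h r u : R -> C).

Definition bconst : R := (2 / pi) `^ 4^-1.

Lemma bconst_gt0 : 0 < bconst.
Proof. by apply: powR_gt0; rewrite divr_gt0 ?pi_gt0. Qed.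

Lemma bconst_sqr : bconst ^+ 2 * Num.sqrt (pi / 2) = 1.
Proof.
have p0 : (0 : R) < pi := pi_gt0 R.
have -> : bconst ^+ 2 = Num.sqrt (2 / pi).
  rewrite -powR12_sqrt; last by rewrite divr_ge0 ?ltW.
  rewrite -powR_mulrn ?powR_ge0// /bconst -powRrM; congr (_ `^ _); lra.
rewrite -sqrtrM ?divr_ge0 ?ltW//.
by rewrite mulrA divfK ?gt_eqF// divff ?sqrtr1.
Qed.

Lemma gauss2E : gauss2 = (Num.sqrt (pi / 2))%:C :> C.
Proof.
have t0 : 0 < Re (2 : C) by rewrite Re_nat.
rewrite /gauss2 gauss_val// sqrtc_sqrtr ?ler0n// Re_nat.
rewrite sqrtrM ?ltW ?pi_gt0// sqrtrV//.
by rewrite rmorphM/= fmorphV.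
Qed.

Lemma gkM (a b a' b' : C) (x : R) : gk a b x * gk a' b' x = gk (a + a') (b + b') x.
Proof. by rewrite /gk -cexpD; congr cexp; ring. Qed.

Lemma gk2 (x : R) : gk 2 0 x = gk 1 0 x * gk 1 0 x.
Proof. by rewrite gkM addr0. Qed.

(** Chosen for norm 1: the squared norm of hermite n times exp(-x^2) is 4^n n! sqrt(pi/2), and
    bconst^2 sqrt(pi/2) = 1. *)
Definition hnorm n : R := bconst / (2 ^+ n * Num.sqrt n`!%:R).

Definition hermite_fun n (x : R) : C := (hnorm n)%:C * hermite n x * gk 1 0 x.

Lemma sqrt_fact_gt0 n : 0 < Num.sqrt (n`!%:R : R).
Proof. by rewrite sqrtr_gt0 ltr0n fact_gt0. Qed.

Lemma subgauss_Zhermite (c : C) n : subgauss (fun x => c * hermite n x).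
Proof. by apply: subgaussM; [exact: subgauss_cst|exact: subgauss_hermite]. Qed.

Lemma rcont_Zhermite (c : C) n : rcont (fun x => c * hermite n x).
Proof. by apply: rcontM; [exact: rcont_cst|exact: rcont_hermite]. Qed.

Lemma hermite_fun_Im n x : Im (hermite_fun n x) = 0.
Proof.
have g : Im (gk 1 0 x) = 0 by have := gk_real 1 x; rewrite (rmorph1 (@real_complex R)) => ->.
by rewrite /hermite_fun (ImM _ (gk 1 0 x)) g Im_scale hermite_Im !(mulr0, mul0r, addr0).
Qed.

Lemma cint_hermite_fun n m : cint mu setT (fun x => hermite_fun n x * hermite_fun m x) =
  (n == m)%:R.
Proof.
transitivity ((hnorm n)%:C * (hnorm m)%:C *
    cint mu setT (fun x => hermite n x * hermite m x * gk 2 0 x)).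
  rewrite -cintZ//.
    apply: eq_cint => x _; rewrite /hermite_fun.
    by rewrite gk2; ring.
  apply: gk_integ; first by rewrite Re_nat.
    by apply: rcontM; exact: rcont_hermite.
  by apply: subgaussM; exact: subgauss_hermite.
rewrite hermite_orth; case: eqP => [<-|_]; last by rewrite mulr0.
rewrite gauss2E (_ : 4 ^+ n * n`!%:R = (4 ^+ n * n`!%:R)%:C); last first.
  by rewrite rmorphM/= rmorphXn/= !rmorph_nat.
rewrite -!rmorphM -[RHS](rmorph1 (@real_complex R)); congr (_%:C).
rewrite -[RHS]bconst_sqr /hnorm.
have s0 := sqrt_fact_gt0 n; have s2 := sqr_sqrtr (ler0n R n`!).
have p2 : (2 : R) ^+ n != 0 by rewrite expf_neq0.
have -> : (4 : R) ^+ n = 2 ^+ n * 2 ^+ n by rewrite -exprMn; congr (_ ^+ _); ring.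
rewrite -{3}s2; field.
by rewrite p2 gt_eqF.
Qed.

Lemma cmeas_hermite_fun n : cmeas (hermite_fun n).
Proof. by apply: rcont_meas; apply: rcontM; [exact: rcont_Zhermite|exact: rcont_gk]. Qed.

Lemma sqint_of_cinteg u : cmeas u -> cinteg mu setT (fun x => u x * u x) -> sqint mu u.
Proof.
move=> mu_ iu; split => //.
have := integrable_lty measurableT (cinteg_normc measurableT iu).
rewrite /sqnorm; under eq_integral do rewrite (normcM (u _)) -expr2.
by [].
Qed.

Lemma sqint_hermite_fun n : sqint mu (hermite_fun n).
Proof.
apply: sqint_of_cinteg; first exact: cmeas_hermite_fun.
apply: (@eq_cinteg _ _ R mu setT (fun x : R => ((hnorm n)%:C * hermite n x) * ((hnorm n)%:C * hermite n x) * gk 2 0 x)) => //.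
  move=> x _; rewrite /hermite_fun.
  by rewrite gk2; ring.
apply: gk_integ; first by rewrite Re_nat.
  by apply: rcontM; exact: rcont_Zhermite.
by apply: subgaussM; exact: subgauss_Zhermite.
Qed.

(** The real value of [sqnorm], for square integrable functions, so that norms can be subtracted. *)
Definition rsqnorm u : R := \int[mu]_x (normc (u x) ^+ 2).

(** Expansion of |r - b psi|^2. As [psi] is real, its inner product with [r] involves no
    conjugation, and the only conjugate left is that of [b]. *)
Lemma rsqnormB r psi (b : C) : sqint mu r -> sqint mu psi -> (forall x, Im (psi x) = 0) ->
  cint mu setT (fun x => psi x * psi x) = 1 ->
  rsqnorm (fun x => r x - b * psi x) = rsqnorm r -
    2 * Re ((Re b -i* Im b) * cint mu setT (fun x => r x * psi x)) + normc b ^+ 2.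
Proof.
move=> sr sp psi0 psi1.
have i1 := sqintM_integ sr sp; have i2 := sqintM_integ sp sp.
pose v x := - 2 * (Re b -i* Im b) * (r x * psi x) + (normc b ^+ 2)%:C * (psi x * psi x).
have iv : cinteg mu setT v by apply: cintegD => //; exact: cintegZ.
have cv : cint mu setT v = - 2 * (Re b -i* Im b) * cint mu setT (fun x => r x * psi x) +
    (normc b ^+ 2)%:C.
  rewrite /v cintD//; [|exact: cintegZ..].
  by rewrite !cintZ// psi1 mulr1.
transitivity (\int[mu]_x (normc (r x) ^+ 2 + Re (v x))).
  apply: eq_Rintegral => x _; rewrite /v !normc_sqr.
  rewrite !(ReD, ImD, ReN, ImN, ReM, ImM, Re_nat, Im_nat) psi0 /=; ring.
rewrite RintegralD//; [|exact: sqint_integrable|exact: iv.1].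
rewrite -/(rsqnorm r) (_ : \int[mu]_x Re (v x) = Re (cint mu setT v))// cv ReD.
rewrite -[Re (_ ^+ 2)%:C]/(normc b ^+ 2) addrA; congr (_ + _ + _).
rewrite -mulrA; move: (_ * cint _ _ _) => w.
by rewrite mulNr ReN (ReM 2) Re_nat Im_nat mul0r subr0.
Qed.

Definition synth (a : nat -> C) N x : C := \sum_(n < N) a n * hermite_fun n x.

Lemma synthS a N x : synth a N.+1 x = synth a N x + a N * hermite_fun N x.
Proof. by rewrite /synth big_ord_recr. Qed.

Lemma sqint_synth a N : sqint mu (synth a N).
Proof.
elim: N => [|N IH].
  have := sqintZ 0 (sqint_hermite_fun 0).
  by congr (sqint mu _); apply/funext => x; rewrite /synth big_ord0 mul0r.
have := sqintD IH (sqintZ (a N) (sqint_hermite_fun N)).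
by congr (sqint mu _); apply/funext => x; rewrite synthS.
Qed.

Lemma cint_synth a N u : sqint mu u ->
  cint mu setT (fun x => synth a N x * u x) =
  \sum_(n < N) a n * cint mu setT (fun x => hermite_fun n x * u x).
Proof.
move=> su.
have i n : cinteg mu setT (fun x => a n * (hermite_fun n x * u x)).
  by apply: cintegZ => //; apply: sqintM_integ => //; exact: sqint_hermite_fun.
transitivity (cint mu setT (fun x => \sum_(n < N) a n * (hermite_fun n x * u x))).
  apply: eq_cint => x _; rewrite /synth mulr_suml; apply: eq_bigr => n _.
  by rewrite mulrA.
rewrite (cint_sum N measurableT i); apply: eq_bigr => n _.
by rewrite cintZ//; apply: sqintM_integ => //; exact: sqint_hermite_fun.
Qed.

Lemma cint_synth_hermite a N m : cint mu setT (fun x => synth a N x * hermite_fun m x) =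
  if (m < N)%N then a m else 0.
Proof.
rewrite cint_synth; last exact: sqint_hermite_fun.
under eq_bigr do rewrite cint_hermite_fun.
case: ifPn => mN.
  rewrite (bigD1 (Ordinal mN))//= eqxx mulr1 big1 ?addr0// => i im.
  by rewrite -val_eqE/= in im; rewrite (negbTE im) mulr0.
rewrite big1// => i _; case: eqP => [im|]; last by rewrite mulr0.
by rewrite -im ltn_ord in mN.
Qed.

Lemma rsqnorm_synth a N : rsqnorm (synth a N) = \sum_(n < N) normc (a n) ^+ 2.
Proof.
elim: N => [|N IH].
  rewrite big_ord0 /rsqnorm; under eq_Rintegral do rewrite /synth big_ord0 normc0 expr0n/=.
  by rewrite /Rintegral integral0.
rewrite big_ord_recr/= -IH.
have -> : rsqnorm (synth a N.+1) = rsqnorm (fun x => synth a N x - (- a N) * hermite_fun N x).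
  by apply: eq_Rintegral => x _; rewrite synthS mulNr opprK.
rewrite rsqnormB; [|exact: sqint_synth|exact: sqint_hermite_fun|exact: hermite_fun_Im|]; last first.
  by rewrite cint_hermite_fun eqxx.
by rewrite cint_synth_hermite ltnn mulr0 [Re 0]/= mulr0 subr0 normcN.
Qed.

(** The inner product with [hermite_fun n], which is real valued, whence the absence of a
    conjugate. *)
Definition hcoef h n : C := cint mu setT (fun x => h x * hermite_fun n x).

(** Kept as an equality: for the Bargmann kernel the right side is computed explicitly and shown to
    tend to 0. *)
Lemma bessel h N : sqint mu h ->
  rsqnorm (fun x => h x - synth (hcoef h) N x) =
  rsqnorm h - \sum_(n < N) normc (hcoef h n) ^+ 2.
Proof.
move=> sh; elim: N => [|N IH].
  rewrite big_ord0 subr0; apply: eq_Rintegral => x _.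
  by rewrite /synth big_ord0 subr0.
rewrite big_ord_recr/= opprD addrA -IH.
have -> : rsqnorm (fun x => h x - synth (hcoef h) N.+1 x) =
    rsqnorm (fun x => (h x - synth (hcoef h) N x) - hcoef h N * hermite_fun N x).
  by apply: eq_Rintegral => x _; rewrite synthS opprD addrA.
rewrite rsqnormB; [| |exact: sqint_hermite_fun|exact: hermite_fun_Im|]; last 2 first.
- by apply: sqintB => //; exact: sqint_synth.
- by rewrite cint_hermite_fun eqxx.
have -> : cint mu setT (fun x => (h x - synth (hcoef h) N x) * hermite_fun N x) = hcoef h N.
  transitivity (cint mu setT (fun x => h x * hermite_fun N x - synth (hcoef h) N x * hermite_fun N x)).
    by apply: eq_cint => x _; rewrite mulrBl.
  have sN := sqint_hermite_fun N; have ss := sqint_synth (hcoef h) N.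
  rewrite cintB//; [|exact: sqintM_integ..].
  by rewrite cint_synth_hermite ltnn subr0.
rewrite normc_sqr ReM/=; ring.
Qed.

End HermiteBasis.

(** * The Bargmann transform on L^2 *)

Section BargmannExpansion.
Context {R : realType}.
Local Notation C := R[i].
Local Notation Re := (@complex.Re R).
Local Notation Im := (@complex.Im R).
Local Notation mu := (@lebesgue_measure R).
Implicit Types (h u : R -> C) (z : C).

(** Companion of [normc_cintM_le]: a small [t] makes the first term small, and then [delta n / t]
    tends to 0. It gives continuity of the pairing in one argument. *)
Lemma cvg0_weighted (F delta : R^nat) (A : R) : 0 <= A ->
  delta n @[n --> \oo] --> (0 : R) -> (forall n, 0 <= F n) ->
  (forall n t, 0 < t -> F n <= t * A + delta n / t) -> F n @[n --> \oo] --> (0 : R).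
Proof.
move=> A0 d0 F0 hF; apply/cvgrPdist_le => e e0.
have A1 : 0 < A + 1 by rewrite ltr_wpDl.
pose t := e / (2 * (A + 1)).
have t0 : 0 < t by rewrite divr_gt0// mulr_gt0.
have te : 0 < t * (e / 2) by rewrite mulr_gt0// divr_gt0.
have /cvgrPdist_le/(_ _ te) := d0.
apply: filterS => n; rewrite !sub0r !normrN => hd.
rewrite ger0_norm//; apply: (le_trans (hF n t t0)).
have h1 : t * A <= e / 2.
  rewrite /t mulrAC ler_pdivrMr ?mulr_gt0//; nra.
have h2 : delta n / t <= e / 2.
  rewrite ler_pdivrMr// mulrC; apply: le_trans hd; exact: ler_norm.
lra.
Qed.

Definition bkern z (x : R) : C :=
  bconst%:C * cexp (2 * x%:C * z - x%:C ^+ 2 - z ^+ 2 / 2).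

Lemma bkernE z x : bkern z x = bconst%:C * cexp (- (z ^+ 2 / 2)) * gk 1 (2 * z) x.
Proof.
rewrite /bkern /gk -(mulrA bconst%:C) -cexpD; congr (_ * cexp _); ring.
Qed.

Lemma cmeas_bkern z : cmeas (bkern z).
Proof.
have -> : bkern z = fun x => bconst%:C * cexp (- (z ^+ 2 / 2)) * gk 1 (2 * z) x.
  by apply/funext => x; exact: bkernE.
by apply: rcont_meas; apply: rcontM; [exact: rcont_cst|exact: rcont_gk].
Qed.

Lemma normc_bkern_sqr z x : normc (bkern z x) ^+ 2 =
  (bconst ^+ 2 * expR (normc z ^+ 2)) * expR (- (2 * (x - Re z) ^+ 2)).
Proof.
rewrite /bkern (normcM bconst%:C) (exprMn 2 (normc bconst%:C)).
rewrite (normc_real bconst) (ger0_norm (ltW (bconst_gt0))) normc_cexp.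
rewrite -[RHS]mulrA -expRD.
rewrite (expr2 (expR _)) -expRD; congr (_ * expR _).
rewrite normc_sqr.
have -> : z ^+ 2 / 2 = (2^-1)%:C * z ^+ 2 by rewrite fmorphV/= rmorph_nat mulrC.
have -> : 2 * x%:C * z = (2 * x)%:C * z by rewrite rmorphM/= rmorph_nat.
have -> : x%:C ^+ 2 = (x * x)%:C * 1 :> C by rewrite mulr1 rmorphM/= expr2.
rewrite !(ReD, ReN) !Re_scale (Re_nat 1) (ReM z z).
by move: (Re z) (Im z) => a b; field.
Qed.

(** The value on the diagonal of the reproducing kernel of the Fock space. *)
Lemma sqnorm_bkern z : sqnorm mu (bkern z) = (expR (normc z ^+ 2))%:E.
Proof.
have [ig eg] := gaussian_integral (Re z) (ltr0Sn R 1).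
rewrite /sqnorm; under eq_integral do rewrite normc_bkern_sqr EFinM.
rewrite ge0_integralZl_EFin//; last 2 first.
- exact: measurable_int ig.
- exact: mulr_ge0 (sqr_ge0 _) (expR_ge0 _).
by rewrite eg -EFinM mulrAC bconst_sqr mul1r.
Qed.

Lemma sqint_bkern z : sqint mu (bkern z).
Proof. by split; [exact: cmeas_bkern|rewrite sqnorm_bkern ltry]. Qed.

Lemma bargmannE h z : sqint mu h -> bargmann h z = cint mu setT (fun x => h x * bkern z x).
Proof.
move=> sh; have b0 : bconst%:C != 0 :> C.
  by rewrite -normc_gt0 normc_real gtr0_norm ?bconst_gt0.
have i := cintegZ bconst%:C^-1 measurableT (sqintM_integ sh (sqint_bkern z)).
have e x : h x * cexp (2 * x%:C * z - x%:C ^+ 2 - z ^+ 2 / 2) = bconst%:C^-1 * (h x * bkern z x).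
  by rewrite [RHS]mulrCA /bkern (mulKf b0).
rewrite /bargmann -[cintegral _]/(cint mu setT _).
have -> : cint mu setT (fun x => h x * cexp (2 * x%:C * z - x%:C ^+ 2 - z ^+ 2 / 2)) =
    cint mu setT (fun x => bconst%:C^-1 * (h x * bkern z x)).
  by apply: eq_cint => x _; exact: e.
by rewrite cintZ ?mulVKf//; exact: sqintM_integ sh (sqint_bkern z).
Qed.

(** The normalized monomials of the Fock space, which are the transforms of the Hermite functions
    and also the Hermite coefficients of the kernel. *)
Definition nmono z n : C := z ^+ n / (Num.sqrt n`!%:R)%:C.

Lemma cint_hermite_bkern n z : cint mu setT (fun x => hermite_fun n x * bkern z x) = nmono z n.
Proof.
have t0 : 0 < Re (2 : C) by rewrite Re_nat.
transitivity ((hnorm n)%:C * bconst%:C * cexp (- (z ^+ 2 / 2)) *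
    cint mu setT (fun x => hermite n x * gk 2 (2 * z) x)).
  rewrite -cintZ//.
    apply: eq_cint => x _; rewrite bkernE /hermite_fun.
    have -> : gk 2 (2 * z) x = gk 1 0 x * gk 1 (2 * z) x by rewrite gkM add0r.
    ring.
  by apply: gk_integ => //; [exact: rcont_hermite|exact: subgauss_hermite].
rewrite hermite_gauss gk_shift// -/gauss2 gauss2E.
have e1 : cexp (- (z ^+ 2 / 2)) * cexp ((2 * z) ^+ 2 / (4 * 2)) = 1.
  by rewrite -cexpD (_ : _ + _ = 0) ?cexp0//; field.
rewrite /nmono exprMn.
transitivity ((hnorm n)%:C * bconst%:C * (2 ^+ n * z ^+ n) * (cexp (- (z ^+ 2 / 2)) * cexp ((2 * z) ^+ 2 / (4 * 2))) * (Num.sqrt (pi / 2))%:C).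
  ring.
rewrite e1 mulr1.
transitivity ((hnorm n * bconst * 2 ^+ n * Num.sqrt (pi / 2))%:C * z ^+ n).
  by rewrite !rmorphM/= rmorphXn/= rmorph_nat; ring.
rewrite mulrC; congr (_ * _); rewrite -fmorphV; congr (_%:C).
have s0 : 0 < Num.sqrt (n`!%:R : R) := sqrt_fact_gt0 n; have p2 : (2 : R) ^+ n != 0 by rewrite expf_neq0.
transitivity ((Num.sqrt n`!%:R)^-1 * (bconst ^+ 2 * Num.sqrt (pi / 2) : R)); last first.
  by rewrite bconst_sqr mulr1.
rewrite /hnorm; move: (Num.sqrt (pi / 2)) => q; field.
by rewrite p2 gt_eqF.
Qed.

Lemma hcoef_bkern z n : hcoef (bkern z) n = nmono z n.
Proof. by rewrite -cint_hermite_bkern; apply: eq_cint => x _; rewrite mulrC. Qed.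

Lemma normc_nmono z n : normc (nmono z n) ^+ 2 = exp_coeff (normc z ^+ 2) n.
Proof.
have s0 : 0 < Num.sqrt (n`!%:R : R) := sqrt_fact_gt0 n.
rewrite /nmono (normcM (z ^+ n)) (exprMn 2 (normc _)) normcX.
rewrite -fmorphV normc_real ger0_norm ?invr_ge0 ?ltW// exprVn sqr_sqrtr ?ler0n//.
by rewrite /exp_coeff/= -!exprM mulnC.
Qed.

(** The squared Hermite coefficients of the kernel are the terms of the exponential series at |z|^2,
    whose sum is its squared norm; Bessel's identity then leaves a tail tending to 0. *)
Lemma bkern_tail_cvg z :
  rsqnorm (fun x => bkern z x - synth (nmono z) N x) @[N --> \oo] --> (0 : R).
Proof.
have -> : (fun N => rsqnorm (fun x => bkern z x - synth (nmono z) N x)) =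
    (fun N => expR (normc z ^+ 2) - series (exp_coeff (normc z ^+ 2)) N).
  apply/funext => N.
  have := bessel N (sqint_bkern z).
  have -> : rsqnorm (bkern z) = expR (normc z ^+ 2).
    by have := sqint_fin (sqint_bkern z); rewrite sqnorm_bkern => -[].
  have -> : hcoef (bkern z) = nmono z by apply/funext => n; exact: hcoef_bkern.
  move=> ->; congr (_ - _); rewrite seriesEord.
  by apply: eq_bigr => n _; exact: normc_nmono.
rewrite -(subrr (expR (normc z ^+ 2))); apply: cvgB; first exact: cvg_cst.
exact: is_cvg_series_exp_coeff.
Qed.

Lemma sqnorm_rsqnorm u : sqint mu u -> sqnorm mu u = (rsqnorm u)%:E.
Proof. exact: sqint_fin. Qed.

(** The error is the pairing of [h] with the tail of the Hermite expansion of the kernel. *)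
Lemma bargmann_expansion h z : sqint mu h ->
  normc (\sum_(n < N) hcoef h n * nmono z n - bargmann h z) @[N --> \oo] --> 0.
Proof.
move=> sh.
have rh0 : 0 <= rsqnorm h by apply: Rintegral_ge0 => x _; exact: sqr_ge0.
apply: (cvg0_weighted rh0 (bkern_tail_cvg z)) => [N|N t t0]; first exact: normc_ge0.
have ss := sqint_synth (nmono z) N.
have sd : sqint mu (fun x => bkern z x - synth (nmono z) N x).
  by apply: sqintB => //; exact: sqint_bkern.
have := normc_cintM_le sh sd t0 _ _; rewrite !sqnorm_rsqnorm// => /(_ _ _ (lexx _) (lexx _)).
apply: le_trans; rewrite le_eqVlt normcC; apply/orP; left; apply/eqP; congr normc.
rewrite bargmannE//.
have -> : \sum_(n < N) hcoef h n * nmono z n = cint mu setT (fun x => h x * synth (nmono z) N x).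
  transitivity (cint mu setT (fun x => synth (nmono z) N x * h x)).
    rewrite cint_synth//; apply: eq_bigr => n _; rewrite mulrC; congr (_ * _).
    by apply: eq_cint => x _; rewrite mulrC.
  by apply: eq_cint => x _; rewrite mulrC.
rewrite -cintB//; first by apply: eq_cint => x _; rewrite mulrBr.
  by apply: sqintM_integ => //; exact: sqint_bkern.
exact: sqintM_integ.
Qed.

Lemma bessel_le h N : sqint mu h -> \sum_(n < N) normc (hcoef h n) ^+ 2 <= rsqnorm h.
Proof.
move=> sh; rewrite -subr_ge0 -bessel//.
by apply: Rintegral_ge0 => x _; exact: sqr_ge0.
Qed.

(** The squared distance of two Hermite sums is a difference of partial sums of |a n|^2, so the sums
    are Cauchy. Pairing with the fixed kernel is continuous, which gives the transform of the
    limit. *)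
Lemma riesz_fischer (a : nat -> C) (S : R) :
  (forall N, \sum_(n < N) normc (a n) ^+ 2 <= S) ->
  exists h, [/\ sqint mu h, (sqnorm mu h <= (2 * S)%:E)%E &
    forall z, normc (\sum_(n < N) a n * nmono z n - bargmann h z) @[N --> \oo] --> 0].
Proof.
move=> aS.
pose P N := \sum_(n < N) normc (a n) ^+ 2.
have Pinc : nondecreasing_seq P.
  by apply/nondecreasing_seqP => n; rewrite /P big_ord_recr/= lerDl sqr_ge0.
have cP : cvgn P.
  by apply: nondecreasing_is_cvgn => //; exists S => _ [n _ <-]; exact: aS.
have diff m n : (n <= m)%N -> rsqnorm (fun x => synth a m x - synth a n x) = P m - P n.
  move=> nm.
  (* The difference of two partial sums is itself a Hermite sum, with the coefficients below n set
     to 0. *)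
  pose c k := if (n <= k)%N then a k else 0.
  have split_sum (V : zmodType) (G : nat -> V) : \sum_(k < m) G k - \sum_(k < n) G k =
      \sum_(k < m | (n <= k)%N) G k.
    rewrite (bigID (fun k : 'I_m => (n <= k)%N))/=.
    rewrite (big_ord_widen m G nm).
    rewrite (eq_bigl (fun k : 'I_m => (k < n)%N) _ (fun k : 'I_m => esym (ltnNge k n))).
    by rewrite addrK.
  have -> : (fun x => synth a m x - synth a n x) = synth c m.
    apply/funext => x; rewrite /synth (split_sum _ (fun k => a k * hermite_fun k x)) big_mkcond/=; apply: eq_bigr => k _.
    by rewrite /c; case: ifP; rewrite ?mul0r.
  rewrite rsqnorm_synth /P (split_sum _ (fun k => normc (a k) ^+ 2)) [RHS]big_mkcond/=; apply: eq_bigr => k _.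
  by rewrite /c; case: ifP; rewrite // normc0 expr0n.
have cau e : 0 < e -> exists N, forall m n, (N <= m)%N -> (N <= n)%N ->
    (sqnorm mu (fun x => synth a m x - synth a n x)%R <= e%:E)%E.
  move=> e0; have /cvgrPdist_le/(_ _ e0) [N _ hN] := cP.
  have key m n : (N <= n)%N -> (n <= m)%N ->
      (sqnorm mu (fun x => synth a m x - synth a n x)%R <= e%:E)%E.
    move=> Nn nm; rewrite sqnorm_rsqnorm; last by apply: sqintB; exact: sqint_synth.
    rewrite lee_fin diff//; have := hN n Nn.
    have := nondecreasing_cvgn_le Pinc cP m.
    by rewrite ler_norml => h1 /andP[_ h2]; move: h1 h2; rewrite -/(P n); lra.
  exists N => m n Nm Nn; case: (leqP n m) => nm; first exact: key.
  rewrite -sqnormN (@eq_sqnorm _ _ _ mu _ (fun x => synth a n x - synth a m x)).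
    by apply: key => //; exact: ltnW.
  by move=> x; rewrite opprB.
have [h sh hh] := sqint_complete (sqint_synth a) cau.
have sd N : sqint mu (fun x => synth a N x - h x) by apply: sqintB => //; exact: sqint_synth.
exists h; split => //.
- apply/lee_addgt0Pr => e e0.
  have e20 : 0 < e / 2 by rewrite divr_gt0.
  have [N _ /(_ N (leqnn _)) hN] := hh _ e20.
  rewrite (@eq_sqnorm _ _ _ mu h (fun x => synth a N x - (synth a N x - h x))); last first.
    by move=> x; rewrite opprB addrC subrK.
  have -> : ((2 * S)%:E + e%:E = 2%:E * S%:E + 2%:E * (e / 2)%:E)%E.
    by rewrite -!EFinM -EFinD; congr (_%:E); field.
  apply: (le_trans (sqnormB_le mu (sqint_synth a N).1 (sd N).1)).
  apply: leeD; apply: lee_wpmul2l => //.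
  by rewrite sqnorm_rsqnorm ?lee_fin ?rsqnorm_synth//; exact: sqint_synth.
move=> z.
have A0 : 0 <= expR (normc z ^+ 2) by exact: expR_ge0.
have d0 : rsqnorm (fun x => synth a N x - h x) @[N --> \oo] --> (0 : R).
  apply/cvgrPdist_le => e e0; apply: filterS (hh e e0) => N.
  rewrite sqnorm_rsqnorm// lee_fin sub0r normrN ger0_norm//.
  by apply: Rintegral_ge0 => x _; exact: sqr_ge0.
apply: (cvg0_weighted A0 d0) => [N|N t t0]; first exact: normc_ge0.
have := normc_cintM_le (sqint_bkern z) (sd N) t0 _ _.
rewrite sqnorm_bkern sqnorm_rsqnorm// => /(_ _ _ (lexx _) (lexx _)).
apply: le_trans; rewrite le_eqVlt; apply/orP; left; apply/eqP; congr normc.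
have -> : \sum_(n < N) a n * nmono z n = cint mu setT (fun x => synth a N x * bkern z x).
  rewrite cint_synth; last exact: sqint_bkern.
  by apply: eq_bigr => n _; rewrite cint_hermite_bkern.
rewrite bargmannE// -cintB//.
- by apply: eq_cint => x _; rewrite -mulrBl mulrC.
- by apply: sqintM_integ; [exact: sqint_synth|exact: sqint_bkern].
- by apply: sqintM_integ => //; exact: sqint_bkern.
Qed.

End BargmannExpansion.

(** * Injectivity and the fractional Fourier transform *)

Section ProductBoundFubini.
Context {R : realType}.
Local Notation C := R[i].
Local Notation Re := (@complex.Re R).
Local Notation Im := (@complex.Im R).
Local Notation mu := (@lebesgue_measure R).

Section Real.
Context (f : R * R -> R) (g1 g2 : R -> R).
Context (mf : measurable_fun setT f).
Context (i1 : mu.-integrable setT (EFin \o g1)).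
Context (i2 : mu.-integrable setT (EFin \o g2)).
Context (fg : forall x t, `|f (x, t)| <= g1 x * g2 t).

Lemma integrable_section1 x : mu.-integrable setT (EFin \o (fun t => f (x, t))).
Proof.
apply: (le_integrable measurableT _ _ (integrable_scale (g1 x) measurableT i2)).
  by apply/measurable_EFinP; apply: measurableT_comp mf _; exact: pair1_measurable.
by move=> t _ /=; rewrite lee_fin; apply: le_trans (fg x t) _; exact: ler_norm.
Qed.

Lemma integrable_section2 t : mu.-integrable setT (EFin \o (fun x => f (x, t))).
Proof.
apply: (le_integrable measurableT _ _ (integrable_scale (g2 t) measurableT i1)).
  by apply/measurable_EFinP; apply: measurableT_comp mf _; exact: pair2_measurable.
by move=> x _ /=; rewrite lee_fin mulrC; apply: le_trans (fg x t) _; exact: ler_norm.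
Qed.

Lemma integrable_prod_bound : (mu \x mu)%E.-integrable setT (EFin \o f).
Proof.
apply/integrable12ltyP; first exact/measurable_EFinP.
have mf' : measurable_fun setT (abse \o (EFin \o f)).
  by apply: measurableT_comp => //; exact/measurable_EFinP.
pose I2 := \int[mu]_t `|g2 t|.
have i2' : mu.-integrable setT (EFin \o (fun t => `|g2 t|)) := integrable_norm i2.
have i1' := integrable_scale I2 measurableT (integrable_norm i1 : mu.-integrable setT (EFin \o (fun t => `|g1 t|))).
apply: le_lt_trans (integrable_lty measurableT i1').
apply: ge0_le_integral => //.
- by move=> x _; apply: integral_ge0.
- by have := @measurable_fun_fubini_tonelli_F _ _ _ _ R mu _ mf' (fun p => abse_ge0 _).
- exact: measurable_int i1'.
move=> x _ /=.
apply: (@le_trans _ _ (\int[mu]_t (`|g1 x|%:E * `|g2 t|%:E))%E).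
  apply: ge0_le_integral => //.
  - by apply: measurableT_comp mf' _; exact: pair1_measurable.
  - by apply: measurable_funeM; exact: measurable_int i2'.
  move=> t _; rewrite -EFinM lee_fin -normrM.
  by apply: le_trans (fg x t) _; exact: ler_norm.
rewrite ge0_integralZl_EFin//; last exact: measurable_int i2'.
rewrite mulrC EFinM; apply: lee_wpmul2l => //.
rewrite /I2 /Rintegral fineK//; apply: integrable_fin_num => //.
Qed.

Lemma measurable_Rintegral_section : measurable_fun setT (fun x => \int[mu]_t f (x, t)).
Proof.
apply: (measurableT_comp (f := fine)) => //.
exact: (measurable_fubini_F integrable_prod_bound).
Qed.

Lemma Rintegral_exchange :
  \int[mu]_x (\int[mu]_t f (x, t)) = \int[mu]_t (\int[mu]_x f (x, t)).
Proof.
rewrite [LHS]/Rintegral [RHS]/Rintegral; congr fine.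
have := Fubini integrable_prod_bound => /= h.
transitivity (\int[mu]_x \int[mu]_t (f (x, t))%:E)%E.
  apply: eq_integral => x _; rewrite /Rintegral fineK//.
  exact: integrable_fin_num (integrable_section1 x).
rewrite h; apply: eq_integral => t _; rewrite /Rintegral fineK//.
exact: integrable_fin_num (integrable_section2 t).
Qed.

End Real.

Lemma cint_exchange (F : R * R -> C) (g1 g2 : R -> R) : cmeas F ->
  mu.-integrable setT (EFin \o g1) -> mu.-integrable setT (EFin \o g2) ->
  (forall x t, normc (F (x, t)) <= g1 x * g2 t) ->
  cmeas (fun x => cint mu setT (fun t => F (x, t))) /\
  cint mu setT (fun x => cint mu setT (fun t => F (x, t))) =
  cint mu setT (fun t => cint mu setT (fun x => F (x, t))).
Proof.
move=> [m1 m2] i1 i2 Fg.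
have f1 x t : `|Re (F (x, t))| <= g1 x * g2 t by apply: le_trans (Fg x t); exact: normr_Re_le.
have f2 x t : `|Im (F (x, t))| <= g1 x * g2 t by apply: le_trans (Fg x t); exact: normr_Im_le.
split.
  split; first exact: (measurable_Rintegral_section m1 i1 i2 f1).
  exact: (measurable_Rintegral_section m2 i1 i2 f2).
congr (_ +i* _); first exact: (Rintegral_exchange m1 i1 i2 f1).
exact: (Rintegral_exchange m2 i1 i2 f2).
Qed.

End ProductBoundFubini.

(** * A function with vanishing Gaussian averages is null *)

Section GaussianUniqueness.
Context {R : realType}.
Local Notation C := R[i].
Local Notation Re := (@complex.Re R).
Local Notation Im := (@complex.Im R).
Local Notation mu := (@lebesgue_measure R).

Lemma Rintegral_setC_split (D : set R) (f : R -> R) : measurable D ->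
  mu.-integrable setT (EFin \o f) ->
  \int[mu]_t f t = \int[mu]_(t in D) f t + \int[mu]_(t in ~` D) f t.
Proof.
move=> mD i; rewrite -(setUv D) in i *; rewrite Rintegral_setU//; first exact: measurableC.
by rewrite disj_set2E setICr.
Qed.

(** An approximate identity of mass 1, symmetric in [x] and [t], concentrating as [c] grows. *)
Definition gbump (c x t : R) : R := Num.sqrt (c / pi) * expR (- (c * (t - x) ^+ 2)).

Lemma gbump_ge0 c x t : 0 <= gbump c x t.
Proof. by rewrite mulr_ge0 ?sqrtr_ge0 ?expR_ge0. Qed.

Lemma gbump_integ c x : 0 < c -> mu.-integrable setT (EFin \o gbump c x).
Proof. by move=> c0; apply: integrable_scale => //; exact: (gaussian_integral x c0).1. Qed.

Lemma gbump_int c x : 0 < c -> \int[mu]_t gbump c x t = 1.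
Proof.
move=> c0; have p0 : (0 : R) < pi := pi_gt0 R.
have [i e] := gaussian_integral x c0.
rewrite RintegralZl// /Rintegral e /= -sqrtrM ?divr_ge0 ?ltW//.
by rewrite mulrA divfK ?gt_eqF// divff ?gt_eqF// sqrtr1.
Qed.

(** Half of the exponent gives the factor exp(- c d^2 / 2), the other half leaves at most twice the
    bump with parameter c / 2; finally exp(-q) <= 1/q. *)
Lemma gbump_tail c x (D : set R) (d : R) : 0 < c -> 0 < d -> measurable D ->
  (forall t, D t -> d <= `|t - x|) ->
  \int[mu]_(t in D) gbump c x t <= 2 / (c / 2 * d ^+ 2).
Proof.
move=> c0 d0 mD hD; have c20 : 0 < c / 2 by rewrite divr_gt0.
have q0 : 0 < c / 2 * d ^+ 2 by rewrite mulr_gt0// exprn_gt0.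
have id : mu.-integrable setT (EFin \o (fun t => expR (- (c / 2 * d ^+ 2)) * (2 * gbump (c / 2) x t))).
  by do 2 apply: integrable_scale => //; exact: gbump_integ.
have sD (f : R -> R) : mu.-integrable setT (EFin \o f) -> mu.-integrable D (EFin \o f).
  exact: integrableS.
apply: (@le_trans _ _ (\int[mu]_(t in D) (expR (- (c / 2 * d ^+ 2)) * (2 * gbump (c / 2) x t)))).
  apply: le_Rintegral => //; first by apply: sD; exact: gbump_integ.
    exact: sD.
  move=> t Dt; rewrite /gbump.
  have e1 : expR (- (c * (t - x) ^+ 2)) <= expR (- (c / 2 * d ^+ 2)) * expR (- (c / 2 * (t - x) ^+ 2)).
    rewrite -expRD ler_expR.
    have : d ^+ 2 <= (t - x) ^+ 2.
      rewrite -(real_normK (num_real (t - x))) ler_pXn2r ?nnegrE ?normr_ge0 ?(ltW d0)//.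
      exact: hD.
    move=> h; have : c * d ^+ 2 <= c * (t - x) ^+ 2 by rewrite ler_pM2l.
    lra.
  have e2 : Num.sqrt (c / pi) <= 2 * Num.sqrt (c / 2 / pi).
    have -> : c / pi = 2 * (c / 2 / pi) by rewrite mulrA mulrCA divff ?mulr1.
    rewrite sqrtrM// ler_wpM2r ?sqrtr_ge0//.
    rewrite -[leRHS]ger0_norm// -sqrtr_sqr ler_wsqrtr//; lra.
  have := ler_pM (sqrtr_ge0 _) (expR_ge0 _) e2 e1.
  by move=> /le_trans; apply; rewrite le_eqVlt; apply/orP; left; apply/eqP; ring.
apply: (@le_trans _ _ (\int[mu]_t (expR (- (c / 2 * d ^+ 2)) * (2 * gbump (c / 2) x t)))).
  rewrite (Rintegral_setC_split mD id) lerDl.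
  by apply: Rintegral_ge0 => t _; rewrite !mulr_ge0 ?expR_ge0 ?sqrtr_ge0.
have ig := gbump_integ x c20.
rewrite (RintegralZl _ measurableT (integrable_scale 2 measurableT ig)) (RintegralZl _ measurableT ig).
rewrite gbump_int// mulr1 mulrC ler_pM2l//.
by rewrite expRN lef_pV2 ?posrE ?expR_gt0//; apply: le_trans (expR_ge1Dx _); rewrite lerDr.
Qed.

Lemma gbump_itv_le1 c x (D : set R) : 0 < c -> measurable D ->
  0 <= \int[mu]_(t in D) gbump c x t <= 1.
Proof.
move=> c0 mD; rewrite Rintegral_ge0/=; last by move=> t _; exact: gbump_ge0.
rewrite -(gbump_int x c0) (Rintegral_setC_split mD (gbump_integ x c0)) lerDl.
by apply: Rintegral_ge0 => t _; exact: gbump_ge0.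
Qed.

Lemma gbump_itv_cvg a b x : x != a -> x != b ->
  \int[mu]_(t in `[a, b]) gbump (2 ^+ n) x t @[n --> \oo] --> (\1_(`[a, b]%classic : set R) x : R).
Proof.
move=> xa xb.
pose d := Num.min `|a - x| `|b - x|.
have d0 : 0 < d by rewrite lt_min !normr_gt0 !subr_eq0 eq_sym xa eq_sym xb.
have p2 n : (0 : R) < 2 ^+ n by rewrite exprn_gt0.
pose K := 4 / d ^+ 2.
have Kn n : 2 / (2 ^+ n / 2 * d ^+ 2) = K / 2 ^+ n.
  by rewrite /K; field; rewrite !gt_eqF// exprn_gt0.
apply/cvgrPdist_le => e e0.
have /cvgrPdist_le/(_ _ e0) := cvg_K2 K.
apply: filterS => n; rewrite sub0r normrN ger0_norm; last first.
  by rewrite divr_ge0 ?ltW// divr_gt0// exprn_gt0.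
apply: le_trans; rewrite -Kn.
have [xab|xab] := boolP (x \in `[a, b]).
  rewrite indicE mem_set//=.
  have := Rintegral_setC_split (measurable_itv `[a, b]) (gbump_integ x (p2 n)).
  rewrite gbump_int// => /eqP; rewrite addrC -subr_eq => /eqP ->.
  rewrite ger0_norm; last by apply: Rintegral_ge0 => t _; exact: gbump_ge0.
  apply: gbump_tail => //; first exact: measurableC.
  move=> t /= /negP; rewrite in_itv/= => tab.
  move: xab; rewrite in_itv/= => /andP[ax xb'].
  rewrite /d ge_min.
  move: tab; rewrite negb_and -!ltNge => /orP[ta|bt]; apply/orP; [left|right].
    have -> : `|a - x| = x - a by rewrite ler0_norm; lra.
    have -> : `|t - x| = x - t by rewrite ler0_norm; lra.
    lra.
  have -> : `|b - x| = b - x by rewrite ger0_norm; lra.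
  have -> : `|t - x| = t - x by rewrite ger0_norm; lra.
  lra.
rewrite indicE memNset//= ?sub0r ?normrN; last exact/negP.
rewrite ger0_norm; last by apply: Rintegral_ge0 => t _; exact: gbump_ge0.
apply: gbump_tail => // t /=; rewrite in_itv/= => /andP[at_ tb].
rewrite /d ge_min.
move: xab; rewrite in_itv/= negb_and -!ltNge => /orP[xa'|bx]; apply/orP; [left|right].
  have -> : `|a - x| = a - x by rewrite ger0_norm; lra.
  have -> : `|t - x| = t - x by rewrite ger0_norm; lra.
  lra.
have -> : `|b - x| = x - b by rewrite ler0_norm; lra.
have -> : `|t - x| = x - t by rewrite ler0_norm; lra.
lra.
Qed.

(** The indicator of the interval is smoothed to [E n]. Against [w] the smoothed function integrates
    to 0 by Fubini, and it tends to the indicator away from the two endpoints. *)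
Lemma gauss_unique_itv (w : R -> R) (a b : R) : mu.-integrable setT (EFin \o w) ->
  (forall c t : R, 0 < c -> \int[mu]_x (w x * expR (- (c * (x - t) ^+ 2))) = 0) ->
  \int[mu]_(x in `[a, b]) w x = 0.
Proof.
move=> iw hw.
have mw : measurable_fun setT w by apply/measurable_EFinP; exact: measurable_int iw.
pose J : set R := `[a, b]%classic.
have mJ : measurable J by exact: measurable_itv.
have iJ : mu.-integrable setT (EFin \o (\1_J : R -> R)) by exact: integrable_indic_itv.
have RJ (f : R -> R) : \int[mu]_(x in J) f x = \int[mu]_x (f x * \1_J x).
  by rewrite Rintegral_mkcond patch_indic.
pose E n x := \int[mu]_(t in J) gbump (2 ^+ n) x t.
have p2 n : (0 : R) < 2 ^+ n by rewrite exprn_gt0.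
pose f n (p : R * R) := w p.1 * (gbump (2 ^+ n) p.1 p.2 * \1_J p.2).
have fE n x : w x * E n x = \int[mu]_t f n (x, t).
  rewrite /E RJ -RintegralZl//.
  apply: (le_integrable measurableT _ _ (gbump_integ x (p2 n))).
    apply/measurable_EFinP; apply: measurable_funM; last exact: measurable_indic.
    by apply/measurable_EFinP; exact: measurable_int (gbump_integ x (p2 n)).
  move=> t _ /=; rewrite lee_fin normrM ger0_norm ?gbump_ge0//.
  rewrite ler_piMr ?gbump_ge0// indicE ger0_norm ?ler0n//.
  by case: (t \in J); rewrite // ler01.
have mgb c : measurable_fun setT (fun p : R * R => gbump c p.1 p.2).
  apply: measurable_funM => //; apply: measurableT_comp => //.
  apply: measurableT_comp => //; apply: measurable_funM => //.
  by apply: measurable_funX; apply: measurable_funB.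
have mf n : measurable_fun setT (f n).
  apply: measurable_funM; first exact: measurableT_comp mw _.
  apply: measurable_funM; first exact: mgb.
  by apply: (measurableT_comp (f := \1_J : R -> R)).
have i1 n := integrable_scale (Num.sqrt (2 ^+ n / pi)) measurableT (integrable_norm iw : mu.-integrable setT (EFin \o (fun x => `|w x|))).
have fb n x t : `|f n (x, t)| <= Num.sqrt (2 ^+ n / pi) * `|w x| * \1_J t.
  rewrite /f/= (normrM (w x)) (normrM (gbump _ _ _)) (ger0_norm (gbump_ge0 _ _ _)) mulrA.
  have j0 : 0 <= (\1_J t : R) by rewrite indicE ler0n.
  rewrite (ger0_norm j0) ler_wpM2r// mulrC ler_wpM2r// /gbump ler_piMr ?sqrtr_ge0//.
  by rewrite expR_le1// oppr_le0 mulr_ge0 ?sqr_ge0 ?ltW.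
have E0 n : \int[mu]_x (w x * E n x) = 0.
  under eq_Rintegral do rewrite fE.
  rewrite (Rintegral_exchange (mf n) (i1 n) iJ (fb n)).
  rewrite -[RHS](_ : \int[mu]_t (0 : R) = 0); last by rewrite /Rintegral integral0.
  apply: eq_Rintegral => t _.
  transitivity (Num.sqrt (2 ^+ n / pi) * \1_J t * \int[mu]_x (w x * expR (- (2 ^+ n * (x - t) ^+ 2)))).
    rewrite -RintegralZl//; last first.
      apply: (le_integrable measurableT _ _ iw).
        apply/measurable_EFinP; apply: measurable_funM => //.
        by apply/measurable_EFinP; exact: measurable_int (gaussian_integral t (p2 n)).1.
      move=> x _ /=; rewrite lee_fin normrM ler_piMr// ger0_norm ?expR_ge0//.
      by rewrite expR_le1// oppr_le0 mulr_ge0 ?sqr_ge0 ?ltW.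
    apply: eq_Rintegral => x _; rewrite /f/= /gbump -(sqrrN (x - t)) opprB; ring.
  by rewrite hw// mulr0.
have mE n : measurable_fun setT (fun x => w x * E n x).
  under [X in measurable_fun _ X]eq_fun do rewrite fE.
  exact: (measurable_Rintegral_section (mf n) (i1 n) iJ (fb n)).
have E1 n x : `|E n x| <= 1.
  by have /andP[h0 h1] := gbump_itv_le1 x (p2 n) mJ; rewrite ger0_norm.
have mwJ : measurable_fun setT (fun x => w x * \1_J x).
  by apply: measurable_funM => //; exact: measurable_indic.
have nab c : {ae mu, forall x : R, x != c}.
  exists [set c]; split => //; first exact: lebesgue_measure_set1.
  by move=> x /= /negP; rewrite negbK => /eqP.
have cv : {ae mu, forall x : R, setT x -> (w x * E n x)%:E @[n --> \oo] --> (w x * \1_J x)%:E}.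
  have := nab b; have := nab a; apply: filterS2; first exact: (ae_filter_ringOfSetsType mu).
  move=> x xa xb _.
  apply/cvg_EFin; first exact: nearW.
  by apply: cvgMr; exact: gbump_itv_cvg.
have bd : {ae mu, forall x : R, forall n, setT x -> (`|(w x * E n x)%:E| <= `|(w x)%:E|)%E}.
  apply: aeW => x n _ /=; rewrite lee_fin normrM ler_piMr//.
have mEE (g : R -> R) : measurable_fun setT g -> measurable_fun setT (EFin \o g) by move=> ?; exact/measurable_EFinP.
have [_ _ c] := @dominated_convergence _ _ R mu setT measurableT (fun n (x : R) => (w x * E n x)%:E)
  (fun x : R => (w x * \1_J x)%:E) (fun x : R => `|(w x)%:E|%E) (fun n => mEE _ (mE n))
  (mEE _ mwJ) cv (integrable_abse iw) bd.
rewrite RJ /Rintegral -[RHS]/(fine 0%E); congr fine.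
have e0 n : (\int[mu]_x (w x * E n x)%:E = 0)%E.
  have iE : mu.-integrable setT (EFin \o (fun x => w x * E n x)).
    apply: (le_integrable measurableT _ _ iw); first exact: mEE (mE n).
    by move=> x _ /=; rewrite lee_fin normrM ler_piMr.
  by have := E0 n; rewrite /Rintegral => h; rewrite -[RHS]/(0%:E) -h fineK//; exact: integrable_fin_num iE.
have c0 : (fun _ : nat => 0%E : \bar R) @ \oo --> (\int[mu]_x (w x * \1_J x)%:E)%E.
  by apply: cvg_trans c; apply: near_eq_cvg; apply: nearW => n; exact: e0.
by apply: cvg_unique c0 _; [exact: ereal_hausdorff|exact: cvg_cst].
Qed.

Lemma gauss_unique (w : R -> R) : mu.-integrable setT (EFin \o w) ->
  (forall c t : R, 0 < c -> \int[mu]_x (w x * expR (- (c * (x - t) ^+ 2))) = 0) ->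
  {ae mu, forall x, w x = 0}.
Proof.
move=> iw hw.
have iD (D : set R) : measurable D -> mu.-integrable D (EFin \o w).
  by move=> mD; exact: integrableS iw.
have loc : locally_integrable setT w.
  exact: open_integrable_locally openT iw.
have h n : {ae mu, forall x, (- n%:R < x) -> w x = 0}.
  have := @FTC1 R w (BLeft (- n%:R)) (fun y => iD _ (measurable_itv _)) loc.
  apply: filterS; first exact: (ae_filter_ringOfSetsType mu).
  move=> x hx nx.
  have hb : ((- n%:R)%:E < x%:E)%E by rewrite lte_fin.
  have [_ <-] := hx hb.
  rewrite (_ : (fun y => _) = cst 0) ?derive1_cst//.
  by apply/funext => y; exact: gauss_unique_itv.
have H : {ae mu, forall x n, - n%:R < x -> w x = 0} := ae_foralln h.
move: H; apply: filterS; first exact: (ae_filter_ringOfSetsType mu).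
move=> x hx.
apply: (hx (Num.truncn `|x|).+1).
rewrite ltrNl; apply: le_lt_trans (truncnS_gt _); rewrite -normrN; exact: ler_norm.
Qed.

End GaussianUniqueness.

(** * Injectivity of B, and B F_alpha on integrable functions *)

Section FractionalFourier.
Context {R : realType}.
Local Notation C := R[i].
Local Notation Re := (@complex.Re R).
Local Notation Im := (@complex.Im R).
Local Notation mu := (@lebesgue_measure R).
Implicit Types (u : R -> C) (z a b : C).

Lemma cmeas_snd : cmeas (fun p : R * R => p.2%:C).
Proof. exact: cmeas_real. Qed.

Lemma cmeas_gk_pair a (B : R * R -> C) (X : R * R -> R) : cmeas B -> measurable_fun setT X ->
  cmeas (fun p => gk a (B p) (X p)).
Proof.
move=> mB mX; have mX' := cmeas_real mX.
apply: cmeas_cexp; apply: cmeasD; last exact: cmeasM.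
apply: cmeasM; [exact: cmeas_cst|exact: cmeasX].
Qed.

Lemma gk_gauss_neq0 a : 0 < Re a -> (Num.sqrt pi)%:C / sqrtc a != 0 :> C.
Proof.
move=> a0; rewrite mulf_neq0 ?invr_eq0//.
  by rewrite -normc_gt0 normc_real normr_gt0 gt_eqF// sqrtr_gt0 pi_gt0.
by rewrite sqrtc_eq0; apply: contraTneq a0 => ->; rewrite ltxx.
Qed.

Lemma integrable_normc_gk a b : 0 < Re a ->
  mu.-integrable setT (EFin \o (fun x => normc (gk a b x))).
Proof. by move=> a0; apply: cinteg_normc => //; exact: gk_integ1. Qed.

(** Satisfied by square integrable functions and also by [frft_integral al u] for integrable [u], so
    that differences of the two kinds can be transformed. *)
Definition bargmann_integrable u : Prop := forall z,
  cinteg mu setT (fun x => u x * cexp (2 * x%:C * z - x%:C ^+ 2 - z ^+ 2 / 2)).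

(* On the imaginary axis the transform of [u] is the Fourier transform of
   [u exp(-x^2)]; integrating it against Gaussians yields all Gaussian averages
   of [u exp(-x^2)]. *)
Lemma bargmann_inj u : cmeas u -> bargmann_integrable u ->
  (forall z, bargmann u z = 0) -> {ae mu, forall x, u x = 0}.
Proof.
move=> mu_ iu Bu; pose W x := u x * gk 1 0 x.
have iW : cinteg mu setT W.
  apply: (@eq_cinteg _ _ R mu setT _ _ measurableT _ (iu 0)) => x _.
  by rewrite /W /gk; congr (_ * cexp _); ring.
have mW : cmeas W by apply: cmeasM => //; apply: rcont_meas; exact: rcont_gk.
have n1 (y x : R) : normc (cexp (2 * 'i%C * y%:C * x%:C)) = 1.
  rewrite normc_cexp (_ : 2 * 'i%C * y%:C * x%:C = (2 * y * x)%:C * 'i%C) ?Re_scale/= ?mulr0 ?expR0//.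
  by rewrite !rmorphM/= rmorph_nat; ring.
have mE (y : R) : cmeas (fun x : R => cexp (2 * 'i%C * y%:C * x%:C)).
  by apply: cmeas_cexp; apply: cmeasM; [exact: cmeas_cst|exact: cmeas_real].
have iE (y : R) : cinteg mu setT (fun x => W x * cexp (2 * 'i%C * y%:C * x%:C)).
  apply: (@cinteg_leT _ _ R mu _ (fun x : R => normc (W x))).
  - exact: cmeasM mW (mE y).
  - exact: cinteg_normc iW.
  - by move=> x; rewrite (normcM (W x)) n1 mulr1.
have FW (y : R) : cint mu setT (fun x => W x * cexp (2 * 'i%C * y%:C * x%:C)) = 0.
  have := Bu ('i%C * y%:C).
  rewrite /bargmann -[cintegral _]/(cint mu setT _).
  have -> : cint mu setT (fun x => u x * cexp (2 * x%:C * ('i%C * y%:C) - x%:C ^+ 2 - ('i%C * y%:C) ^+ 2 / 2)) =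
     cint mu setT (fun x => cexp (- (('i%C * y%:C) ^+ 2 / 2)) * (W x * cexp (2 * 'i%C * y%:C * x%:C))).
    apply: eq_cint => x _.
    rewrite /W /gk [RHS]mulrCA -[RHS]mulrA -!cexpD; congr (_ * cexp _); ring.
  rewrite cintZ// => /eqP; rewrite mulf_eq0.
  have -> : ((2 / pi) `^ 4^-1)%:C == 0 :> C = false.
    by apply/negbTE; rewrite -normc_gt0 normc_real normr_gt0 gt_eqF// bconst_gt0.
  by rewrite orFb (mulf_eq0 (cexp _)) (negbTE (cexp_neq0 _)) orFb => /eqP.
have key (c t : R) : 0 < c -> cint mu setT (fun x => W x * (expR (- (c * (x - t) ^+ 2)))%:C) = 0.
  (* With a = 1/c, integrating exp(- a y^2 + 2 i (x - t) y) over y gives a constant times exp(- c (x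
     - t)^2); integrating over x first gives 0 by [FW]. *)
  move=> c0; pose a : C := c%:C^-1.
  have a0 : 0 < Re a by rewrite /a -fmorphV invr_gt0.
  pose F (p : R * R) := W p.1 * gk a (2 * 'i%C * (p.1 - t)%:C) p.2.
  have mF : cmeas F.
    apply: cmeasM; first by split; [apply: measurableT_comp mW.1 _|apply: measurableT_comp mW.2 _].
    apply: cmeas_gk_pair => //; apply: cmeasM; first exact: cmeas_cst.
    by apply: cmeas_real; apply: measurable_funB.
  have bF x y : normc (F (x, y)) <= normc (W x) * normc (gk a 0 y).
    rewrite /F (normcM (W _)) ler_wpM2l ?normc_ge0// !normc_gk ler_expR.
    rewrite -mulrA (ReM 2) Re_nat Im_nat mul0r subr0 ReM/= !(mulr0, mul0r, subr0, mul1r).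
    done.
  have [_] := cint_exchange mF (cinteg_normc measurableT iW) (integrable_normc_gk 0 a0) bF.
  have -> : cint mu setT (fun y => cint mu setT (fun x => F (x, y))) = 0.
    transitivity (cint mu setT (fun y : R => 0 * gk a 0 y)).
      apply: eq_cint => y _.
      transitivity (gk a (- 2 * 'i%C * t%:C) y * cint mu setT (fun x => W x * cexp (2 * 'i%C * y%:C * x%:C))); last by rewrite FW mulr0 mul0r.
      rewrite -cintZ//.
      apply: eq_cint => x _; rewrite /F/= [RHS]mulrCA; congr (_ * _).
      rewrite /gk -cexpD rmorphB/=; congr cexp; ring.
    by rewrite cintZ ?mul0r//; exact: gk_integ1.
  have K0 := gk_gauss_neq0 a0.
  have -> : cint mu setT (fun x => cint mu setT (fun y => F (x, y))) =
      cint mu setT (fun x => (Num.sqrt pi)%:C / sqrtc a * (W x * (expR (- (c * (x - t) ^+ 2)))%:C)).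
    apply: eq_cint => x _; rewrite /F/= cintZ//; last exact: gk_integ1.
    rewrite gauss_integral_complex// mulrA mulrC; congr (_ * (_ * _)).
    rewrite -cexp_real; congr cexp.
    rewrite !exprMn (_ : 'i%C ^+ 2 = -1); last by apply: complexP; rewrite expr2 !ReImE /=; ring.
    rewrite !(rmorphM, rmorphB, rmorphN, rmorphXn)/= /a.
    have c1 : c%:C != 0 :> C by rewrite -normc_gt0 normc_real normr_gt0 gt_eqF.
    by field.
  rewrite cintZ//; last first.
    apply: (@cinteg_leT _ _ R mu _ (fun x : R => normc (W x))).
    - apply: cmeasM mW _; apply: cmeas_real; apply/measurable_EFinP.
      exact: measurable_int (gaussian_integral t c0).1.
    - exact: cinteg_normc iW.
    - move=> x; rewrite (normcM (W x)) normc_real ger0_norm ?expR_ge0// ler_piMr ?normc_ge0//.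
      by rewrite expR_le1// oppr_le0 mulr_ge0 ?sqr_ge0 ?ltW.
  by move=> /eqP; rewrite mulf_eq0 (negbTE K0) => /eqP.
have reW : {ae mu, forall x, Re (W x) = 0}.
  apply: gauss_unique iW.1 _ => c t c0.
  have := key c t c0 => /(congr1 Re)/= => h.
  rewrite -[RHS]h; apply: eq_Rintegral => x _; by rewrite (mulrC (W x)) Re_scale mulrC.
have imW : {ae mu, forall x, Im (W x) = 0}.
  apply: gauss_unique iW.2 _ => c t c0.
  have := key c t c0 => /(congr1 Im)/= => h.
  rewrite -[RHS]h; apply: eq_Rintegral => x _; by rewrite (mulrC (W x)) Im_scale mulrC.
move: reW imW; apply: filterS2; first exact: (ae_filter_ringOfSetsType mu).
move=> x r0 i0; have /eqP : W x = 0 by apply: complexP.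
by rewrite /W mulf_eq0 (negbTE (cexp_neq0 _)) orbF => /eqP.
Qed.

Lemma cexp_angle (a : R) : cexp (- 'i%C * a%:C) = (cos a)%:C - 'i%C * (sin a)%:C :> C.
Proof.
rewrite (_ : - 'i%C * a%:C = (- a)%:C * 'i%C :> C); last by rewrite rmorphN/=; ring.
apply: complexP; rewrite ?Re_cexp ?Im_cexp Re_scale Im_scale !ReImE /=;
  by rewrite !(mulr0, mul0r, mulr1, mul1r, subr0, add0r, addr0, oppr0, sub0r) expR0 mul1r ?cosN ?sinN.
Qed.

Lemma sqr_i : 'i%C * 'i%C = -1 :> C.
Proof. by apply: complexP; rewrite !ReImE /=; ring. Qed.

Lemma cos_sqrC (a : R) : (cos a)%:C * (cos a)%:C = 1 - (sin a)%:C * (sin a)%:C :> C.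
Proof. by rewrite -!rmorphM -(rmorph1 (@real_complex R)) -rmorphB/= -!expr2 cos2sin2. Qed.

Lemma cotE (a : R) : (cot a)%:C = (cos a)%:C / (sin a)%:C :> C.
Proof. by rewrite /cot fmorph_div. Qed.

Lemma realC_neq0 (x : R) : x != 0 -> x%:C != 0 :> C.
Proof. by rewrite -normc_gt0 normc_real normr_gt0. Qed.

Lemma frft_rotation (a : R) : sin a != 0 ->
  (1 - 'i%C * (cot a)%:C) * ('i%C * cexp (- 'i%C * a%:C) * (sin a)%:C) = 1 :> C.
Proof.
move=> /realC_neq0 S0; rewrite cotE cexp_angle.
have i2 := sqr_i; have cs := cos_sqrC a.
by field: i2 cs.
Qed.

Section Kernel.
Context (al : R) (u : R -> C).
Context (s0 : sin al != 0).
Context (mu_ : cmeas u).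
Context (iu : cinteg mu setT u).

Let a : C := 1 - 'i%C * (cot al)%:C.

Let Re_a : Re a = 1.
Proof. by rewrite /a !ReImE /=; ring. Qed.

Let a_gt0 : 0 < Re a.
Proof. by rewrite Re_a. Qed.

Let chirp (t : R) : C := cexp ('i%C * (cot al)%:C * t%:C ^+ 2).

Let normc_chirp t : normc (chirp t) = 1.
Proof.
rewrite /chirp normc_cexp (_ : _ * _ = (cot al * t ^+ 2)%:C * 'i%C); last first.
  by rewrite -(rmorphXn (@real_complex R)) -mulrA -rmorphM/= mulrC.
by rewrite Re_scale/= mulr0 expR0.
Qed.

Let cmeas_chirp : cmeas chirp.
Proof.
apply: cmeas_cexp; apply: cmeasM; first exact: cmeas_cst.
by apply: cmeasX; exact: cmeas_real.
Qed.

(** The double integrand without its factor [D z]: the chirp in x joins exp(-x^2) to form exp(-a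
    x^2), and the chirp in t stays apart. The t-part of the linear coefficient is imaginary, so |F|
    is bounded by a product. *)
Let F z (p : R * R) : C :=
  gk a (2 * z - 2 * 'i%C * (csc al)%:C * p.2%:C) p.1 * (chirp p.2 * u p.2).

Let cmeasF z : cmeas (F z).
Proof.
apply: cmeasM.
  apply: cmeas_gk_pair => //; apply: cmeasB; first exact: cmeas_cst.
  by apply: cmeasM; [exact: cmeas_cst|exact: cmeas_snd].
apply: cmeasM.
  by split; [apply: measurableT_comp cmeas_chirp.1 _|apply: measurableT_comp cmeas_chirp.2 _].
by split; [apply: measurableT_comp mu_.1 _|apply: measurableT_comp mu_.2 _].
Qed.

Let F_le z x t : normc (F z (x, t)) <= normc (gk a (2 * z) x) * normc (u t).
Proof.
rewrite -[F z (x, t)]/(gk a (2 * z - 2 * 'i%C * (csc al)%:C * t%:C) x * (chirp t * u t)).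
rewrite (normcM (gk a (2 * z - 2 * 'i%C * (csc al)%:C * t%:C) x)).
rewrite (normcM (chirp t)) normc_chirp mul1r.
rewrite ler_wpM2r ?normc_ge0// !normc_gk ler_expR lerD2l.
have -> : 2 * 'i%C * (csc al)%:C * t%:C = (2 * csc al * t)%:C * 'i%C :> C.
  by rewrite !rmorphM/= rmorph_nat; ring.
by rewrite ReD ReN Re_scale/= mulr0 subr0.
Qed.

Let chirp_u_integ : cinteg mu setT (fun t => chirp t * u t).
Proof.
apply: (@cinteg_leT _ _ R mu _ (fun x : R => normc (u x))).
- exact: cmeasM cmeas_chirp mu_.
- exact: cinteg_normc iu.
- by move=> x; rewrite (normcM (chirp x)) normc_chirp mul1r.
Qed.

Let F_integ z x : cinteg mu setT (fun t => F z (x, t)).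
Proof.
apply: (@cinteg_leT _ _ R mu _ (fun t : R => normc (gk a (2 * z) x) * normc (u t))).
- split.
    by apply: measurableT_comp (cmeasF z).1 _; exact: pair1_measurable.
  by apply: measurableT_comp (cmeasF z).2 _; exact: pair1_measurable.
- by apply: integrable_scale => //; exact: cinteg_normc iu.
- by move=> t; exact: F_le.
Qed.

Let D z : C := sqrtc a / (Num.sqrt pi)%:C * cexp (- (z ^+ 2 / 2)).

Let frft_kernel z x : frft_integral al u x * cexp (2 * x%:C * z - x%:C ^+ 2 - z ^+ 2 / 2) =
  D z * cint mu setT (fun t => F z (x, t)).
Proof.
rewrite /frft_integral -/a -[cintegral _]/(cint mu setT _).
pose E : C := cexp (2 * x%:C * z - x%:C ^+ 2 - z ^+ 2 / 2).
pose c1 : C := cexp ('i%C * (x ^+ 2 * cot al)%:C).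
(* The inverse of all exponential factors in x; after cancelling it only exp(- z^2 / 2) survives
   outside the integral. *)
pose k : C := cexp (- ('i%C * (x ^+ 2 * cot al)%:C + (2 * x%:C * z - x%:C ^+ 2))).
have ck : c1 * k * E = cexp (- (z ^+ 2 / 2)) by rewrite /c1 /E /k -!cexpD; congr cexp; ring.
have -> : cint mu setT (fun t =>
    cexp (- 2 * 'i%C * (x * t * csc al - cot al / 2 * t ^+ 2)%:C) * u t) =
    k * cint mu setT (fun t => F z (x, t)).
  rewrite -cintZ//; apply: eq_cint => t _.
  transitivity (k * gk a (2 * z - 2 * 'i%C * (csc al)%:C * t%:C) x * chirp t * u t); last first.
    by rewrite -[F z (x, t)]/(gk a (2 * z - 2 * 'i%C * (csc al)%:C * t%:C) x * (chirp t * u t)); ring.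
  congr (_ * u t); rewrite /gk /k /chirp -!cexpD; congr cexp; rewrite /a; move: (cot al) (csc al) => ct cs.
  rewrite !(rmorphM, rmorphB, rmorphXn, fmorph_div, rmorph_nat)/=.
  by field.
rewrite /D -ck -/c1 -/E; ring.
Qed.

Let cintF_le z x : normc (cint mu setT (fun t => F z (x, t))) <=
  (\int[mu]_t normc (u t)) * normc (gk a (2 * z) x).
Proof.
apply: (le_trans (normc_cint_le measurableT (F_integ z x))).
rewrite mulrC -RintegralZl//; last exact: cinteg_normc iu.
apply: le_Rintegral => //; first exact: cinteg_normc (F_integ z x).
  by apply: integrable_scale => //; exact: cinteg_normc iu.
Qed.

Let exchangeF z := cint_exchange (cmeasF z) (integrable_normc_gk (2 * z) a_gt0)
  (cinteg_normc measurableT iu) (F_le z).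

Let cintF_integ z : cinteg mu setT (fun x => cint mu setT (fun t => F z (x, t))).
Proof.
apply: (@cinteg_leT _ _ R mu _ (fun x : R => (\int[mu]_t normc (u t)) * normc (gk a (2 * z) x))).
- exact: (exchangeF z).1.
- by apply: integrable_scale => //; exact: integrable_normc_gk.
- by move=> x; exact: cintF_le.
Qed.

Lemma frft_bargmann_integrable : bargmann_integrable (frft_integral al u).
Proof.
move=> z; apply: (@eq_cinteg _ _ R mu setT (fun x : R => D z * cint mu setT (fun t => F z (x, t)))) => //.
exact: cintegZ.
Qed.

(** The kernel identity at z = 0, multiplied by exp(x^2), exhibits the transform as a measurable
    partial integral of [F 0]. *)
Lemma cmeas_frft : cmeas (frft_integral al u).
Proof.
have -> : frft_integral al u = fun x => D 0 * cint mu setT (fun t => F 0 (x, t)) * cexp (x%:C ^+ 2).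
  apply/funext => x; rewrite -frft_kernel -mulrA -cexpD.
  by rewrite (_ : _ + _ = 0) ?cexp0 ?mulr1//; ring.
apply: cmeasM; first by apply: cmeasM; [exact: cmeas_cst|exact: (exchangeF 0).1].
by apply: cmeas_cexp; apply: cmeasX; exact: cmeas_real.
Qed.

Lemma bargmann_frft z : bargmann (frft_integral al u) z = bargmann u (cexp (- 'i%C * al%:C) * z).
Proof.
rewrite /bargmann -![cintegral _]/(cint mu setT _); congr (_ * _).
have -> : cint mu setT (fun x => frft_integral al u x * cexp (2 * x%:C * z - x%:C ^+ 2 - z ^+ 2 / 2)) =
    cint mu setT (fun x => D z * cint mu setT (fun t => F z (x, t))).
  by apply: eq_cint => x _; exact: frft_kernel.
rewrite cintZ// (exchangeF z).2.
set w := cexp (- 'i%C * al%:C).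
pose kern t : C := cexp (2 * t%:C * (w * z) - t%:C ^+ 2 - (w * z) ^+ 2 / 2).
have ikern : cinteg mu setT (fun t => u t * kern t).
  (* Since 2 t r - t^2 <= r^2 with r = Re (w z), the Bargmann kernel is bounded in t. *)
  apply: (@cinteg_leT _ _ R mu _ (fun t : R => expR (Re (w * z) ^+ 2 - Re ((w * z) ^+ 2 / 2)) * normc (u t))).
  - apply: cmeasM mu_ _; apply: cmeas_cexp; apply: cmeasB; last exact: cmeas_cst.
    apply: cmeasB; last by apply: cmeasX; exact: cmeas_real.
    by apply: cmeasM; [apply: cmeasM; [exact: cmeas_cst|exact: cmeas_real]|exact: cmeas_cst].
  - by apply: integrable_scale => //; exact: cinteg_normc iu.
  move=> t; rewrite (normcM (u t)) mulrC ler_wpM2r ?normc_ge0// normc_cexp ler_expR.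
  have -> : 2 * t%:C * (w * z) = (2 * t)%:C * (w * z) by rewrite rmorphM/= rmorph_nat.
  have -> : t%:C ^+ 2 = (t * t)%:C * 1 :> C by rewrite mulr1 rmorphM/= expr2.
  rewrite !(ReD, ReN) !Re_scale (Re_nat 1).
  have := sqr_ge0 (Re (w * z) - t); rewrite sqrrB; lra.
have aw := frft_rotation s0; rewrite -/a -/w in aw.
have a0 : a != 0 by apply: contraTneq a_gt0 => ->; rewrite ltxx.
have ai : a^-1 = 'i%C * w * (sin al)%:C by apply: (mulfI a0); rewrite mulfV.
have sa0 : sqrtc a != 0 by rewrite sqrtc_eq0.
have sp0 : (Num.sqrt pi)%:C != 0 :> C.
  by rewrite -normc_gt0 normc_real normr_gt0 gt_eqF// sqrtr_gt0 pi_gt0.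
pose K : C := (Num.sqrt pi)%:C / sqrtc a * cexp (z ^+ 2 / 2).
have -> : cint mu setT (fun t => cint mu setT (fun x => F z (x, t))) =
    cint mu setT (fun t => K * (u t * kern t)).
  apply: eq_cint => t _.
  transitivity (cint mu setT (fun x => (chirp t * u t) * gk a (2 * z - 2 * 'i%C * (csc al)%:C * t%:C) x)).
    by apply: eq_cint => x _; rewrite mulrC.
  rewrite cintZ//; last exact: gk_integ1.
  rewrite gauss_integral_complex//.
  set b := 2 * z - _.
  transitivity ((Num.sqrt pi)%:C / sqrtc a * (u t * (chirp t * cexp (b ^+ 2 / (4 * a))))); first ring.
  transitivity ((Num.sqrt pi)%:C / sqrtc a * (u t * (cexp (z ^+ 2 / 2) * kern t))); last first.
    by rewrite /K; ring.
  (* The exponents are rational in z, t, cos and sin once 1/a is replaced by i w sin alpha; they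
     agree modulo i^2 = -1 and cos^2 = 1 - sin^2. *)
  congr (_ * (_ * _)); rewrite /chirp /kern -!cexpD; congr cexp.
  rewrite invfM ai /b (_ : (csc al)%:C = (sin al)%:C^-1); last by rewrite /csc fmorphV.
  rewrite cotE /w cexp_angle; have S0 := realC_neq0 s0.
  have i2 := sqr_i; have cs := cos_sqrC al.
  by field: i2 cs.
have e1 : cexp (- (z ^+ 2 / 2)) * cexp (z ^+ 2 / 2) = 1 by rewrite -cexpD addNr cexp0.
have DK : D z * K = 1.
  by rewrite -[RHS]e1 /D /K; field; rewrite sa0 sp0.
by rewrite cintZ// mulrA DK mul1r.
Qed.

End Kernel.

End FractionalFourier.

(** * Passage to L^2, and the conjugated operator *)

Section Conjugation.
Context {R : realType}.
Local Notation C := R[i].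
Local Notation Re := (@complex.Re R).
Local Notation Im := (@complex.Im R).
Local Notation mu := (@lebesgue_measure R).
Implicit Types (u h g k q : R -> C) (f : C -> C) (z c : C).

Lemma cvg_normc_unique (F : nat -> C) z z' :
  normc (F n - z) @[n --> \oo] --> 0 -> normc (F n - z') @[n --> \oo] --> 0 -> z = z'.
Proof.
move=> c1 c2; apply/eqP; rewrite -subr_eq0 -normc_eq0; apply/eqP/le_anti.
rewrite normc_ge0 andbT; apply/ler_addgt0Pr => e e0; rewrite add0r.
have e20 : 0 < e / 2 by rewrite divr_gt0.
have /cvgrPdist_le/(_ _ e20) h1 := c1; have /cvgrPdist_le/(_ _ e20) h2 := c2.
have [N _ hN] := filterI h1 h2.
have [a b] := hN N (leqnn N).
have -> : z - z' = (F N - z') - (F N - z) by ring.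
apply: (le_trans (le_normcB _ _)).
have := a; have := b; rewrite !sub0r !normrN !ger0_norm ?normc_ge0//; lra.
Qed.

Lemma fock_bargmann f : fock f -> exists h, sqint mu h /\ bargmann h = f.
Proof.
move=> ff; have ef := ff.1.
(* The coordinates of f in the normalized monomials. *)
pose a n : C := (Num.sqrt n`!%:R)%:C * taylor_coef f n.
have fin : fock_normsq f = (fine (fock_normsq f))%:E.
  rewrite fineK// ge0_fin_numE; first exact: ff.2.
  by apply: integral_ge0 => p _; exact: fock_integrand_ge0.
have aS N : \sum_(n < N) normc (a n) ^+ 2 <= fine (fock_normsq f).
  rewrite -lee_fin -fin; apply: le_trans (fock_coef_bound N ff).
  rewrite lee_fin; apply: ler_sum => n _.
  rewrite /a (normcM (Num.sqrt n`!%:R)%:C) (exprMn 2 (normc _)) normc_real.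
  by rewrite ger0_norm ?sqrtr_ge0// sqr_sqrtr ?ler0n.
have [h [sh _ hB]] := riesz_fischer aS.
exists h; split => //; apply/funext => z.
apply: (cvg_normc_unique (hB z)).
have -> : (fun N => normc (\sum_(n < N) a n * nmono z n - f z)) =
    (fun N => normc (f z - \sum_(n < N) taylor_coef f n * z ^+ n)).
  apply/funext => N; rewrite normcC; congr (normc (_ - _)); apply: eq_bigr => n _.
  rewrite /a /nmono; have s0 : (Num.sqrt n`!%:R)%:C != 0 :> C.
    by apply: realC_neq0; rewrite gt_eqF// sqrt_fact_gt0.
  by field.
by have := taylor_cvg z ef; rewrite (cvg_shiftS (fun N => normc (f z - \sum_(n < N) taylor_coef f n * z ^+ n))).
Qed.

Lemma bargmann_rotate k c : sqint mu k -> normc c = 1 ->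
  exists q, [/\ sqint mu q, (sqnorm mu q <= 2%:E * sqnorm mu k)%E &
    forall z, bargmann q z = bargmann k (c * z)].
Proof.
move=> sk c1; pose a n := hcoef k n * c ^+ n.
have aS N : \sum_(n < N) normc (a n) ^+ 2 <= rsqnorm k.
  apply: le_trans (bessel_le N sk); apply: ler_sum => n _.
  by rewrite /a (normcM (hcoef k n)) normcX c1 expr1n mulr1.
have [q [sq nq qB]] := riesz_fischer aS.
exists q; split => //; first by rewrite (sqnorm_rsqnorm sk) -EFinM.
move=> z; apply: (cvg_normc_unique (qB z)).
have := bargmann_expansion (c * z) sk.
have -> : (fun N => normc (\sum_(n < N) hcoef k n * nmono (c * z) n - bargmann k (c * z))) =
    (fun N => normc (\sum_(n < N) a n * nmono z n - bargmann k (c * z))) => //.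
apply/funext => N; congr (normc (_ - _)); apply: eq_bigr => n _.
by rewrite /a /nmono exprMn; ring.
Qed.

Lemma bargmannB u h : bargmann_integrable u -> bargmann_integrable h -> forall z,
  bargmann (fun x => u x - h x) z = bargmann u z - bargmann h z.
Proof.
move=> iu ih z; rewrite /bargmann -![cintegral _]/(cint mu setT _) -mulrBr -cintB//.
by congr (_ * _); apply: eq_cint => x _; rewrite mulrBl.
Qed.

Lemma bargmann_integrableB u h : bargmann_integrable u -> bargmann_integrable h ->
  bargmann_integrable (fun x => u x - h x).
Proof.
move=> iu ih z; apply: (@eq_cinteg _ _ R mu setT _ _ measurableT _ (cintegB measurableT (iu z) (ih z))).
by move=> x _; rewrite mulrBl.
Qed.

Lemma sqint_bargmann_integrable h : sqint mu h -> bargmann_integrable h.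
Proof.
move=> sh z; have i := cintegZ bconst%:C^-1 measurableT (sqintM_integ sh (sqint_bkern z)).
apply: (@eq_cinteg _ _ R mu setT _ _ measurableT _ i) => x _.
have b0 := realC_neq0 (lt0r_neq0 (@bconst_gt0 R)).
by rewrite /bkern mulrCA (mulKf b0).
Qed.

Lemma indic_le1 (D : set R) x : 0 <= (\1_D x : R) <= 1.
Proof. by rewrite indicE; case: (_ \in _); rewrite ?lexx ?ler01. Qed.

(** Provides approximants in L^1 and L^2, without which the condition in [extends_to] would be
    vacuous. *)
Lemma truncation h (d : R) : sqint mu h -> 0 < d ->
  exists u, [/\ inL1 u, inL2 u & (norm2 (fun x => u x - h x)%R < d%:E)%E].
Proof.
move=> sh d0; have mh := sh.1.
pose J (n : nat) : set R := `[- n%:R, n%:R]%classic.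
have mJ n : measurable (J n) by exact: measurable_itv.
pose u n x : C := (\1_(J n) x)%:C * h x.
have mI n : cmeas (fun x => (\1_(J n) x : R)%:C) by apply: cmeas_real; exact: measurable_indic.
have mu_ n : cmeas (u n) by exact: cmeasM.
(* This is |u n - h|^2, taken as a complex function to fit [cint_dominated]. *)
pose F n x : C := ((\1_(J n) x - 1) ^+ 2 * normc (h x) ^+ 2)%:C.
have nF n x : normc (F n x) <= normc (h x) ^+ 2.
  have /andP[h0 h1] := indic_le1 (J n) x.
  rewrite /F normc_real ger0_norm; last exact: mulr_ge0 (sqr_ge0 _) (sqr_ge0 _).
  apply: ler_piMl; first exact: sqr_ge0.
  by rewrite -sqrrN opprB expr_le1//; lra.
have mF n : cmeas (F n).
  apply: cmeas_real; apply: measurable_funM.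
    by apply: measurable_funX; apply: measurable_funB => //; exact: measurable_indic.
  by apply: measurable_funX; exact: measurable_normc.
have cF x : normc (F n x - 0) @[n --> \oo] --> 0.
  apply/cvgrPdist_le => e e0; near=> n.
  have xn : `|x| <= n%:R by near: n; exact: nbhs_infty_ger.
  have -> : F n x = 0.
    have Jx : J n x by rewrite /J/= in_itv/= -ler_norml.
    by rewrite /F indicE (mem_set Jx) subrr expr0n mul0r.
  by rewrite subr0 normc0 subr0 normr0 ltW.
have [i0 c0] := @cint_dominated _ _ R mu F (fun=> 0) (fun x : R => normc (h x) ^+ 2) setT
  measurableT mF (@cmeas_cst _ _ R 0) (fun x _ => cF x) (sqint_integrable sh) (fun n x _ => nF n x).
have d20 : 0 < d ^+ 2 by rewrite exprn_gt0.
have /cvgrPdist_lt/(_ _ d20) [n _ /(_ n (leqnn n))] := c0.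
rewrite sub0r normrN => hn.
have su : sqint mu (u n).
  split; first exact: mu_; apply: le_lt_trans sh.2; apply: ge0_le_integral => //.
  - by move=> x _; rewrite lee_fin sqr_ge0.
  - exact: (measurable_sqnorm (mu_ n)).
  - exact: (measurable_sqnorm mh).
  move=> x _; rewrite lee_fin /u (normcM (\1_(J n) x)%:C) (exprMn 2 (normc _)).
  have /andP[h0 h1] := indic_le1 (J n) x.
  rewrite normc_real ger0_norm//; apply: ler_piMl; first exact: sqr_ge0.
  by rewrite expr_le1.
exists (u n); split; last 2 first.
- exact/inL2P.
- apply/norm2_lt => //.
  have sd : sqint mu (fun x => u n x - h x) by exact: sqintB.
  rewrite (sqint_fin sd) lte_fin.
  have -> : \int[mu]_x (normc (u n x - h x) ^+ 2) = \int[mu]_x Re (F n x).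
    apply: eq_Rintegral => x _; rewrite /F /u [RHS]/=.
    have -> : (\1_(J n) x)%:C * h x - h x = (\1_(J n) x - 1)%:C * h x.
      by rewrite rmorphB/= mulrBl mul1r.
    rewrite (normcM (\1_(J n) x - 1)%:C) (exprMn 2 (normc _)) normc_real.
    by rewrite real_normK ?num_real.
  apply: le_lt_trans hn; rewrite ger0_norm ?normc_ge0//.
  have -> : cint mu setT (fun=> 0 : C) = 0.
    by rewrite /cint /Rintegral !integral0.
  rewrite subr0; apply: le_trans (normr_Re_le _); exact: ler_norm.
apply/inL1P; split => //.
(* On a bounded interval L^2 lies in L^1, because |h| <= 1 + |h|^2. *)
apply: (@cinteg_leT _ _ R mu _ (fun x : R => \1_(J n) x + normc (h x) ^+ 2)); first exact: mu_.
  have i := integrableD measurableT (integrable_indic_itv (- n%:R) n%:R true false) (sqint_integrable sh).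
  by apply: eq_integrable i => // x _; rewrite /= EFinD.
move=> x; rewrite /u (normcM (\1_(J n) x)%:C) normc_real indicE.
by case: (x \in J n) => /=; rewrite ?normr0 ?normr1 ?mul0r ?mul1r ?add0r ?sqr_ge0//; nra.
Unshelve. all: by end_near.
Qed.

Lemma Rintegral_opp (v : R -> R) : measurable_fun setT v ->
  \int[mu]_x v (- x) = \int[mu]_x v x.
Proof.
move=> mv.
have ge0 (w : R -> \bar R) : measurable_fun setT w -> (forall x, (0 <= w x)%E) ->
    (\int[mu]_x w (- x)%R = \int[mu]_x w x)%E.
  move=> mw w0.
  pose phi : measurableTypeR R -> measurableTypeR R := fun x : R => - x.
  have mphi : measurable_fun setT phi by exact: oppr_measurable.
  have := @ge0_integral_pushforward _ _ _ _ R phi mphi mu setT w measurableT mw (fun y _ => w0 y).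
  rewrite preimage_setT => <-.
  by apply: eq_measure_integral => A mA _; exact: lebesgue_measureN.
have mv' : measurable_fun setT (EFin \o v) by exact/measurable_EFinP.
congr fine; rewrite integralE [RHS]integralE.
have p := ge0 ((EFin \o v)^\+)%E (measurable_funepos mv') (fun x => funepos_ge0 _ x).
have n := ge0 ((EFin \o v)^\-)%E (measurable_funeneg mv') (fun x => funeneg_ge0 _ x).
congr (_ - _)%E.
  by apply: etrans p; apply: eq_integral => x _; rewrite !funeposE.
by apply: etrans n; apply: eq_integral => x _; rewrite !funenegE.
Qed.

Lemma bargmann_opp h z : cmeas h -> bargmann (fun x => h (- x)) z = bargmann h (- z).
Proof.
move=> mh; rewrite /bargmann -![cintegral _]/(cint mu setT _); congr (_ * _).
pose v x := h x * cexp (2 * x%:C * (- z) - x%:C ^+ 2 - (- z) ^+ 2 / 2).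
have mv : cmeas v.
  apply: cmeasM => //; apply: cmeas_cexp; apply: cmeasB; last exact: cmeas_cst.
  apply: cmeasB; last by apply: cmeasX; exact: cmeas_real.
  by apply: cmeasM; [apply: cmeasM; [exact: cmeas_cst|exact: cmeas_real]|exact: cmeas_cst].
transitivity (cint mu setT (fun x => v (- x))).
  by apply: eq_cint => x _; rewrite /v; congr (_ * cexp _); rewrite rmorphN/=; ring.
by congr (_ +i* _); [exact: (Rintegral_opp mv.1)|exact: (Rintegral_opp mv.2)].
Qed.

Lemma bargmann_inv_spec f : fock f -> inL2 (bargmann_inv f) /\ bargmann (bargmann_inv f) = f.
Proof.
move=> /fock_bargmann[h [sh hf]].
apply: (@xgetPex _ (fun=> 0) [set h | inL2 h /\ bargmann h = f]).
by exists h; split => //; exact/inL2P.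
Qed.

Section NonDegenerate.
Context (al : R) (h : R -> C).
Context (s0 : sin al != 0).
Context (sh : sqint mu h).

Let w : C := cexp (- 'i%C * al%:C).

Lemma normc_rotation : normc w = 1.
Proof.
rewrite /w normc_cexp (_ : - 'i%C * al%:C = (- al)%:C * 'i%C); last by rewrite rmorphN/=; ring.
by rewrite Re_scale/= mulr0 expR0.
Qed.

Lemma frft_extends g : sqint mu g -> (forall z, bargmann g z = bargmann h (w * z)) ->
  extends_to (frft_integral al) h g.
Proof.
move=> sg Bg; split; first exact/inL2P.
(* The norm bound for [q] turns (e/2)^2 into e^2 / 2, still below e^2. *)
move=> e e0; exists (e / 2) => [|u /inL1P[mu_ iu] /inL2P su]; first by rewrite divr_gt0.
have sk : sqint mu (fun x => u x - h x) by exact: sqintB.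
move=> /(norm2_lt _ (_ : 0 < e / 2)) -/(_ ltac:(by rewrite divr_gt0)) nk.
have [q [sq nq Bq]] := bargmann_rotate sk normc_rotation.
pose A := frft_integral al u.
have mA : cmeas A := cmeas_frft al mu_ iu.
have iA : bargmann_integrable A := frft_bargmann_integrable al mu_ iu.
have ig := sqint_bargmann_integrable sg; have iq := sqint_bargmann_integrable sq.
have iAg := bargmann_integrableB iA ig.
have mAg : cmeas (fun x => A x - g x) by apply: cmeasB => //; exact: sg.1.
have : {ae mu, forall x, A x - g x - q x = 0}.
  apply: bargmann_inj.
  - by apply: cmeasB => //; exact: sq.1.
  - exact: bargmann_integrableB.
  move=> z; rewrite !bargmannB// (bargmann_frft s0 mu_ iu) Bg Bq -/w.
  rewrite bargmannB ?subrr//; exact: sqint_bargmann_integrable.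
move=> ae0; apply/(norm2_lt _ e0).
have -> : sqnorm mu (fun x => A x - g x) = sqnorm mu q.
  apply: (@ae_eq_sqnorm _ _ R mu _ _ mAg sq.1); move: ae0; apply: filterS; first exact: (ae_filter_ringOfSetsType mu).
  by move=> x /eqP; rewrite subr_eq0 => /eqP.
apply: (le_lt_trans nq); move: nk; rewrite (sqint_fin sk) -EFinM !lte_fin.
set r := \int[mu]_x _; have := exprn_gt0 2 e0; rewrite exprMn; lra.
Qed.

(** Uniqueness of the extension as seen by the Bargmann transform: both functions are close to [B u]
    for a common truncation [u] of [h]. It makes the choice in [frft] immaterial. *)
Lemma extends_to_bargmann (B : (R -> C) -> R -> C) g g' :
  extends_to B h g -> extends_to B h g' ->
  (forall u, inL1 u -> inL2 u -> cmeas (B u)) -> forall z, bargmann g z = bargmann g' z.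
Proof.
move=> [/inL2P sg hg] [/inL2P sg' hg'] mB z.
have sd : sqint mu (fun x => g x - g' x) by exact: sqintB.
have small e : 0 < e -> (sqnorm mu (fun x => g x - g' x)%R <= (4 * e ^+ 2)%:E)%E.
  move=> e0; have [d d0 hd] := hg e e0; have [d' d'0 hd'] := hg' e e0.
  have dd : 0 < Num.min d d' by rewrite lt_min d0.
  have [u [u1 u2 ud]] := truncation sh dd.
  have ul : (norm2 (fun x => u x - h x)%R < d%:E)%E.
    by apply: lt_le_trans ud _; rewrite lee_fin ge_min lexx.
  have ul' : (norm2 (fun x => u x - h x)%R < d'%:E)%E.
    by apply: lt_le_trans ud _; rewrite lee_fin ge_min lexx orbT.
  have /(norm2_lt _ e0)/ltW n1 := hd u u1 u2 ul.
  have /(norm2_lt _ e0)/ltW n2 := hd' u u1 u2 ul'.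
  apply: (le_trans (sqnorm_triangle mu sg.1 (mB u u1 u2) sg'.1)).
  rewrite -(sqnormN mu (fun x => g x - B u x)).
  rewrite (@eq_sqnorm _ _ _ mu (fun x => - (g x - B u x)) (fun x => B u x - g x)); last first.
    by move=> x; rewrite opprB.
  have -> : ((4 * e ^+ 2)%:E = 2%:E * (e ^+ 2)%:E + 2%:E * (e ^+ 2)%:E)%E.
    by rewrite -!EFinM -EFinD; congr (_%:E); ring.
  by apply: leeD; apply: lee_wpmul2l.
have sd0 : (sqnorm mu (fun x => g x - g' x)%R <= 0%:E)%E.
  apply/lee_addgt0Pr => e e0; rewrite add0e.
  apply: (le_trans (small (Num.sqrt (e / 4)) _)); first by rewrite sqrtr_gt0 divr_gt0.
  rewrite sqr_sqrtr; last by rewrite divr_ge0// ltW.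
  by rewrite lee_fin mulrC divfK.
apply/eqP; rewrite -subr_eq0 -(bargmannB (sqint_bargmann_integrable sg) (sqint_bargmann_integrable sg')).
rewrite bargmannE// -normc_eq0; apply/eqP/le_anti; rewrite normc_ge0 andbT.
apply/ler_addgt0Pr => e e0; rewrite add0r.
(* With the squared norm of g - g' bounded by 0, this weight turns the bound on the pairing into
   exactly e. *)
have t0 : 0 < expR (normc z ^+ 2) / e by rewrite divr_gt0// expR_gt0.
have := normc_cintM_le sd (sqint_bkern z) t0 sd0.
rewrite sqnorm_bkern => /(_ _ (lexx _)); rewrite mulr0 add0r invfM invrK mulrA.
by rewrite divff ?mul1r// gt_eqF// expR_gt0.
Qed.

End NonDegenerate.

Lemma frft_rotates al h z : sqint mu h ->
  bargmann (frft al h) z = bargmann h (cexp (- 'i%C * al%:C) * z).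
Proof.
move=> sh; rewrite /frft; case: eqP => [sin0|/eqP sin0].
  (* When sin alpha = 0 the rotation is cos alpha = 1 or -1, matching the identity and the
     reflection of the line. *)
  rewrite cexp_angle sin0 rmorph0 mulr0 subr0.
  case: eqP => [->|cos1]; first by rewrite rmorph1 mul1r.
  have -> : cos al = -1.
    have := cos2sin2 al; rewrite sin0 expr0n subr0 => /eqP; rewrite sqrf_eq1.
    by case/orP => /eqP.
  by rewrite bargmann_opp ?rmorphN1 ?mulN1r//; exact: sh.1.
set P := [set g | _].
have [g [sg _ Bg]] := bargmann_rotate sh (normc_rotation al).
have eg := frft_extends sin0 sh sg Bg.
have eg' : P (xget (fun=> 0) P) by apply: xgetPex; exists g.
rewrite (extends_to_bargmann sh eg' eg) ?Bg// => u /inL1P[mu_ iu] _.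
exact: cmeas_frft.
Qed.

End Conjugation.

Theorem theorem3 (R : realType) (alpha : R)
    (T := fun f : R[i] -> R[i] => bargmann (frft alpha (bargmann_inv f)))
    (f : R[i] -> R[i]) (hf : fock f) :
  fock (T f) /\
  forall z : R[i], T f z = f (cexp (- 'i%C * alpha%:C) * z).
Proof.
have [/inL2P sh Bh] := bargmann_inv_spec hf.
have Tf z : T f z = f (cexp (- 'i%C * alpha%:C) * z) by rewrite /T frft_rotates ?Bh.
split => //; rewrite (_ : T f = fun z => f (cexp (- 'i%C * alpha%:C) * z)); last exact/funext.
by apply: fock_rotate => //; exact: normc_rotation.
Qed.
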